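(* Let $(w(t))_{t\ge0}$ be a Brownian motion on the quaternionic projective space $\mathbb{H}P^n$ started at $0$, with quaternionic stochastic area process $\mathfrak a(t)$, and let $(\Theta(t))_{t\ge0}$ be the $\mathbf{SU}(2)$-valued solution, started from the identity, of the Stratonovich stochastic differential equation $$d\Theta(t)=-\Theta(t)\circ d\mathfrak a(t).$$ The $\mathbb{S}^{4n+3}$-valued diffusion process $$X_t=\frac{\Theta(t)}{\sqrt{1+|w(t)|^2}}\,\big(w(t),1\big),\qquad t\ge0,$$ is the horizontal lift at the north pole of $(w(t))_{t\ge0}$ by the submersion $\mathbb{S}^{4n+3}\to\mathbb{H}P^n$.
   Context: $n\ge1$. $\mathbb{H}$ is the field of quaternions with units $I,J,K$ (realized as $2\times2$ matrices, so that $\mathbf{SU}(2)$ is the group of unit quaternions and $\mathfrak{su}(2)\simeq\mathbb{R}^3$ is the space of imaginary quaternions $xI+yJ+zK$, with $I,J,K$ as orthonormal basis). $\mathbb{S}^{4n+3}=\{q\in\mathbb{H}^{n+1}:|q|^2=1\}$ with its round metric. $\mathbf{SU}(2)$ acts on it isometrically by left multiplication, and the quotient is $\mathbb{H}P^n$ with inhomogeneous coordinates $w_i=q_{n+1}^{-1}q_i$, $1\le i\le n$ (defined where $q_{n+1}\ne0$), equipped with the Riemannian metric making the projection $\pi:\mathbb{S}^{4n+3}\to\mathbb{H}P^n$ a Riemannian submersion, i.e. $\frac{\sum_j|dw_j|^2}{1+|w|^2}-\frac{|\sum_j dw_j\overline{w_j}|^2}{(1+|w|^2)^2}$. $0$ is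 the point with $w_1=\dots=w_n=0$; Brownian motion on $\mathbb{H}P^n$ has generator $\frac12\Delta_{\mathbb{H}P^n}$ (half the Laplace–Beltrami operator); almost surely it stays in the domain of the coordinates $w$ for all times. The quaternionic stochastic area process of $(w(t))$ is the $\mathfrak{su}(2)\simeq\mathbb{R}^3$-valued process $$\mathfrak a(t)=\frac12\sum_{j=1}^n\int_0^t\frac{dw_j(s)\overline{w_j}(s)-w_j(s)d\overline{w_j}(s)}{1+|w(s)|^2}$$ (Stratonovich, equivalently Itô, integrals). The north pole is $(0,\dots,0,1)\in\mathbb{H}^{n+1}$. The horizontal distribution of $\pi$ is the orthogonal complement of the tangent spaces to the fibers, equivalently the kernel of $\alpha=\frac12\sum_{i=1}^{n+1}(dq_i\overline{q_i}-q_id\overline{q_i})$. The horizontal lift of $w$ at the north pole is the semimartingale $X$ on $\mathbb{S}^{4n+3}$ started at the north pole with $\pi(X_t)=w(t)$ and $\int_{X[0,t]}\alpha=0$ (Stratonovich) for all $t\ge0$. *)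

(* Defs.v *)
From HB Require Import structures.
From mathcomp Require Import all_boot all_order all_algebra.
From mathcomp Require Import all_classical all_reals all_analysis.

Set Implicit Arguments.
Unset Strict Implicit.
Unset Printing Implicit Defensive.

Import Order.TTheory GRing.Theory Num.Theory.
Import numFieldNormedType.Exports.

Local Open Scope classical_set_scope.
Local Open Scope ring_scope.

(* A quaternion a + b I + c J + d K is the row vector (a, b, c, d), and a vector
   of H^m is an m x 4 matrix, one quaternion per row. *)
Notation quat R := 'rV[R]_4.
Notation hvec R m := 'M[R]_(m, 4).

Section Quaternions.
Context {R : realType}.

Definition mkquat (a b c d : R) : quat R := \row_k nth 0 [:: a; b; c; d] k.

Definition qcoord (q : quat R) (k : nat) : R := q ord0 (inord k).

Definition qone : quat R := mkquat 1 0 0 0.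

Definition qmul (p q : quat R) : quat R :=
  let: (a, b, c, d) := (qcoord p 0, qcoord p 1, qcoord p 2, qcoord p 3) in
  let: (x, y, z, t) := (qcoord q 0, qcoord q 1, qcoord q 2, qcoord q 3) in
  mkquat (a * x - b * y - c * z - d * t)
         (a * y + b * x + c * t - d * z)
         (a * z - b * t + c * x + d * y)
         (a * t + b * z - c * y + d * x).

Definition qconj (q : quat R) : quat R :=
  mkquat (qcoord q 0) (- qcoord q 1) (- qcoord q 2) (- qcoord q 3).

(* real inner product of H^m = R^(4m) *)
Definition hdot m (h k : hvec R m) : R := \sum_i \sum_j h i j * k i j.

Definition hnorm2 m (h : hvec R m) : R := hdot h h.

Definition qinv (q : quat R) : quat R := (hnorm2 q)^-1 *: qconj q.

Definition SU2 : set (quat R) := [set q | hnorm2 q = 1].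

Definition hlmul m (q : quat R) (h : hvec R m) : hvec R m :=
  \matrix_(i, j) qmul q (row i h) ord0 j.

(* the value on the tangent vector h at q of the su(2)-valued one-form
   1/2 \sum_i (dq_i conj(q_i) - q_i dconj(q_i)) *)
Definition alpha_form m (q h : hvec R m) : quat R :=
  2^-1 *: \sum_i (qmul (row i h) (qconj (row i q))
                  - qmul (row i q) (qconj (row i h))).

(* the su(2)-valued one-form on H^n, chart of HP^n, whose line integral is the
   quaternionic stochastic area *)
Definition area_form n (w h : hvec R n) : quat R :=
  (1 + hnorm2 w)^-1 *: alpha_form w h.

End Quaternions.

(* S^(4n+3) in H^(n+1): a point is (q_1, ..., q_n, q_(n+1)), where the rows
   q_1, ..., q_n are those of usubmx q and q_(n+1) is dsubmx q. *)
Section Geometry.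
Context {R : realType} {n : nat}.

Definition sphere : set (hvec R (n + 1)) := [set q | hnorm2 q = 1].

Definition north_pole : hvec R (n + 1) := col_mx 0 qone.

(* [in_chart q w]: w is the vector of inhomogeneous coordinates
   w_i = q_(n+1)^-1 q_i of the class of q in HP^n *)
Definition in_chart (q : hvec R (n + 1)) (w : hvec R n) : Prop :=
  dsubmx q != 0 /\ hlmul (qinv (dsubmx q)) (usubmx q) = w.

(* polarization of
   \sum_j |dw_j|^2 / (1 + |w|^2) - |\sum_j dw_j conj(w_j)|^2 / (1 + |w|^2)^2 *)
Definition HP_metric (w h k : hvec R n) : R :=
  let s (v : hvec R n) := \sum_j qmul (row j v) (qconj (row j w)) in
  hdot h k / (1 + hnorm2 w) - hdot (s h) (s k) / (1 + hnorm2 w) ^+ 2.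

(* basis of the real vector space H^n *)
Definition hbasis (a : 'I_(n * 4)) : hvec R n := vec_mx (delta_mx 0 a).

Definition gram (g : hvec R n -> hvec R n -> hvec R n -> R) (x : hvec R n) :
  'M[R]_(n * 4) := \matrix_(a, b) g x (hbasis a) (hbasis b).

(* |g|^(-1/2) \sum_(a, b) d_a (|g|^(1/2) g^(ab) d_b f) *)
Definition laplace_beltrami (g : hvec R n -> hvec R n -> hvec R n -> R)
    (f : hvec R n -> R) (x : hvec R n) : R :=
  (Num.sqrt (\det (gram g x)))^-1 *
  \sum_a \sum_b
    'D_(hbasis a) (fun y => Num.sqrt (\det (gram g y)) * invmx (gram g y) a b
                            * 'D_(hbasis b) f y) x.

Fixpoint iter_derive (s : seq (hvec R n)) (f : hvec R n -> R) :
    hvec R n -> R :=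
  if s is v :: s' then 'D_v (iter_derive s' f) else f.

Definition smooth (f : hvec R n -> R) : Prop :=
  forall s, continuous (iter_derive s f) /\
            forall x v, derivable (iter_derive s f) x v.

End Geometry.

(* Processes are indexed by R; only times t >= 0 matter. Path properties are
   almost sure. *)
Section Processes.
Context {R : realType} {d : measure_display} {Omega : measurableType d}.
Variables (P : probability Omega R) (F : R -> set (set Omega)).

(* filtrations satisfying the usual conditions *)
Record usual_filtration : Prop := UsualFiltration {
  filtration_sigma : forall t, 0 <= t -> sigma_algebra setT (F t);
  filtration_measurable : forall t, 0 <= t -> F t `<=` measurable;
  filtration_monotone : forall s t, 0 <= s -> s <= t -> F s `<=` F t;
  filtration_right_cont : forall t, 0 <= t ->
    F t = \bigcap_(s in [set s | t < s]) F s;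
  filtration_complete : P.-negligible `<=` F 0 }.

Definition adapted (X : R -> Omega -> R) : Prop :=
  forall t, 0 <= t -> forall B : set R, measurable B -> F t (X t @^-1` B).

Definition continuous_paths (X : R -> Omega -> R) : Prop :=
  {ae P, forall x, {within `[0, +oo[, continuous (X ^~ x)}}.

Definition martingale (M : R -> Omega -> R) : Prop :=
  [/\ adapted M,
      forall t, 0 <= t -> P.-integrable setT (EFin \o M t) &
      forall s t, 0 <= s -> s <= t -> forall A, F s A ->
        (\int[P]_(x in A) (M t x)%:E = \int[P]_(x in A) (M s x)%:E)%E].

Definition stopping_time (tau : Omega -> \bar R) : Prop :=
  (forall x, (0 <= tau x)%E) /\
  forall t, 0 <= t -> F t [set x | (tau x <= t%:E)%E].

Definition stopped (M : R -> Omega -> R) (tau : Omega -> \bar R) :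
    R -> Omega -> R :=
  fun t x => M (fine (mine t%:E (tau x))) x.

Definition cont_local_martingale (M : R -> Omega -> R) : Prop :=
  [/\ adapted M, continuous_paths M &
      exists tau : nat -> Omega -> \bar R,
      [/\ forall k, stopping_time (tau k),
          {ae P, forall x, {homo tau ^~ x : k l / (k <= l)%N >-> (k <= l)%E} /\
                           tau ^~ x @ \oo --> +oo%E} &
          forall k, martingale (fun t x => stopped M (tau k) t x - M 0 x)]].

Definition cont_finite_variation (A : R -> Omega -> R) : Prop :=
  [/\ adapted A, continuous_paths A &
      {ae P, forall x, forall t, 0 <= t -> bounded_variation 0 t (A ^~ x)}].

Definition cont_semimartingale (X : R -> Omega -> R) : Prop :=
  exists M A, [/\ cont_local_martingale M, cont_finite_variation A,
    adapted X &
    {ae P, forall x, forall t, 0 <= t -> X t x = M t x + A t x}].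

Definition hsemimartingale m (X : R -> Omega -> hvec R m) : Prop :=
  forall i j, cont_semimartingale (fun t x => X t x i j).

Definition cvg_in_probability (Y : nat -> Omega -> R) (Z : Omega -> R) : Prop :=
  forall e : R, 0 < e -> P [set x | e <= `|Y k x - Z x|] @[k --> \oo] --> 0%E.

(* [0 :: s] is the list of the points of the partition *)
Definition mesh_le (s : seq R) (e : R) : Prop :=
  forall i, (i < size s)%N -> nth 0 (0 :: s) i.+1 - nth 0 (0 :: s) i <= e.

(* \sum_i (eta (X_(t_i)) + eta (X_(t_(i+1)))) / 2 . (Y_(t_(i+1)) - Y_(t_i)) *)
Definition stratonovich_sum m p (eta : hvec R m -> hvec R p -> quat R)
    (X : R -> Omega -> hvec R m) (Y : R -> Omega -> hvec R p)
    (s : seq R) (x : Omega) : quat R :=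
  \sum_(0 <= i < size s)
    let t := nth 0 (0 :: s) i in
    let t' := nth 0 (0 :: s) i.+1 in
    let dY := Y t' x - Y t x in
    2^-1 *: (eta (X t x) dY + eta (X t' x) dY).

(* Z_t = \int_0^t eta(X) o dY (Fisk-Stratonovich), for semimartingales X, Y and
   a smooth eta that is linear in its second argument. With Y = X, it is the
   integral of the one-form eta along the path X[0, t]. *)
Definition stratonovich_integral m p (eta : hvec R m -> hvec R p -> quat R)
    (X : R -> Omega -> hvec R m) (Y : R -> Omega -> hvec R p)
    (Z : R -> Omega -> quat R) : Prop :=
  [/\ hsemimartingale X, hsemimartingale Y,
      forall j, adapted (fun t x => Z t x ord0 j) /\
                continuous_paths (fun t x => Z t x ord0 j) &
      forall t, 0 <= t -> forall s : nat -> seq R,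
        (forall k, itv_partition 0 t (s k)) ->
        (forall e : R, 0 < e -> \forall k \near \oo, mesh_le (s k) e) ->
        forall j, cvg_in_probability
          (fun k x => stratonovich_sum eta X Y (s k) x ord0 j)
          (fun x => Z t x ord0 j)].

Section OnProjectiveSpace.
Context {n : nat}.
Variable w : R -> Omega -> hvec R n.

(* Brownian motion on HP^n started at 0, read in the chart w, as the solution of
   the (local) martingale problem for half the Laplace-Beltrami operator *)
Definition brownian_motion_HP : Prop :=
  [/\ forall i j, adapted (fun t x => w t x i j) /\
                  continuous_paths (fun t x => w t x i j),
      {ae P, forall x, w 0 x = 0} &
      forall f : hvec R n -> R, smooth f ->
        cont_local_martingale (fun t x => f (w t x) - f (w 0 x)
          - Rintegral lebesgue_measure `[0, t]
              (fun s => 2^-1 * laplace_beltrami HP_metric f (w s x)))].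

Definition stochastic_area (a : R -> Omega -> quat R) : Prop :=
  stratonovich_integral (@area_form R n) w w a.

(* dTheta = - Theta o da, Theta(0) = 1, with values in SU(2) *)
Definition solves_area_sde (a Theta : R -> Omega -> quat R) : Prop :=
  [/\ {ae P, forall x, forall t, 0 <= t -> SU2 (Theta t x)},
      {ae P, forall x, Theta 0 x = qone} &
      stratonovich_integral (fun q h => - qmul q h) Theta a
        (fun t x => Theta t x - Theta 0 x)].

Definition horizontal_lift (X : R -> Omega -> hvec R (n + 1)) : Prop :=
  [/\ hsemimartingale X,
      {ae P, forall x, forall t, 0 <= t -> sphere (X t x)},
      {ae P, forall x, X 0 x = north_pole},
      {ae P, forall x, forall t, 0 <= t -> in_chart (X t x) (w t x)} &
      stratonovich_integral (@alpha_form R (n + 1)) X X (fun _ _ => 0)].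

End OnProjectiveSpace.

End Processes.

(* Main.v *)
Require Import Defs.
From HB Require Import structures.
From mathcomp Require Import all_boot all_order all_algebra.
From mathcomp Require Import all_classical all_reals all_analysis.
From mathcomp Require Import measurable_realfun ring lra.

Set Implicit Arguments.
Unset Strict Implicit.
Unset Printing Implicit Defensive.

Import Order.TTheory GRing.Theory Num.Theory.
Import numFieldNormedType.Exports.

Local Open Scope classical_set_scope.
Local Open Scope ring_scope.

(* Let Y = (1 + |w|^2)^(-1/2) (w, 1), a unit vector, so that X = Theta Y. If Y, Y'
   and Theta, Theta' are the values at the ends of a step of a partition, the
   Stratonovich increment of the connection form along X is
   alpha(X, X') = Im (Theta' G conj(Theta)) with G = \sum_l Y'_l conj(Y_l). The real
   part of G is 1 - |Y' - Y|^2 / 2, its imaginary part is a' - a up to an error, and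
   Theta' - Theta is - (Theta + Theta') / 2 (a' - a) up to another error; the two
   first-order contributions cancel. What remains are products of three
   increments, whose sums vanish because quadratic variations are bounded in
   probability, and the two errors weighted by processes. The error of a
   Stratonovich equation over a step has a partial sum that converges to 0 at
   each fixed time, hence uniformly by continuity of paths; summation by parts
   then shows that the sum of its squares is small, and so are its weighted sums.

   Semimartingales enter through two facts: elementary integrals against them are
   bounded in probability, and f(X) - \int f'(X) dX is nondecreasing for convex f,
   which makes them stable under products and under y |-> (1 + y)^(-1/2). *)

(** The Stratonovich hypotheses are limits of sums at fixed times, with no rate, and the conclusion
    is one more such limit; hence the whole argument is carried out on sums. A weighted error
    [\sum_i H_i e_i] cannot be bounded through the absolute values of the [e_i], whose sum need not
    be small. What is small, and adapted, is [u_j = \sum_(i < j) e_i]. In [u_j ^ 2 = \sum_i e_i ^ 2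
    + 2 \sum_i u_i e_i] the last sum expands into elementary integrals of small adapted integrands
    against semimartingales, plus sums of [u_i] times two increments. This is where the uniform
    smallness of [u] enters, and why semimartingales are used through boundedness in probability.
    The terms in which [e_i] meets the increment of a weight are then left to Cauchy-Schwarz. Almost
    sure regularity of paths is turned into regularity at every outcome by a change of version,
    which the completeness of the filtration permits. *)

Section Expectation.
Context {R : realType} {d : measure_display} {T : measurableType d}.
Context (P : probability T R).
Implicit Types f g : T -> R.

Definition itg f := P.-integrable setT (EFin \o f).
Definition Ex f : R := \int[P]_x f x.

Lemma itg_meas f : itg f -> measurable_fun setT f.
Proof. by move=> /(measurable_int P) /measurable_EFinP. Qed.

Lemma itg_bound f c : measurable_fun setT f -> (forall x, `|f x| <= c) -> itg f.
Proof.
move=> mf fc; apply: measurable_bounded_integrable => //.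
  by rewrite (le_lt_trans (probability_le1 P measurableT))// ltry.
exists (`|c| + 1); split; first exact: num_real.
move=> y cy x _; apply: ltW; apply: le_lt_trans cy.
rewrite (le_trans (fc x))// (le_trans (ler_norm c))// lerDl.
by rewrite ler01.
Qed.

Lemma itg_cst c : itg (fun=> c).
Proof. exact: (@itg_bound _ `|c|). Qed.

Lemma itgD f g : itg f -> itg g -> itg (fun x => f x + g x).
Proof.
move=> If Ig; rewrite /itg (_ : _ \o _ = (EFin \o f) \+ (EFin \o g))%E//.
exact: integrableD.
Qed.

Lemma itgZ c f : itg f -> itg (fun x => c * f x).
Proof.
move=> If; rewrite /itg (_ : _ \o _ = (fun x => c%:E * (EFin \o f) x)%E)//.
exact: integrableZl.
Qed.

Lemma itgN f : itg f -> itg (fun x => - f x).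
Proof.
by move=> /(itgZ (-1)); congr itg; apply/funext => x; rewrite mulN1r.
Qed.

Lemma itgB f g : itg f -> itg g -> itg (fun x => f x - g x).
Proof. by move=> If Ig; apply: itgD => //; exact: itgN. Qed.

Lemma itg_le f g : measurable_fun setT f -> itg g ->
  (forall x, `|f x| <= `|g x|) -> itg f.
Proof.
move=> mf Ig fg; apply: (le_integrable _ _ _ Ig) => //.
  exact/measurable_EFinP.
by move=> x _ /=; rewrite lee_fin.
Qed.

Lemma itg_abs f : itg f -> itg (fun x => `|f x|).
Proof.
move=> If; apply: (itg_le _ If) => [|x]; last by rewrite normr_id.
by apply: measurableT_comp => //; exact: itg_meas.
Qed.

Lemma itgM c f g : itg f -> measurable_fun setT g -> (forall x, `|g x| <= c) ->
  itg (fun x => f x * g x).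
Proof.
move=> If mg gc; apply: (@itg_le _ (fun x => c * f x)).
- by apply: measurable_funM => //; exact: itg_meas.
- exact: itgZ.
- move=> x; rewrite !normrM mulrC ler_wpM2r//.
  by rewrite (le_trans (gc x))// ler_norm.
Qed.

Lemma itg_sum (I : Type) (r : seq I) (f : I -> T -> R) :
  (forall i, itg (f i)) -> itg (fun x => \sum_(i <- r) f i x).
Proof.
move=> If; elim: r => [|i r IH].
  by rewrite (_ : (fun _ => _) = fun=> 0); [exact: itg_cst|
    apply/funext => x; rewrite big_nil].
rewrite (_ : (fun _ => _) = fun x => f i x + \sum_(j <- r) f j x); last first.
  by apply/funext => x; rewrite big_cons.
exact: itgD.
Qed.

Lemma ExD f g : itg f -> itg g -> Ex (fun x => f x + g x) = Ex f + Ex g.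
Proof. by move=> If Ig; exact: RintegralD. Qed.

Lemma ExZ c f : itg f -> Ex (fun x => c * f x) = c * Ex f.
Proof. by move=> If; exact: RintegralZl. Qed.

Lemma ExB f g : itg f -> itg g -> Ex (fun x => f x - g x) = Ex f - Ex g.
Proof. by move=> If Ig; exact: RintegralB. Qed.

Lemma Ex_cst c : Ex (fun=> c) = c.
Proof.
rewrite /Ex Rintegral_cst// [X in fine X](_ : _ = 1%E) ?mulr1//.
exact: probability_setT.
Qed.

Lemma Ex_le f g : itg f -> itg g -> (forall x, f x <= g x) -> Ex f <= Ex g.
Proof. by move=> If Ig fg; exact: le_Rintegral. Qed.

Lemma Ex_ge0 f : (forall x, 0 <= f x) -> 0 <= Ex f.
Proof. by move=> f0; exact: Rintegral_ge0. Qed.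

Lemma Ex_abs f : itg f -> `|Ex f| <= Ex (fun x => `|f x|).
Proof. by move=> If; exact: le_normr_Rintegral. Qed.

Lemma Ex_sum (I : Type) (r : seq I) (f : I -> T -> R) :
  (forall i, itg (f i)) ->
  Ex (fun x => \sum_(i <- r) f i x) = \sum_(i <- r) Ex (f i).
Proof.
move=> If; elim: r => [|i r IH].
  rewrite big_nil -[RHS]Ex_cst; congr Ex.
  by apply/funext => x; rewrite big_nil.
rewrite big_cons -IH -ExD//; last exact: itg_sum.
by congr Ex; apply/funext => x; rewrite big_cons.
Qed.

Lemma itg_indic (A : set T) : measurable A -> itg (\1_A).
Proof.
move=> mA; apply: (@itg_bound _ 1) => [|x]; first exact: measurable_indic.
by rewrite indicE; case: (_ \in _); rewrite ?normr1// normr0 ler01.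
Qed.

Lemma Ex_set (A : set T) f : Ex (fun x => f x * \1_A x) =
  fine (\int[P]_(x in A) (f x)%:E)%E.
Proof.
rewrite /Ex -/(Rintegral P A f) [RHS]Rintegral_mkcond; congr Rintegral.
apply/funext => x; rewrite /= /patch indicE.
by case: ifPn => _; rewrite ?mulr1 ?mulr0.
Qed.

(** Chebyshev's inequality. *)
Lemma prob_ge f (e : R) : 0 < e -> itg (fun x => f x ^+ 2) -> measurable_fun setT f ->
  (P [set x | (e <= `|f x|)%R] <= (Ex (fun x => f x ^+ 2) / e ^+ 2)%:E)%E.
Proof.
move=> e0 If mf.
have mA : measurable [set x | e <= `|f x|].
  rewrite (_ : mkset _ = (fun x => `|f x|) @^-1` `[e, +oo[).
    have mfn : measurable_fun setT (fun x => `|f x|) by exact: measurableT_comp.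
    by rewrite -[_ @^-1` _]setTI; exact: mfn.
  by apply/seteqP; split => x /=; rewrite in_itv/= andbT.
have -> : P [set x | e <= `|f x|] = (Ex \1_[set x | e <= `|f x|])%:E.
  have := integral_indic P measurableT mA; rewrite setIT => <-.
  by rewrite /Ex /Rintegral fineK//; apply: integrable_fin_num => //;
    exact: itg_indic.
rewrite lee_fin ler_pdivlMr ?exprn_gt0// mulrC -ExZ; last exact: itg_indic.
apply: Ex_le => // [|x]; first by apply/itgZ/itg_indic.
rewrite indicE; case: (boolP (x \in _)); rewrite ?mulr0 ?sqr_ge0//.
rewrite inE/= => xe; rewrite mulr1 -[f x ^+ 2]ger0_norm ?sqr_ge0// normrX.
by rewrite ler_pXn2r// ?nnegrE ?ltW.
Qed.

End Expectation.

(** * Truncation of real numbers and the size of its remainder *)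

Section Clip.
Context {R : realType}.
Implicit Types c u v : R.

(** Uniform integrability is tested below on the remainder [u - clip c u]. Its absolute value
    [max 0 (|u| - c)] is convex in [u], so that Jensen's inequality applies to it. *)
Definition clip (c u : R) : R := Num.max (- c) (Num.min c u).

Lemma clipP c u : 0 <= c -> [\/ u < - c /\ clip c u = - c,
  - c <= u <= c /\ clip c u = u | c < u /\ clip c u = c].
Proof.
move=> c0; rewrite /clip; have [h|h] := leP u c.
  have [h'|h'] := leP (- c) u; first by apply: Or32.
  by apply: Or31.
by apply: Or33; rewrite max_r//; lra.
Qed.

Lemma clip_le c u : 0 <= c -> `|clip c u| <= c.
Proof. by move=> c0; rewrite ler_norml; case: (clipP u c0) => -[h ->]; lra. Qed.

Lemma clip_id c u : `|u| <= c -> clip c u = u.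
Proof.
rewrite ler_norml => /andP[h1 h2]; have c0 : 0 <= c by lra.
by case: (clipP u c0) => -[h ->]; lra.
Qed.

Lemma clip_lip c u v : 0 <= c -> `|clip c u - clip c v| <= `|u - v|.
Proof.
move=> c0; have [h|h] := leP v u.
  rewrite [leRHS]ger0_norm ?subr_ge0// ler_norml.
  by case: (clipP u c0) => -[h1 ->]; case: (clipP v c0) => -[h2 ->]; lra.
rewrite [leRHS]ltr0_norm ?subr_lt0// ler_norml.
by case: (clipP u c0) => -[h1 ->]; case: (clipP v c0) => -[h2 ->]; lra.
Qed.

Lemma clip_rest c u : 0 <= c -> `|u - clip c u| = Num.max 0 (`|u| - c).
Proof.
move=> c0; case: (clipP u c0) => -[h ->].
- by rewrite !ltr0_norm ?max_r; lra.
- rewrite subrr normr0; have := h; rewrite -ler_norml => h'.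
  by rewrite max_l// subr_le0.
- by rewrite !gtr0_norm ?max_r; lra.
Qed.

Lemma clip_rest_le c u : 0 <= c -> `|u - clip c u| <= `|u|.
Proof. by move=> c0; rewrite clip_rest// ge_max normr_ge0/=; lra. Qed.

(** Through this inequality a bound in L^2 gives uniform integrability. *)
Lemma clip_rest_sqr c u : 0 < c -> `|u - clip c u| <= c^-1 * u ^+ 2.
Proof.
move=> c0; rewrite (clip_rest _ (ltW c0)) -real_normK ?num_real//.
rewrite mulrC ler_pdivlMr//; have := normr_ge0 u; set y := `|u| => y0.
rewrite (maxr_pMl _ _ (ltW c0)) mul0r ge_max sqr_ge0/=.
by have := sqr_ge0 (y - c); rewrite sqrrB; nra.
Qed.

Lemma clip_continuous c : 0 <= c -> continuous (clip c).
Proof.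
move=> c0 u; apply/cvgrPdist_lt => e e0; near=> v.
apply: le_lt_trans (clip_lip _ _ c0) _; near: v.
exact: (@cvgr_dist_lt _ _ _ _ _ id).
Unshelve. all: by end_near. Qed.

Lemma cvg_clip c (u_ : nat -> R) u : 0 <= c ->
  u_ @ \oo --> u -> (fun m => clip c (u_ m)) @ \oo --> clip c u.
Proof.
move=> c0; apply: continuous_cvg; exact: clip_continuous.
Qed.

Lemma clip_meas d (T : measurableType d) c (f : T -> R) :
  measurable_fun setT f -> measurable_fun setT (fun x => clip c (f x)).
Proof.
by move=> mf; apply: measurable_maxr => //; exact: measurable_minr.
Qed.

End Clip.

(** * Limits under the expectation *)

Section Limits.
Context {R : realType} {d : measure_display} {T : measurableType d}.
Context (P : probability T R).

Lemma Ex_cvg_bounded (f_ : nat -> T -> R) (f : T -> R) (c : R) :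
  (forall m, measurable_fun setT (f_ m)) -> measurable_fun setT f ->
  {ae P, forall x, f_ ^~ x @ \oo --> f x} ->
  (forall m x, `|f_ m x| <= c) ->
  (fun m => Ex P (f_ m)) @ \oo --> Ex P f.
Proof.
move=> mf_ mf ff fc.
have h1 m : measurable_fun setT (EFin \o f_ m) by exact/measurable_EFinP.
have h2 : measurable_fun setT (EFin \o f) by exact/measurable_EFinP.
have h3 : {ae P, forall x, [set: T] x ->
    (fun m => (EFin \o f_ m) x) @ \oo --> (EFin \o f) x}.
  by move: ff; apply: filterS => x fx _; apply: cvg_EFin => //; exact: nearW.
have h4 : {ae P, forall x (n : nat), [set: T] x ->
    (`|(EFin \o f_ n) x| <= (EFin \o cst c) x)%E}.
  by apply: aeW => x n _ /=; rewrite lee_fin.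
have [_ _] := dominated_convergence measurableT h1 h2 h3 (itg_cst P c) h4.
have : itg P f.
  by have [] := dominated_convergence measurableT h1 h2 h3 (itg_cst P c) h4.
move=> If h; apply: fine_cvg; rewrite fineK//; exact: integrable_fin_num.
Qed.

(** Fatou's lemma is applied on the complement of a null set, where the convergence, and so the sign
    of [f], hold pointwise; the null set is put back at the end. *)
Lemma fatou_le (f_ : nat -> T -> R) (f : T -> R) (e : R) :
  (forall m, itg P (f_ m)) -> measurable_fun setT f ->
  {ae P, forall x, f_ ^~ x @ \oo --> f x} ->
  (forall m x, 0 <= f_ m x) ->
  (forall m, Ex P (f_ m) <= e) ->
  itg P f /\ Ex P (fun x => `|f x|) <= e.
Proof.
move=> If_ mf [N [mN N0 subN]] f0 fe.
have mD : measurable (~` N) by exact: measurableC.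
have mE : measurable_fun setT (EFin \o f) by exact/measurable_EFinP.
have f1 x : (~` N) x -> f_ ^~ x @ \oo --> f x.
  by move=> Nx; apply: contrapT => h; apply: Nx; apply: subN.
have le : (\int[P]_(x in ~` N) (EFin \o f) x <= e%:E)%E.
  rewrite (eq_integral (fun x => limn_einf (fun m => (f_ m x)%:E))); last first.
    move=> x /set_mem Nx /=; apply/esym.
    have h : (fun m => (f_ m x)%:E) @ \oo --> (f x)%:E.
      by apply: cvg_EFin; [exact: nearW|exact: f1].
    by have [-> _] := cvg_limn_einf_sup h.
  apply: (le_trans (fatou _ mD _ _)).
  - move=> m; apply: measurable_funS (measurable_int _ (If_ m)) => //.
  - by move=> m x _; rewrite lee_fin.
  rewrite limn_einf_lim; apply: lime_le; first exact: is_cvg_einfs.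
  apply: nearW => m; apply: (@le_trans _ _ (\int[P]_(x in ~` N) (f_ m x)%:E)%E).
    by apply: ereal_inf_lbound; exists m => //=.
  apply: (@le_trans _ _ (\int[P]_x (f_ m x)%:E)%E).
    apply: ge0_subset_integral => //; first exact: (measurable_int _ (If_ m)).
    by move=> x _; rewrite lee_fin.
  rewrite -[leLHS]fineK ?lee_fin; first exact: fe.
  exact: (integrable_fin_num measurableT (If_ m)).
have f0' x : (~` N) x -> 0 <= f x.
  move=> /f1 h; rewrite -(cvg_lim _ h)//; apply: limr_ge; first exact: cvgP h.
  exact: nearW.
have If : itg P f.
  apply/(negligible_integrable mN measurableT mE N0).
  rewrite setTD; apply/integrableP; split; first exact: measurable_funS mE.
  rewrite (eq_integral (EFin \o f)); first exact: le_lt_trans le (ltry _).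
  by move=> x /set_mem Nx /=; rewrite ger0_norm// f0'.
split => //; rewrite -lee_fin /Ex /Rintegral fineK; last first.
  apply: integrable_fin_num => //; exact: (itg_abs If).
rewrite (negligible_integral mN measurableT (itg_abs If) N0) setTD.
rewrite (eq_integral (EFin \o f))// => x /set_mem Nx /=.
by rewrite ger0_norm// f0'.
Qed.

(* Vitali's theorem, with uniform integrability read off the remainders of the
   truncations. *)
Lemma UI_limit (f_ : nat -> T -> R) (f : T -> R) :
  (forall m, itg P (f_ m)) -> measurable_fun setT f ->
  {ae P, forall x, f_ ^~ x @ \oo --> f x} ->
  (forall e : R, 0 < e -> exists2 c, 0 <= c &
     forall m, Ex P (fun x => `|f_ m x - clip c (f_ m x)|) <= e) ->
  itg P f /\
  forall g : T -> R, measurable_fun setT g -> (forall x, `|g x| <= 1) ->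
    (forall m, Ex P (fun x => f_ m x * g x) = 0) -> Ex P (fun x => f x * g x) = 0.
Proof.
move=> If_ mf ff UI.
have rest e : 0 < e -> exists2 c, 0 <= c &
  (forall m, Ex P (fun x => `|f_ m x - clip c (f_ m x)|) <= e) /\
  itg P (fun x => f x - clip c (f x)) /\
  Ex P (fun x => `|f x - clip c (f x)|) <= e.
  move=> e0; have [c c0 cP] := UI e e0; exists c => //; split=> //.
  have m1 : measurable_fun setT (fun x => f x - clip c (f x)).
    by apply: measurable_funB => //; exact: clip_meas.
  have m2 m : measurable_fun setT (fun x => f_ m x - clip c (f_ m x)).
    by apply: measurable_funB; [|apply: clip_meas]; exact: itg_meas (If_ m).
  have [||||I1 E1] := @fatou_le (fun m x => `|f_ m x - clip c (f_ m x)|)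
    (fun x => `|f x - clip c (f x)|) e _ _ _ _ cP.
  - move=> m; apply: (itg_le _ (If_ m)) => [|x].
      exact: measurableT_comp.
    by rewrite normr_id clip_rest_le.
  - exact: measurableT_comp.
  - move: ff; apply: filterS => x fx; apply: cvg_norm; apply: cvgB => //.
    exact: cvg_clip.
  - by [].
  split; first by apply: (itg_le m1 I1) => x; rewrite normr_id.
  by move: E1; under [X in Ex P X]eq_fun do rewrite normr_id.
have If : itg P f.
  have [c c0 [_ [I1 _]]] := rest 1 ltr01.
  rewrite (_ : f = fun x => (f x - clip c (f x)) + clip c (f x)).
    apply: itgD => //; apply: (@itg_bound _ _ _ _ _ c); first exact: clip_meas.
    by move=> x; exact: clip_le.
  by apply/funext => x; rewrite subrK.
split => // g mg g1 fg0.
apply/eqP; rewrite -normr_eq0 eq_le normr_ge0 andbT; apply/ler_addgt0Pr => e e0.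
rewrite add0r.
(* Three errors share [e]: the remainder of [f], the remainder of [f_ m], and the distance between
   the expectations of the truncations, which converge by domination. *)
have e3 : 0 < e / 3 by rewrite divr_gt0.
have [c c0 [cm [I1 E1]]] := rest _ e3.
have Ic : itg P (fun x => clip c (f x)).
  by apply: (@itg_bound _ _ _ _ _ c) => [|x]; [exact: clip_meas|exact: clip_le].
have Icm m : itg P (fun x => clip c (f_ m x)).
  apply: (@itg_bound _ _ _ _ _ c) => [|x]; last exact: clip_le.
  by apply: clip_meas; exact: itg_meas.
have small (h : T -> R) : itg P h -> `|Ex P (fun x => h x * g x)| <= Ex P (fun x => `|h x|).
  move=> Ih; apply: (le_trans (Ex_abs (itgM Ih mg g1))).
  apply: Ex_le; [exact/itg_abs/(itgM Ih mg g1)|exact: itg_abs|].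
  by move=> x; rewrite normrM ler_piMr.
have cv : (fun m => Ex P (fun x => clip c (f_ m x) * g x)) @ \oo -->
    Ex P (fun x => clip c (f x) * g x).
  apply: (@Ex_cvg_bounded _ _ c) => //.
  - move=> m; apply: measurable_funM => //; exact: itg_meas (Icm m).
  - by apply: measurable_funM => //; exact: itg_meas Ic.
  - move: ff; apply: filterS => x fx; apply: cvgMr_tmp.
    exact: cvg_clip.
  - move=> m x; rewrite normrM (le_trans (ler_piMr _ (g1 x)))//.
    exact: clip_le.
have [m _ mP] : \forall m \near \oo, `|Ex P (fun x => clip c (f x) * g x) -
    Ex P (fun x => clip c (f_ m x) * g x)| < e / 3.
  exact: (@cvgr_dist_lt _ _ _ _ _ _ _ cv).
have {}mP := mP m (leqnn m).
have -> : Ex P (fun x => f x * g x) =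
    Ex P (fun x => (f x - clip c (f x)) * g x) + Ex P (fun x => clip c (f x) * g x).
  rewrite -ExD; [|exact: itgM I1 mg g1|exact: itgM Ic mg g1].
  by congr Ex; apply/funext => x; rewrite mulrBl subrK.
have E2 := fg0 m.
have {}E2 : Ex P (fun x => (f_ m x - clip c (f_ m x)) * g x) +
    Ex P (fun x => clip c (f_ m x) * g x) = 0.
  rewrite -E2 -ExD; [|exact: itgM (itgB (If_ m) (Icm m)) mg g1|exact: itgM (Icm m) mg g1].
  by congr Ex; apply/funext => x; rewrite mulrBl subrK.
have s1 := small _ I1.
have s2 := small _ (itgB (If_ m) (Icm m)).
have {}s1 := le_trans s1 E1.
have {}s2 := le_trans s2 (cm m).
move: s1 s2 mP E2; rewrite !ler_norml ltr_norml => /andP[] ? ? /andP[] ? ? /andP[] ? ? ?.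
by apply/andP; split; lra.
Qed.

End Limits.

(** * Measurability along the filtration; martingales as orthogonality relations *)

Section Filtration.
Context {R : realType} {d : measure_display} {Omega : measurableType d}.
Context (P : probability Omega R) (F : R -> set (set Omega)).
Context (F_usual : usual_filtration P F).

Definition Fm (t : R) (g : Omega -> R) :=
  measurable_fun [set: g_sigma_algebraType (F t)] g.

Lemma FsetE t A : 0 <= t ->
  F t A = (measurable (A : set (g_sigma_algebraType (F t)))).
Proof.
move=> t0; rewrite measurable_g_measurableTypeE//.
exact: filtration_sigma F_usual t t0.
Qed.

Lemma FmE t g : 0 <= t ->
  Fm t g <-> (forall B : set R, measurable B -> F t (g @^-1` B)).
Proof.
move=> t0; split=> [mg B mB|h _ B mB].
  by rewrite FsetE// -[_ @^-1` _]setTI; exact: mg.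
by rewrite -FsetE// setTI; exact: h.
Qed.

Lemma adaptedP X : adapted F X <-> forall t, 0 <= t -> Fm t (X t).
Proof.
by split=> h t t0; [apply/FmE|apply/(FmE _ t0)] => //; exact: h.
Qed.

Lemma Fset_mono s t A : 0 <= s -> s <= t -> F s A -> F t A.
Proof. by move=> s0 st; exact: filtration_monotone F_usual s t s0 st A. Qed.

Lemma Fm_mono s t g : 0 <= s -> s <= t -> Fm s g -> Fm t g.
Proof.
move=> s0 st /(FmE _ s0) h; apply/FmE => [|B mB]; first exact: le_trans st.
exact: (Fset_mono s0 st (h B mB)).
Qed.

Lemma Fset_meas t A : 0 <= t -> F t A -> measurable A.
Proof. by move=> t0; exact: (filtration_measurable F_usual t0). Qed.

Lemma Fm_meas t g : 0 <= t -> Fm t g -> measurable_fun setT g.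
Proof.
move=> t0 /(FmE _ t0) h _ B mB; rewrite setTI.
exact: (Fset_meas t0 (h B mB)).
Qed.

Lemma Fset_negl t A : 0 <= t -> P.-negligible A -> F t A.
Proof.
move=> t0 nA; apply: (Fset_mono (lexx 0) t0).
exact: (filtration_complete F_usual nA).
Qed.

Lemma FsetI t A B : 0 <= t -> F t A -> F t B -> F t (A `&` B).
Proof. by move=> t0; rewrite !FsetE//; exact: measurableI. Qed.

Lemma FsetU t A B : 0 <= t -> F t A -> F t B -> F t (A `|` B).
Proof. by move=> t0; rewrite !FsetE//; exact: measurableU. Qed.

Lemma FsetC t A : 0 <= t -> F t A -> F t (~` A).
Proof. by move=> t0; rewrite !FsetE//; exact: measurableC. Qed.

Lemma Fset0 t : 0 <= t -> F t set0.
Proof. by move=> t0; rewrite !FsetE//; exact: measurable0. Qed.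

(** The set where [g'] and [g] differ is negligible, so by completeness of the filtration it and all
    its subsets belong to [F t]. *)
Lemma Fm_ae t g g' : 0 <= t -> Fm t g -> {ae P, forall x, g' x = g x} -> Fm t g'.
Proof.
move=> t0 /(FmE _ t0) h gg'; apply/FmE => // B mB.
pose N := [set x | ~ (g' x = g x)].
have nN : P.-negligible N by [].
have FN : F t N by exact: Fset_negl.
rewrite (_ : g' @^-1` B = (g @^-1` B `&` ~` N) `|` (g' @^-1` B `&` N)).
  apply: FsetU => //; first by apply: FsetI => //; [exact: h|exact: FsetC].
  by apply: Fset_negl => //; apply: negligibleS nN => x [].
apply/seteqP; split => x /=; rewrite /N /=.
  by move=> Bx; have [e|e] := pselect (g' x = g x); [left; split; [rewrite -e|move=> /(_ e)]|right].
by move=> [[Bx /contrapT ->]|[]].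
Qed.

Lemma Fm_cst t c : Fm t (cst c).
Proof. exact: measurable_cst. Qed.

Lemma FmD t f g : Fm t f -> Fm t g -> Fm t (fun x => f x + g x).
Proof. exact: measurable_funD. Qed.

Lemma FmB t f g : Fm t f -> Fm t g -> Fm t (fun x => f x - g x).
Proof. exact: measurable_funB. Qed.

Lemma FmM t f g : Fm t f -> Fm t g -> Fm t (fun x => f x * g x).
Proof. exact: measurable_funM. Qed.

Lemma FmZ t c f : Fm t f -> Fm t (fun x => c * f x).
Proof. by apply: FmM; exact: Fm_cst. Qed.

Lemma Fm_norm t f : Fm t f -> Fm t (fun x => `|f x|).
Proof. by move=> mf; exact: measurableT_comp. Qed.

Lemma Fm_comp t (f : R -> R) g : continuous f -> Fm t g -> Fm t (fun x => f (g x)).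
Proof.
move=> cf mg; apply: measurableT_comp => //.
exact: continuous_measurable_fun.
Qed.

Lemma Fm_sum t (I : Type) (r : seq I) (f : I -> Omega -> R) :
  (forall i, Fm t (f i)) -> Fm t (fun x => \sum_(i <- r) f i x).
Proof. by move=> mf; exact: measurable_sum. Qed.

Lemma Fm_indic t A : 0 <= t -> F t A -> Fm t (\1_A).
Proof. by move=> t0; rewrite FsetE// => mA; exact: measurable_indic. Qed.

Lemma Fm_ge t c g : 0 <= t -> Fm t g -> F t [set x | c <= g x].
Proof.
move=> t0 /(FmE _ t0)/(_ [set` `[c, +oo[] (measurable_itv _)); congr (F t _).
by apply/seteqP; split => x /=; rewrite in_itv/= andbT.
Qed.

Lemma Fm_gt t c g : 0 <= t -> Fm t g -> F t [set x | c < g x].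
Proof.
move=> t0 /(FmE _ t0)/(_ [set` `]c, +oo[] (measurable_itv _)); congr (F t _).
by apply/seteqP; split => x /=; rewrite in_itv/= andbT.
Qed.

Lemma Fm_lt t c g : 0 <= t -> Fm t g -> F t [set x | g x < c].
Proof.
move=> t0 /(Fm_ge c t0)/(FsetC t0); congr (F t _).
by apply/seteqP; split => x /=; rewrite ltNge => /negP.
Qed.

Lemma Fm_cvg t (g_ : nat -> Omega -> R) g : (forall m, Fm t (g_ m)) ->
  (forall x, g_ ^~ x @ \oo --> g x) -> Fm t g.
Proof.
move=> mg gg; apply: (@measurable_fun_cvg _ _ _ setT _ _ mg) => // x _.
Qed.

(** [g] is within [n^-1] of the step function [gn], which is constant on the sets [A i] of [F s] and
    hence orthogonal to [h]. The error is at most [E / n], with [E] the L^1 norm of [h]. *)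
Lemma orth_bounded s (h g : Omega -> R) c : 0 <= s -> itg P h ->
  (forall A, F s A -> Ex P (fun x => h x * \1_A x) = 0) ->
  Fm s g -> (forall x, `|g x| <= c) -> Ex P (fun x => h x * g x) = 0.
Proof.
move=> s0 Ih h0 mg gc.
have c0 : 0 <= c by exact: le_trans (gc point).
have mg' := Fm_meas s0 mg.
apply/eqP; rewrite -normr_eq0 eq_le normr_ge0 andbT.
apply/ler_addgt0Pr => e e0; rewrite add0r.
pose E := Ex P (fun x => `|h x|).
have E0 : 0 <= E by apply: Ex_ge0.
pose n := (Num.truncn (E / e)).+1%:R : R.
have n0 : 0 < n by rewrite ltr0n.
have En : E / n <= e.
  by rewrite ler_pdivrMr// mulrC -ler_pdivrMr// ltW// truncnS_gt.
pose k x := Num.truncn ((g x + c) * n).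
have kg0 x : 0 <= (g x + c) * n.
  apply: mulr_ge0; [by have := gc x; rewrite ler_norml; lra|exact: ltW].
have kP x : (k x)%:R <= (g x + c) * n < (k x).+1%:R by exact: truncn_itv.
pose N := (Num.truncn ((c + c) * n)).+1.
have kN x : (k x < N)%N.
  rewrite ltnS; apply: le_truncn; rewrite ler_pM2r// lerD2r.
  by have := gc x; rewrite ler_norml => /andP[].
pose A i := [set x | k x = i].
have FA i : F s (A i).
  have mu : Fm s (fun x => (g x + c) * n).
    by apply: FmM; [apply: FmD => //|]; exact: Fm_cst.
  have := FsetI s0 (Fm_ge i%:R s0 mu) (Fm_lt i.+1%:R s0 mu); congr (F s _).
  apply/seteqP; split => x /=; first by move=> [h1 h2]; apply: truncn_def; rewrite h1.
  by move=> <-; have /andP[] := kP x.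
pose gn x : R := \sum_(i < N) (i%:R / n - c) * \1_(A i) x.
have gnE x : gn x = (k x)%:R / n - c.
  rewrite /gn (bigD1 (Ordinal (kN x)))//= indicE mem_set// mulr1 big1 ?addr0//.
  move=> i ik; rewrite indicE memNset ?mulr0// /A /= => e'.
  by move/eqP: ik; apply; apply/val_inj.
have gng x : `|g x - gn x| <= n^-1.
  rewrite gnE; have /andP[h1 h2] := kP x.
  have -> : g x - ((k x)%:R / n - c) = ((g x + c) * n - (k x)%:R) / n.
    by rewrite mulrBl mulfK ?gt_eqF//; ring.
  have ni0 : 0 <= n^-1 by rewrite invr_ge0 ltW.
  rewrite normrM (ger0_norm ni0) ler_piMl// ger0_norm ?subr_ge0//.
  by move: h2; rewrite -natr1; lra.
have mA i : measurable (A i) by exact: Fset_meas s0 (FA i).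
have Igi i : itg P (fun x => (i%:R / n - c) * (h x * \1_(A i) x)).
  apply: itgZ; apply: (@itgM _ _ _ _ 1) => // x; rewrite indicE.
  by case: (_ \in _); rewrite ?normr1 ?normr0.
have hgn x : h x * gn x = \sum_(i < N) (i%:R / n - c) * (h x * \1_(A i) x).
  by rewrite /gn mulr_sumr; apply: eq_bigr => i _; rewrite mulrCA.
have Ign : itg P (fun x => h x * gn x).
  by rewrite (funext hgn); apply: itg_sum => i.
have Egn : Ex P (fun x => h x * gn x) = 0.
  rewrite (funext hgn) Ex_sum//.
  apply: big1 => i _; rewrite ExZ ?h0 ?mulr0//.
  apply: (@itgM _ _ _ _ 1) => // x; rewrite indicE.
  by case: (_ \in _); rewrite ?normr1 ?normr0.
rewrite -[Ex P _]subr0 -Egn -ExB//; last exact: itgM Ih mg' gc.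
have Id : itg P (fun x => h x * g x - h x * gn x).
  by apply: itgB => //; exact: itgM Ih mg' gc.
apply: (le_trans (Ex_abs Id)); apply: le_trans En.
rewrite mulrC -ExZ; last exact: itg_abs.
apply: Ex_le; [exact: itg_abs|exact/itgZ/itg_abs|] => x.
by rewrite -mulrBr normrM mulrC ler_wpM2r.
Qed.

Lemma martingale_itg L t : martingale P F L -> 0 <= t -> itg P (L t).
Proof. by move=> [_ h _]; exact: h. Qed.

(** Trades the extended-valued set integrals of the definition for a real orthogonality relation,
    the form in which martingales are combined and passed to the limit below. *)
Lemma martingaleP L : martingale P F L <->
  [/\ adapted F L, forall t, 0 <= t -> itg P (L t) &
   forall s t A, 0 <= s -> s <= t -> F s A ->
     Ex P (fun x => (L t x - L s x) * \1_A x) = 0].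
Proof.
have key s t A : 0 <= s -> s <= t -> itg P (L s) -> itg P (L t) -> F s A ->
    (\int[P]_(x in A) (L t x)%:E = \int[P]_(x in A) (L s x)%:E)%E <->
    Ex P (fun x => (L t x - L s x) * \1_A x) = 0.
  move=> s0 st Is It FA; have mA := Fset_meas s0 FA.
  have Ii u : itg P (L u) -> itg P (fun x => L u x * \1_A x).
    move=> Iu; apply: (@itgM _ _ _ _ 1) => // x; rewrite indicE.
    by case: (_ \in _); rewrite ?normr1 ?normr0.
  have fn u : itg P (L u) -> (\int[P]_(x in A) (L u x)%:E)%E \is a fin_num.
    move=> Iu; apply: integrable_fin_num => //.
    exact: integrableS Iu.
  rewrite (_ : (fun _ => _) = fun x => L t x * \1_A x - L s x * \1_A x); last first.
    by apply/funext => x; rewrite mulrBl.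
  rewrite ExB ?Ex_set; [|exact: Ii|exact: Ii].
  split=> [->|/eqP]; first by rewrite subrr.
  by rewrite subr_eq0 => /eqP h; rewrite -[LHS]fineK ?fn// h fineK ?fn.
split=> -[aL IL h]; split => //.
  by move=> s t A s0 st FA; apply/key => //; [exact: IL|exact/IL/(le_trans s0)|exact: h].
by move=> s t s0 st A FA; apply/key => //; [exact: IL|exact/IL/(le_trans s0)|exact: h].
Qed.

Lemma mart_orth L s t g c : martingale P F L -> 0 <= s -> s <= t -> Fm s g ->
  (forall x, `|g x| <= c) -> Ex P (fun x => (L t x - L s x) * g x) = 0.
Proof.
move=> /martingaleP[aL IL h] s0 st mg gc.
apply: (orth_bounded s0 _ _ mg gc) => [|A FA]; last exact: h.
by apply: itgB; apply: IL => //; exact: le_trans st.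
Qed.

End Filtration.

(** * Stopping and localization *)

Section StopValue.
Context {R : realType}.
Implicit Types (s t : R) (u : \bar R).

(** The time at which [stopped] evaluates a process. It is finite even when [u] is infinite, because
    [t] is real. *)
Definition stp t u : R := fine (mine t%:E u).

Lemma stpP u : (0 <= u)%E ->
  (exists r, [/\ 0 <= r, u = r%:E & forall t, stp t u = Num.min t r]) \/
  (u = +oo%E /\ forall t, stp t u = t).
Proof.
case: u => [r||//]; rewrite ?lee_fin => u0.
  by left; exists r; split => // t; rewrite /stp -EFin_min.
by right; split => // t; rewrite /stp min_l ?leey.
Qed.

Lemma stp_le t u : (0 <= u)%E -> stp t u <= t.
Proof.
by move=> /stpP[[r [_ _ ->]]|[_ ->//]]; rewrite ge_min lexx.
Qed.

Lemma stp_ge0 t u : (0 <= u)%E -> 0 <= t -> 0 <= stp t u.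
Proof.
by move=> /stpP[[r [r0 _ ->]]|[_ ->//]] t0; rewrite le_min t0.
Qed.

Lemma stp_lt s t u : (0 <= u)%E -> (s < stp t u) = (s < t) && (s%:E < u)%E.
Proof.
move=> /stpP[[r [r0 -> ->]]|[-> ->]]; first by rewrite lt_min lte_fin.
by rewrite ltry andbT.
Qed.

Lemma stp_id t u : (0 <= u)%E -> (t%:E <= u)%E -> stp t u = t.
Proof.
by move=> /stpP[[r [_ -> ->]]|[_ ->//]]; rewrite lee_fin => tr; rewrite min_l.
Qed.

Lemma stp_stp s t u : (0 <= u)%E -> s <= t -> stp s u = Num.min s (stp t u).
Proof.
move=> /stpP[[r [_ _ h]]|[_ h]] st; rewrite !h; last by rewrite min_l.
by rewrite minA (min_l st).
Qed.

Lemma stp_mono s t u : (0 <= u)%E -> s <= t -> stp s u <= stp t u.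
Proof. by move=> u0 st; rewrite (stp_stp u0 st) ge_min lexx orbT. Qed.

Lemma stp_continuous u : (0 <= u)%E -> continuous (stp ^~ u).
Proof.
move=> /stpP[[r [_ _ h]]|[_ h]].
  rewrite (_ : stp ^~ u = id \min cst r); last by apply/funext => t; rewrite h.
  by apply: min_fun_continuous => t; [exact: cvg_id|exact: cvg_cst].
by rewrite (_ : stp ^~ u = id) ?(funext h)// => t; exact: cvg_id.
Qed.

End StopValue.

Section Telescope.
Context {R : realType}.

(** The index [j] is the first one at which [b] fails, or [N]. It does not depend on [g]: one cut
    serves both a sum and its image under a nonlinear function. *)
Lemma telescope_stop (b : nat -> bool) N : (forall i, b i.+1 -> b i) ->
  exists j, [/\ (j <= N)%N, forall i, (i < j)%N -> b i, (j < N)%N -> ~~ b j &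
    forall g : nat -> R, \sum_(i < N) (b i)%:R * (g i.+1 - g i) = g j - g 0%N].
Proof.
move=> bS; elim: N => [|N [j [jN bj nbj gj]]].
  by exists 0%N; split=> // g; rewrite big_ord0 subrr.
have dec i k : b (i + k)%N -> b i.
  by elim: k => [|k IH]; rewrite ?addn0// addnS => /bS.
case: (boolP (b N)) => bN.
  have jE : j = N.
    apply/eqP; rewrite eqn_leq jN leqNgt; apply/negP => h.
    by move: (nbj h); rewrite (dec j (N - j)%N)// subnKC.
  exists N.+1; split=> // [i|/[!ltnn]//|g].
    by rewrite ltnS => iN; rewrite (dec i (N - i)%N)// subnKC.
  by rewrite big_ord_recr/= gj bN jE /= mul1r; lra.
exists j; split=> //; first by rewrite leqW.
  rewrite ltnS leq_eqVlt => /orP[/eqP ->//|]; exact: nbj.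
by move=> g; rewrite big_ord_recr/= gj (negbTE bN) /= mul0r addr0.
Qed.

Definition ugrid (s t : R) (n i : nat) : R := s + (t - s) * (i%:R / n.+1%:R).

Lemma ugrid0 s t n : ugrid s t n 0 = s.
Proof. by rewrite /ugrid mul0r mulr0 addr0. Qed.

Lemma ugridN s t n : ugrid s t n n.+1 = t.
Proof. by rewrite /ugrid divff ?pnatr_eq0// mulr1 subrKC. Qed.

Lemma ugridS s t n i : ugrid s t n i.+1 = ugrid s t n i + (t - s) / n.+1%:R.
Proof. by rewrite /ugrid -[i.+1%:R]natr1 [(_ + 1) / _]mulrDl mul1r mulrDr addrA. Qed.

Lemma ugrid_mono s t n i j : s <= t -> (i <= j)%N -> ugrid s t n i <= ugrid s t n j.
Proof.
move=> st ij; rewrite lerD2l ler_wpM2l ?subr_ge0// ler_pM2r ?ler_nat//.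
Qed.

(** The weights cut the telescoping sum at the first grid point at or after [u], which exceeds the
    stopped time by at most one mesh; continuity of [f] concludes. Each weight is decided at the
    left end of its step, which keeps the sums adapted. *)
Lemma stop_approx (f : R -> R) s t u : continuous f -> 0 <= s -> s <= t -> (0 <= u)%E ->
  (fun n => \sum_(i < n.+1) ((ugrid s t n i)%:E < u)%E%:R *
     (f (ugrid s t n i.+1) - f (ugrid s t n i))) @ \oo -->
  f (stp t u) - f (stp s u).
Proof.
move=> cf s0 st u0.
(* If [u] lies below [s], both stopped values agree and the limit is 0; taking the maximum with [s]
   treats this case together with the other one. *)
pose rho := Num.max s (stp t u).
have E : f (stp t u) - f (stp s u) = f rho - f s.
  by rewrite (stp_stp u0 st) /rho; case: leP => h //; rewrite !subrr.
rewrite E.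
have tsn n : 0 <= (t - s) / n.+1%:R by rewrite divr_ge0 ?subr_ge0.
have q_ex n : exists q, [/\ rho <= q, q <= rho + (t - s) / n.+1%:R &
    \sum_(i < n.+1) ((ugrid s t n i)%:E < u)%E%:R *
     (f (ugrid s t n i.+1) - f (ugrid s t n i)) = f q - f s].
  pose b i := ((ugrid s t n i)%:E < u)%E.
  have bS i : b i.+1 -> b i.
    by apply: le_lt_trans; rewrite lee_fin ugrid_mono.
  have [j [jN bj nbj gj]] := telescope_stop n.+1 bS.
  exists (ugrid s t n j); split; last first.
  - by have := gj (f \o ugrid s t n); rewrite /= ugrid0.
  - case: j jN bj {nbj gj} => [|j] jN bj.
      by rewrite ugrid0 -[leLHS]addr0 lerD// le_max lexx.
    rewrite ugridS lerD2r le_max; have [h|h] := ltP (ugrid s t n j) t.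
      by apply/orP; right; apply: ltW; rewrite stp_lt// h; exact: bj.
    have ts : t = s.
      apply/eqP; rewrite eq_le st andbT leNgt; apply/negP => st'.
      move: h; rewrite leNgt => /negP; apply.
      rewrite -[ltRHS](ugridN s t n) /ugrid ltrD2l ltr_pM2l ?subr_gt0//.
      by rewrite ltr_pM2r ?ltr_nat// invr_gt0.
    by rewrite /ugrid ts subrr mul0r addr0 lexx.
  - rewrite /rho ge_max -{1}(ugrid0 s t n) ugrid_mono//=.
    move: jN; rewrite leq_eqVlt => /orP[/eqP ->|jN].
      by rewrite ugridN stp_le.
    by rewrite leNgt stp_lt//; apply/negP => /andP[_]; exact/negP/nbj.
have [q qP] := choice q_ex.
rewrite (_ : (fun n => _) = fun n => f (q n) - f s); last first.
  by apply/funext => n; have [] := qP n.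
apply: cvgB; last exact: cvg_cst.
apply: continuous_cvg; first exact: cf.
apply: (@squeeze_cvgr _ _ _ _ (fun=> rho) (fun n => rho + (t - s) / n.+1%:R)).
- by apply: nearW => n; have [-> ->] := qP n.
- exact: cvg_cst.
- rewrite -[X in _ --> X]addr0; apply: cvgD; first exact: cvg_cst.
  rewrite -(mulr0 (t - s)); apply: cvgMl_tmp; exact: cvg_harmonic.
Qed.

End Telescope.

(** The factor of [h] is a subgradient at [y] of the convex function [y |-> |y - clip c y|]. *)
Lemma clip_rest_convex (R : realType) (c y h : R) : 0 <= c ->
  h * (if c < y then 1 else if y < - c then -1 else 0) <=
  `|(y + h) - clip c (y + h)| - `|y - clip c y|.
Proof.
move=> c0; rewrite [X in _ <= _ - X]clip_rest//.
case: ifP => h1.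
  have y0 : 0 < y by lra.
  rewrite (gtr0_norm y0) max_r ?mulr1; last by lra.
  have := ler_norm (y + h - clip c (y + h)).
  by have := clip_le (y + h) c0; rewrite ler_norml; lra.
case: ifP => h2.
  have y0 : y < 0 by lra.
  rewrite (ltr0_norm y0) max_r ?mulrN1; last by lra.
  have := ler_norm (- (y + h - clip c (y + h))); rewrite normrN.
  by have := clip_le (y + h) c0; rewrite ler_norml; lra.
rewrite mulr0 max_l ?subr0// subr_le0 ler_norml.
by move/negbT: h1; move/negbT: h2; rewrite -!leNgt => -> ->.
Qed.

(** * Optional stopping for continuous martingales *)

Section OptionalStopping.
Context {R : realType} {d : measure_display} {Omega : measurableType d}.
Context (P : probability Omega R) (F : R -> set (set Omega)).
Context (F_usual : usual_filtration P F).

(** Unlike in [continuous_paths], continuity holds at every outcome and on the whole line, so that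
    stopping and hitting times need no exceptional set. Versions of this kind come from
    [regularize]. *)
Definition cproc (X : R -> Omega -> R) :=
  adapted F X /\ forall x, continuous (X ^~ x).

Lemma cproc_Fm X t : cproc X -> 0 <= t -> Fm F t (X t).
Proof. by move=> [/(adaptedP F_usual) h _]; exact: h. Qed.

Lemma cproc_meas X t : cproc X -> 0 <= t -> measurable_fun setT (X t).
Proof. by move=> hX t0; apply: (Fm_meas F_usual t0); exact: cproc_Fm. Qed.

Lemma stopping_time_lt tau t : 0 <= t -> stopping_time F tau ->
  F t [set x | (t%:E < tau x)%E].
Proof.
move=> t0 [_ /(_ t t0) /(FsetC F_usual t0)]; congr (F t _).
by apply/seteqP; split => x /=; rewrite ltNge => /negP.
Qed.

Lemma itg_mul_indic (f : Omega -> R) (A : set Omega) : measurable A ->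
  itg P f -> itg P (fun x => f x * \1_A x).
Proof.
move=> mA If; apply: (@itgM _ _ _ _ 1) => // x; rewrite indicE.
by case: (_ \in _); rewrite ?normr1 ?normr0.
Qed.

Lemma itg_clip_rest (f : Omega -> R) c : 0 <= c -> itg P f ->
  itg P (fun x => `|f x - clip c (f x)|).
Proof.
move=> c0 If; apply: (itg_le _ If) => [|x]; last by rewrite normr_id clip_rest_le.
apply: measurableT_comp => //; apply: measurable_funB; first exact: (itg_meas If).
by apply: clip_meas; exact: (itg_meas If).
Qed.

Lemma clip_rest_small (f : Omega -> R) (e : R) : itg P f -> 0 < e ->
  exists2 c, 0 <= c & Ex P (fun x => `|f x - clip c (f x)|) <= e.
Proof.
move=> If e0; have mf := itg_meas If.
have mr n : measurable_fun setT (fun x => `|f x - clip n%:R (f x)|).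
  apply: measurableT_comp => //; apply: measurable_funB; first exact: mf.
  exact: clip_meas.
have h1 x : (fun n => (`|f x - clip n%:R (f x)|)%:E) @ \oo --> 0%E.
  apply: cvg_near_cst; near=> n.
  rewrite clip_id ?subrr ?normr0//; near: n.
  exact: nbhs_infty_ger.
have h2 x n : (`| (`|f x - clip n%:R (f x)|)%:E | <= (`|f x|)%:E)%E.
  by rewrite /= lee_fin normr_id clip_rest_le.
have mr' n : measurable_fun setT (fun x => (`|f x - clip n%:R (f x)|)%:E).
  exact/measurable_EFinP.
have [_ _] := @dominated_convergence _ _ _ P setT measurableT _ _ _ mr'
  (measurable_cst _) (aeW _ (fun x _ => h1 x)) (itg_abs If)
  (aeW _ (fun x n _ => h2 x n)).
rewrite integral0 => h.
have {}h : (fun n => Ex P (fun x => `|f x - clip n%:R (f x)|)) @ \oo --> 0.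
  exact: (fine_cvg h).
move/cvgrPdist_le : h => /(_ e e0)[n _ nP].
exists n%:R => //; have := nP n (leqnn n); rewrite sub0r normrN => h'.
exact: le_trans (ler_norm _) h'.
Unshelve. all: by end_near. Qed.

(* A conditional Jensen inequality for the convex function [u |-> |u - clip c u|]. *)
Lemma clip_rest_jensen (s c : R) (Y h : Omega -> R) (B : set Omega) :
  0 <= s -> 0 <= c -> Fm F s Y -> F s B -> itg P Y -> itg P h ->
  (forall g, Fm F s g -> (forall x, `|g x| <= 1) -> Ex P (fun x => h x * g x) = 0) ->
  0 <= Ex P (fun x => (`|(Y x + h x) - clip c (Y x + h x)| - `|Y x - clip c (Y x)|) * \1_B x).
Proof.
move=> s0 c0 mY FB IY Ih h0.
pose g x : R := (\1_[set x | c < Y x] x - \1_[set x | Y x < - c] x) * \1_B x.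
have mg : Fm F s g.
  apply: FmM; last exact: (Fm_indic F_usual).
  apply: FmB; apply: (Fm_indic F_usual s0); first exact: (Fm_gt F_usual).
  exact: (Fm_lt F_usual).
have gE x : g x = (if c < Y x then 1 else if Y x < - c then -1 else 0) * \1_B x.
  rewrite /g !indicE; congr (_ * _).
  have [h1|h1] := ltP c (Y x).
    by rewrite mem_set// memNset/= ?subr0//; apply/negP; rewrite -leNgt; lra.
  rewrite memNset/=; last by apply/negP; rewrite -leNgt.
  have [h2|h2] := ltP (Y x) (- c); first by rewrite mem_set//= sub0r.
  by rewrite memNset/= ?subr0//; apply/negP; rewrite -leNgt.
have g1 x : `|g x| <= 1.
  rewrite gE indicE; case: (x \in B); rewrite ?mulr0 ?normr0// mulr1.
  by case: ifP => _; [|case: ifP => _]; rewrite ?normrN ?normr1 ?normr0.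
have mB := Fset_meas F_usual s0 FB.
rewrite -(h0 g mg g1); apply: Ex_le.
- exact: (itgM Ih (Fm_meas F_usual s0 mg) g1).
- by apply: itg_mul_indic => //; apply: itgB; apply: itg_clip_rest => //; exact: itgD.
move=> x; rewrite gE mulrA; apply: ler_wpM2r; first by rewrite indicE.
exact: clip_rest_convex.
Qed.

Lemma stop_weight_indic (tau : Omega -> \bar R) p :
  (fun x => (p%:E < tau x)%E%:R : R) = \1_[set x | (p%:E < tau x)%E].
Proof.
apply/funext => x; rewrite indicE; congr (_%:R); congr nat_of_bool.
by apply/idP/idP; rewrite inE.
Qed.

Lemma stop_weightE (tau : Omega -> \bar R) p x :
  \1_[set x | (p%:E < tau x)%E] x = (p%:E < tau x)%E%:R :> R.
Proof. by rewrite -stop_weight_indic. Qed.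

Lemma stopped_cproc X tau : cproc X -> stopping_time F tau -> cproc (stopped X tau).
Proof.
move=> hX htau; have [_ X0] := hX; have [tau0 _] := htau; split; last first.
  move=> x t; apply: (@continuous_comp _ _ _ (fun t => stp t (tau x)) (X ^~ x)).
    exact: stp_continuous.
  exact: X0.
apply/(adaptedP F_usual) => t t0.
apply: (@Fm_cvg _ _ _ _ _ (fun n x => X 0 x + \sum_(i < n.+1)
   (((ugrid 0 t n i)%:E < tau x)%E%:R) * (X (ugrid 0 t n i.+1) x - X (ugrid 0 t n i) x))).
  move=> n; apply: FmD.
    by apply: (Fm_mono F_usual (lexx 0) t0); exact: cproc_Fm.
  apply: Fm_sum => i.
  have g0 k : 0 <= ugrid 0 t n k by rewrite -[leLHS](ugrid0 0 t n) ugrid_mono.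
  have gt k : (k <= n.+1)%N -> ugrid 0 t n k <= t.
    by move=> kn; rewrite -[leRHS](ugridN 0 t n) ugrid_mono.
  have ub k : (k <= n.+1)%N -> Fm F t (X (ugrid 0 t n k)).
    by move=> kn; apply: (Fm_mono F_usual (g0 k) (gt k kn)); exact: cproc_Fm.
  apply: FmM; last by apply: FmB; apply: ub => //; exact: ltnW.
  apply: (Fm_mono F_usual (g0 i) (gt i (ltnW (ltn_ord i)))).
  rewrite stop_weight_indic; apply: (Fm_indic F_usual) => //.
  exact: stopping_time_lt.
move=> x; have := stop_approx (X0 x) (lexx 0) t0 (tau0 x).
have -> : stp 0 (tau x) = 0.
  by apply: le_anti; rewrite stp_le//= stp_ge0.
move=> h; rewrite /stopped -/(stp t (tau x)) -[X in _ --> X](subrKC (X 0 x)).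
by apply: cvgD => //; exact: cvg_cst.
Qed.

(** The stopped increment is the limit of the discrete transforms [D n], which are orthogonal to
    [F s]. They are uniformly integrable: the expected remainder of [D n] is at most that of
    [L t - L s], because the steps that [D n] omits contribute nonnegatively by conditional
    Jensen. *)
Lemma stopped_increment L tau s t : martingale P F L -> cproc L ->
  stopping_time F tau -> 0 <= s -> s <= t ->
  itg P (fun x => stopped L tau t x - stopped L tau s x) /\
  forall A, F s A ->
    Ex P (fun x => (stopped L tau t x - stopped L tau s x) * \1_A x) = 0.
Proof.
move=> mL cL htau s0 st; have [_ L0] := cL; have [tau0 _] := htau.
have t0 : 0 <= t by exact: le_trans st.
have /(martingaleP F_usual)[_ IL _] := mL.
pose b n i x : R := ((ugrid s t n i)%:E < tau x)%E%:R.
pose D n x : R := \sum_(i < n.+1) b n i x *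
   (L (ugrid s t n i.+1) x - L (ugrid s t n i) x).
have gs n k : s <= ugrid s t n k by rewrite -[leLHS](ugrid0 s t n) ugrid_mono.
have g0 n k : 0 <= ugrid s t n k by exact: le_trans (gs n k).
have gS n k : ugrid s t n k <= ugrid s t n k.+1 by exact: ugrid_mono.
have Fb n i : F (ugrid s t n i) [set x | ((ugrid s t n i)%:E < tau x)%E].
  exact: stopping_time_lt.
have IL' n k : itg P (L (ugrid s t n k)) by exact: IL.
have ID1 n i : itg P (fun x => b n i x *
    (L (ugrid s t n i.+1) x - L (ugrid s t n i) x)).
  rewrite (_ : (fun _ => _) = fun x => (L (ugrid s t n i.+1) x - L (ugrid s t n i) x) *
     \1_[set x | ((ugrid s t n i)%:E < tau x)%E] x); last first.
    by apply/funext => x; rewrite stop_weightE mulrC.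
  apply: itg_mul_indic; first exact: (Fset_meas F_usual (g0 n i)).
  exact: itgB.
have ID n : itg P (D n) by apply: itg_sum => i; exact: ID1.
have ILts : itg P (fun x => L t x - L s x) by apply: itgB; exact: IL.
have [If Ef] : itg P (fun x => stopped L tau t x - stopped L tau s x) /\
  forall g : Omega -> R, measurable_fun setT g -> (forall x, `|g x| <= 1) ->
    (forall m, Ex P (fun x => D m x * g x) = 0) ->
    Ex P (fun x => (stopped L tau t x - stopped L tau s x) * g x) = 0.
  apply: UI_limit => //.
  - apply: measurable_funB; exact: (cproc_meas (stopped_cproc cL htau)).
  - apply: aeW => x; exact: (stop_approx (L0 x) s0 st (tau0 x)).
  move=> e e0; have [c c0 cP] := clip_rest_small ILts e0.
  exists c => // n; apply: le_trans cP.
  pose phi (u : R) := `|u - clip c u|.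
  pose Y k x := L (ugrid s t n k) x - L s x.
  have IY k : itg P (Y k) by apply: itgB => //; exact: IL.
  have phi0 : phi 0 = 0 by rewrite /phi clip_id ?normr0// subrr normr0.
  (* [D n] and its image under [phi] stop at the same index, as [telescope_stop] gives one [j] for
     all functions. *)
  have phiD x : phi (D n x) = \sum_(i < n.+1) b n i x * (phi (Y i.+1 x) - phi (Y i x)).
    have bS i : ((ugrid s t n i.+1)%:E < tau x)%E -> ((ugrid s t n i)%:E < tau x)%E.
      by apply: le_lt_trans; rewrite lee_fin.
    have [j [_ _ _ hj]] := @telescope_stop R (fun i => ((ugrid s t n i)%:E < tau x)%E) n.+1 bS.
    rewrite /D /b (hj (fun k => L (ugrid s t n k) x)) (hj (fun k => phi (Y k x))).
    by rewrite /Y ugrid0 subrr phi0 subr0.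
  have phiT x : phi (L t x - L s x) = \sum_(i < n.+1) (phi (Y i.+1 x) - phi (Y i x)).
    have := telescope_sumr (fun k => phi (Y k x)) (leq0n n.+1).
    by rewrite big_mkord => ->; rewrite /Y ugrid0 ugridN subrr phi0 subr0.
  have Iphi (h : Omega -> R) : itg P h -> itg P (fun x => phi (h x)).
    exact: itg_clip_rest.
  rewrite -subr_ge0 -ExB; [|exact: (Iphi _ ILts)|exact: (Iphi _ (ID n))].
  rewrite (_ : (fun _ => _) = fun x => \sum_(i < n.+1)
    (phi (Y i.+1 x) - phi (Y i x)) *
    \1_(~` [set x | ((ugrid s t n i)%:E < tau x)%E]) x); last first.
    apply/funext => x; rewrite -/(phi _) -/(phi _) phiD phiT -sumrB.
    apply: eq_bigr => i _; rewrite /b -stop_weightE !indicE in_setC.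
    by case: (_ \in _) => /=; ring.
  have mC i : measurable (~` [set x | ((ugrid s t n i)%:E < tau x)%E]).
    by apply: measurableC; exact: (Fset_meas F_usual (g0 n i)).
  rewrite Ex_sum; last first.
    by move=> i; apply: itg_mul_indic => //; apply: itgB; exact: Iphi.
  apply: sumr_ge0 => i _.
  rewrite (_ : (fun _ => _) = fun x =>
    (`|(Y i x + (L (ugrid s t n i.+1) x - L (ugrid s t n i) x))
       - clip c (Y i x + (L (ugrid s t n i.+1) x - L (ugrid s t n i) x))|
     - `|Y i x - clip c (Y i x)|) *
    \1_(~` [set x | ((ugrid s t n i)%:E < tau x)%E]) x); last first.
    apply/funext => x; rewrite (_ : Y i x + _ = Y i.+1 x)//.
    by rewrite /Y addrC addrA subrK.
  apply: (@clip_rest_jensen (ugrid s t n i)) => //.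
  - apply: FmB; first exact: cproc_Fm.
    by apply: (Fm_mono F_usual s0 (gs n i)); exact: cproc_Fm.
  - exact: (FsetC F_usual).
  - exact: itgB.
  - by move=> g mg g1; exact: (mart_orth F_usual mL (g0 n i) (gS n i) mg g1).
split => // A FA; apply: Ef.
- by apply: measurable_indic; exact: (Fset_meas F_usual s0).
- by move=> x; rewrite indicE; case: (_ \in _); rewrite ?normr1 ?normr0.
move=> n; have mA := Fset_meas F_usual s0 FA.
rewrite (_ : (fun _ => _) = fun x => \sum_(i < n.+1) (b n i x *
   (L (ugrid s t n i.+1) x - L (ugrid s t n i) x)) * \1_A x); last first.
  by apply/funext => x; rewrite mulr_suml.
rewrite Ex_sum; last by move=> i; exact: itg_mul_indic.
apply: big1 => i _.
rewrite (_ : (fun _ => _) = fun x => (L (ugrid s t n i.+1) x - L (ugrid s t n i) x) *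
  (\1_[set x | ((ugrid s t n i)%:E < tau x)%E] x * \1_A x)); last first.
  by apply/funext => x; rewrite stop_weightE -/(b n i x); ring.
apply: (mart_orth F_usual (c := 1) mL (g0 n i) (gS n i)).
  apply: FmM; apply: (Fm_indic F_usual) => //.
  exact: (Fset_mono F_usual s0 (gs n i)).
move=> x; rewrite !indicE.
by case: (_ \in _); case: (_ \in _); rewrite ?mul0r ?mulr0 ?mul1r ?normr0 ?normr1.
Qed.

Lemma stopped_martingale L tau : martingale P F L -> cproc L ->
  stopping_time F tau -> martingale P F (stopped L tau).
Proof.
move=> mL cL htau; have [cS _] := stopped_cproc cL htau.
apply/(martingaleP F_usual); split => //; last first.
  by move=> s t A s0 st; have [_] := stopped_increment mL cL htau s0 st; exact.
move=> t t0; have [I _] := stopped_increment mL cL htau (lexx 0) t0.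
rewrite (_ : stopped L tau t = fun x =>
  (stopped L tau t x - stopped L tau 0 x) + L 0 x).
  by apply: itgD => //; exact: (martingale_itg mL).
apply/funext => x; rewrite {3}/stopped -/(stp 0 (tau x)).
have [tau0 _] := htau.
by rewrite (_ : stp 0 (tau x) = 0) ?subrK//; apply: le_anti; rewrite stp_le//= stp_ge0.
Qed.

End OptionalStopping.

Section Regularize.
Context {R : realType}.
Implicit Types s t u N : R.

Lemma continuous_max0 (f : R -> R) : {within `[0, +oo[, continuous f} ->
  continuous (fun t : R => f (Num.max 0 t)).
Proof.
move=> /subspace_continuousP cf t.
have h0 : `[0, +oo[%classic (Num.max 0 t) by rewrite /= in_itv/= andbT le_max lexx.
apply: (cvg_comp (fun u : R => Num.max 0 u) f _ (cf _ h0)).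
have cm : (fun t : R => Num.max 0 t) @ t --> Num.max 0 t.
  by apply: (@max_fun_continuous _ R R (cst 0) id) => u; [exact: cvg_cst|exact: cvg_id].
move=> A hA; have := cm _ hA; rewrite /= !nbhs_simpl /=.
by apply: filterS => u; apply; rewrite /= in_itv/= andbT le_max lexx.
Qed.

Lemma left_approx (f : R -> R) t N : continuous f -> 0 < t -> N < f t ->
  exists u, [/\ 0 <= u, u < t & N < f u].
Proof.
move=> cf t0 Nf.
have : \forall u \near t, N < f u by exact: (cvgr_gt (f t) (cf t) _ Nf).
move=> /nbhs_ballP[e /= e0 he].
exists (Num.max 0 (t - e / 2)); split; first by rewrite le_max lexx.
  by rewrite gt_max t0/= gtrBl divr_gt0.
apply: he; rewrite /ball/= ger0_norm; last first.
  by rewrite subr_ge0 ge_max ltW//= gerBl divr_ge0// ltW.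
have : t - e / 2 <= Num.max 0 (t - e / 2) by rewrite le_max lexx orbT.
by lra.
Qed.

Lemma rat_approx (f : R -> R) s u N : continuous f -> 0 <= u -> u < s -> N < f u ->
  exists q : rat, [/\ 0 <= ratr q :> R, ratr q < s & N < f (ratr q)].
Proof.
move=> cf u0 us Nf.
have : \forall v \near u, N < f v by exact: (cvgr_gt (f u) (cf u) _ Nf).
move=> /nbhs_ballP[e /= e0 he].
have : u < Num.min s (u + e) by rewrite lt_min us ltrDl.
move=> /rat_in_itvoo[q]; rewrite in_itv/= lt_min => /andP[uq /andP[qs qe]].
exists q; split => //; first exact: le_trans (ltW uq).
by apply: he; rewrite /ball/= ltr0_norm ?subr_lt0//; lra.
Qed.

Lemma cont_bounded (f : R -> R) t : continuous f -> 0 <= t ->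
  exists C, forall u, 0 <= u -> u <= t -> `|f u| <= C.
Proof.
move=> cf t0.
have cn : {within `[0, t], continuous (fun u : R => `|f u|)}.
  apply: continuous_subspaceT => u; apply: cvg_norm; exact: cf.
have [c _ hc] := EVT_max t0 cn.
by exists `|f c| => u u0 ut; apply: hc; rewrite in_itv/= u0.
Qed.

End Regularize.

(** * Regular versions, hitting times, and localization by them *)

Section Hitting.
Context {R : realType} {d : measure_display} {Omega : measurableType d}.
Context (P : probability Omega R) (F : R -> set (set Omega)).
Context (F_usual : usual_filtration P F).

(** [X'] is frozen at negative times and set to 0 off the almost sure event where the path is
    continuous and [Q] holds; completeness keeps it adapted. The dichotomy at the end lets a
    pathwise property such as bounded variation be checked at every outcome. *)
Lemma regularize X (Q : Omega -> Prop) : adapted F X -> continuous_paths P X ->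
  {ae P, forall x, Q x} ->
  exists X', [/\ cproc F X', {ae P, forall x t, 0 <= t -> X' t x = X t x} &
    forall x, (Q x /\ forall t, 0 <= t -> X' t x = X t x) \/ forall t, X' t x = 0].
Proof.
move=> aX cX aQ.
pose G := [set x | {within `[0, +oo[, continuous (X ^~ x)} /\ Q x].
pose X' t x := if x \in G then X (Num.max 0 t) x else 0.
have XX : {ae P, forall x t, 0 <= t -> X' t x = X t x}.
  move: cX aQ; apply: filterS2 => x xG Qx t t0.
  by rewrite /X' mem_set// max_r.
exists X'; split => //; last first.
  move=> x; have [xG|xG] := boolP (x \in G); [left|right].
    split; first by have [] := set_mem xG.
    by move=> t t0; rewrite /X' xG max_r.
  by move=> t; rewrite /X' (negbTE xG).
split.
  apply/(adaptedP F_usual) => t t0.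
  have mX : Fm F t (X t) by move: aX => /(adaptedP F_usual); exact.
  by apply: (Fm_ae F_usual t0 mX); move: XX; apply: filterS => x; apply.
move=> x; have [xG|xG] := boolP (x \in G).
  rewrite (_ : X' ^~ x = fun t => X (Num.max 0 t) x); last first.
    by apply/funext => t; rewrite /X' xG.
  exact: (continuous_max0 (set_mem xG).1).
rewrite (_ : X' ^~ x = cst 0) => [t|]; first exact: cvg_cst.
by apply/funext => t; rewrite /X' (negbTE xG).
Qed.

Implicit Types s t u N : R.

Definition hit (Y : R -> Omega -> R) (N : R) (x : Omega) : \bar R :=
  ereal_inf [set u%:E | u in [set u | 0 <= u /\ N < `|Y u x|]].

Lemma hit_ge0 Y N x : (0 <= hit Y N x)%E.
Proof. by apply: le_ereal_inf_tmp => _ [u [u0 _] <-]; rewrite lee_fin. Qed.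

Lemma hit_ltP Y N x s : (hit Y N x < s%:E)%E <->
  exists u, [/\ 0 <= u, u < s & N < `|Y u x|].
Proof.
split=> [/ereal_inf_lt[_ [u [u0 Nu] <-]]|[u [u0 us Nu]]].
  by rewrite lte_fin => us; exists u.
by apply: (@le_lt_trans _ _ u%:E); [apply: ereal_inf_lbound; exists u|rewrite lte_fin].
Qed.

Lemma lt_hit Y N x t : 0 <= t -> (t%:E < hit Y N x)%E -> `|Y t x| <= N.
Proof.
move=> t0 h; rewrite leNgt; apply/negP => Nt; move: h; rewrite ltNge => /negP; apply.
by apply: ereal_inf_lbound; exists t.
Qed.

Lemma le_hit Y N x t : continuous (Y ^~ x) -> 0 < t -> (t%:E <= hit Y N x)%E ->
  `|Y t x| <= N.
Proof.
move=> cY t0 h; rewrite leNgt; apply/negP => Nt.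
have cn : continuous (fun u : R => `|Y u x|) by move=> u; apply: cvg_norm; exact: cY.
have [u [u0 ut Nu]] := left_approx cn t0 Nt.
by move: h; rewrite leNgt => /negP; apply; apply/hit_ltP; exists u.
Qed.

(** [hit] is the entry time of [|Y|] into the open half-line above [N]: the event [hit < s] is a
    countable union over rational times before [s]. The event [hit <= t] is the intersection of such
    events as the bound decreases to [t], and right continuity of the filtration brings it back into
    [F t]. *)
Lemma hit_stopping Y N : cproc F Y -> stopping_time F (hit Y N).
Proof.
move=> hY; have [aY cY] := hY; split; first by move=> x; exact: hit_ge0.
move=> t t0.
have hlt s : 0 <= s -> F s [set x | (hit Y N x < s%:E)%E].
  move=> s0; rewrite (_ : mkset _ = \bigcup_(q : rat)
      (if (0 <= ratr q :> R) && (ratr q < s) then [set x | N < `|Y (ratr q) x|]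
       else set0)); last first.
    apply/seteqP; split => x /=.
      move=> /hit_ltP[u [u0 us Nu]].
      have cn : continuous (fun u : R => `|Y u x|) by move=> v; apply: cvg_norm; exact: cY.
      have [q [q0 qs Nq]] := rat_approx cn u0 us Nu.
      by exists q => //; rewrite q0 qs.
    by move=> [q _]; case: ifP => //= /andP[q0 qs] Nq; apply/hit_ltP; exists (ratr q).
  rewrite (FsetE F_usual)//; apply: bigcupT_measurable_rat => q.
  rewrite -(FsetE F_usual)//; case: ifP => [/andP[q0 qs]|_]; last exact: (Fset0 F_usual).
  apply: (Fset_mono F_usual q0 (ltW qs)); apply: (Fm_gt F_usual) => //.
  by apply: Fm_norm; exact: (cproc_Fm F_usual).
rewrite (filtration_right_cont F_usual)// => s /= ts.
have s0 : 0 <= s by exact: le_trans (ltW ts).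
rewrite (_ : mkset _ = \bigcap_n [set x | (hit Y N x < (t + (s - t) / n.+1%:R)%:E)%E]).
  rewrite (FsetE F_usual)//; apply: bigcapT_measurable => n; rewrite -(FsetE F_usual)//.
  have tn : t <= t + (s - t) / n.+1%:R.
    by rewrite lerDl divr_ge0// subr_ge0 ltW.
  apply: (Fset_mono F_usual (le_trans t0 tn)); last by apply: hlt; exact: le_trans tn.
  by rewrite -lerBrDl ler_pdivrMr// ler_peMr ?ler1n// subr_ge0 ltW.
apply/seteqP; split => x /=.
  move=> h n _; apply: le_lt_trans h _; rewrite lte_fin ltrDl divr_gt0//.
  by rewrite subr_gt0.
move=> h; apply/lee_addgt0Pr => e e0.
pose n := Num.truncn ((s - t) / e).
apply: le_trans (ltW (h n I)) _; rewrite -EFinD lee_fin lerD2l.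
by rewrite ler_pdivrMr// mulrC -ler_pdivrMr// ltW// truncnS_gt.
Qed.

Lemma hit_infty Y x t : continuous (Y ^~ x) -> 0 <= t ->
  exists n0 : nat, forall n, (n0 <= n)%N -> (t%:E < hit Y n%:R x)%E.
Proof.
move=> cY t0; have t1 : 0 <= t + 1 by rewrite addr_ge0.
have [C hC] := cont_bounded cY t1.
exists (Num.truncn C).+1 => n hn; apply: (@lt_le_trans _ _ (t + 1)%:E).
  by rewrite lte_fin ltrDl.
apply: le_ereal_inf_tmp => _ [u [u0 Nu] <-]; rewrite lee_fin leNgt; apply/negP => ut.
move: Nu; rewrite ltNge => /negP; apply.
apply: le_trans (hC _ u0 (ltW ut)) _; apply: (le_trans (ltW (truncnS_gt C))).
by rewrite ler_nat.
Qed.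

Lemma hit_mono Y N N' x : N <= N' -> (hit Y N x <= hit Y N' x)%E.
Proof.
move=> NN; apply: ereal_inf_le_tmp => _ [u [u0 Nu] <-]; exists u => //; split=> //.
exact: le_lt_trans Nu.
Qed.

(** Time 0 is set apart because [|Y 0 x|] may exceed [N], in which case [hit] is 0. This is harmless
    for processes from which the initial value has been subtracted. *)
Lemma hit_stop_bound Y N x t u : continuous (Y ^~ x) -> 0 <= u ->
  u <= stp t (hit Y N x) -> u = 0 \/ `|Y u x| <= N.
Proof.
move=> cY u0 ut; have [->|un0] := eqVneq u 0; [by left|right].
apply: le_hit => //; first by rewrite lt_neqAle eq_sym un0.
move: ut; have [[r [_ -> ->]]|[-> _]] := stpP (hit_ge0 Y N x); last by rewrite leey.
by rewrite lee_fin le_min => /andP[].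
Qed.

(** Whatever its own localizing sequence [tau], a local martingale may be localized by the hitting
    times of any process [Y] that dominates it: the process stopped at both times is a martingale,
    and bounded convergence lets [tau k] tend to infinity. A common [Y] is what allows two local
    martingales to be treated together. *)
Lemma loc_mart_bounded M Y N : cont_local_martingale P F M -> cproc F M ->
  cproc F Y -> (forall t x, 0 <= t -> `|M t x - M 0 x| <= `|Y t x|) -> 0 <= N ->
  martingale P F (fun t x => stopped M (hit Y N) t x - M 0 x) /\
  forall t x, 0 <= t -> `|stopped M (hit Y N) t x - M 0 x| <= N.
Proof.
move=> [_ _ [tau [htau tau_oo mtau]]] hM hY MY N0.
have [_ cM] := hM; have [_ cY] := hY.
have bnd t u x : 0 <= u -> u <= stp t (hit Y N x) -> `|M u x - M 0 x| <= N.
  move=> u0 ut; have [->|h] := hit_stop_bound (cY x) u0 ut; first by rewrite subrr normr0.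
  exact: le_trans (MY _ _ u0) h.
have hS := hit_stopping N hY.
have bnd' t x : 0 <= t -> `|stopped M (hit Y N) t x - M 0 x| <= N.
  by move=> t0; apply: (bnd t); [exact/stp_ge0/t0/hit_ge0|].
split => //.
pose L k t x := stopped M (tau k) t x - M 0 x.
have cL k : cproc F (L k).
  split; first by have [] := mtau k.
  move=> x t; apply: cvgB; last exact: cvg_cst.
  exact: (stopped_cproc F_usual hM (htau k)).2.
have aS : adapted F (fun t x => stopped M (hit Y N) t x - M 0 x).
  apply/(adaptedP F_usual) => t t0; apply: FmB.
    exact: (cproc_Fm F_usual (stopped_cproc F_usual hM hS)).
  by apply: (Fm_mono F_usual (lexx 0) t0); exact: (cproc_Fm F_usual).
have mS t : 0 <= t -> measurable_fun setT (fun x => stopped M (hit Y N) t x - M 0 x).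
  by move=> t0; apply: (Fm_meas F_usual t0); move: aS => /(adaptedP F_usual); exact.
have IS t : 0 <= t -> itg P (fun x => stopped M (hit Y N) t x - M 0 x).
  by move=> t0; apply: (itg_bound P (mS t t0)) => x; exact: bnd'.
have mSL k := stopped_martingale F_usual (mtau k) (cL k) hS.
have SLE k t x : stopped (L k) (hit Y N) t x = M (stp (stp t (hit Y N x)) (tau k x)) x - M 0 x.
  by [].
have SLb k t x : 0 <= t -> `|stopped (L k) (hit Y N) t x| <= N.
  move=> t0; rewrite SLE; have [tau0 _] := htau k; apply: (bnd t).
    by apply: stp_ge0 => //; exact/stp_ge0/t0/hit_ge0.
  exact: stp_le.
(* The sequence is eventually constant: once [tau k] exceeds the time already stopped by [hit], it
   has no further effect. *)
have SLc t x : 0 <= t -> tau ^~ x @ \oo --> +oo%E ->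
    (fun k => stopped (L k) (hit Y N) t x) @ \oo --> stopped M (hit Y N) t x - M 0 x.
  move=> t0 hx; apply: cvg_near_cst; near=> k; rewrite SLE stp_id//.
    by have [tau0 _] := htau k.
  near: k; move/cvgeyPge : hx; apply.
apply/(martingaleP F_usual); split => // s t A s0 st FA.
have t0 : 0 <= t by exact: le_trans st.
have mA := Fset_meas F_usual s0 FA.
have cv : (fun k => Ex P (fun x => (stopped (L k) (hit Y N) t x -
    stopped (L k) (hit Y N) s x) * \1_A x)) @ \oo -->
   Ex P (fun x => ((stopped M (hit Y N) t x - M 0 x) -
     (stopped M (hit Y N) s x - M 0 x)) * \1_A x).
  apply: (@Ex_cvg_bounded _ _ _ _ _ _ (N + N)).
  - move=> k; apply: measurable_funM; last exact: measurable_indic.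
    have IL u : 0 <= u -> itg P (stopped (L k) (hit Y N) u).
      by move=> u0; exact: martingale_itg (mSL k) u0.
    by apply: measurable_funB; apply: itg_meas (IL _ _).
  - apply: measurable_funM; last exact: measurable_indic.
    by apply: measurable_funB; exact: mS.
  - move: tau_oo; apply: filterS => x [_ hx]; apply: cvgMr_tmp.
    by apply: cvgB; exact: SLc.
  - move=> k x; rewrite normrM (@le_trans _ _ `|stopped (L k) (hit Y N) t x -
      stopped (L k) (hit Y N) s x|)//.
      by rewrite ler_piMr// indicE; case: (_ \in _); rewrite ?normr1 ?normr0.
    by rewrite (le_trans (ler_normB _ _))// lerD// SLb.
move: cv; rewrite (_ : (fun k => _) = cst 0); last first.
  apply/funext => k; have /(martingaleP F_usual)[_ _ h] := mSL k.
  exact: h.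
by move=> /(cvg_lim (@Rhausdorff R)) <-; rewrite lim_cst.
Unshelve. all: by end_near. Qed.

Lemma loc_mart_intro M Y : cproc F M -> cproc F Y ->
  (forall n : nat, martingale P F (fun t x => stopped M (hit Y n%:R) t x - M 0 x)) ->
  cont_local_martingale P F M.
Proof.
move=> [aM cM] hY h; have [_ cY] := hY; split=> //.
  by apply: aeW => x; exact: continuous_subspaceT.
exists (fun n => hit Y n%:R); split => //.
  by move=> k; exact: hit_stopping.
apply: aeW => x; split; first by move=> k l kl; apply: hit_mono; rewrite ler_nat.
apply/cvgeyPge => A.
have A0 : 0 <= Num.max 0 A by rewrite le_max lexx.
have [n0 hitn] := hit_infty (cY x) A0.
near=> n.
apply: le_trans (ltW (hitn n _)); first by rewrite lee_fin le_max lexx orbT.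
by near: n; exact: nbhs_infty_ge.
Unshelve. all: by end_near. Qed.

End Hitting.

(** * Paths of bounded variation *)

Section BoundedVariation.
Context {R : realType}.

(** [T] stands for the total variation function of [A]. Bounding increments by those of a single
    function makes sums over partitions telescope. *)
Definition bvpath (A : R -> R) := exists T : R -> R,
  forall u v, 0 <= u -> u <= v -> `|A v - A u| <= T v - T u.

Lemma bv_intro (A T : R -> R) t : 0 <= t ->
  (forall u v, 0 <= u -> u <= v -> v <= t -> `|A v - A u| <= T v - T u) ->
  bounded_variation 0 t A.
Proof.
move=> t0 hT; exists (T t - T 0) => _ [s sp <-].
have tn k : (k < size s)%N -> nth t (0 :: s) k <= nth t (0 :: s) k.+1.
  by move=> ks; have [/(pathP t)/(_ k ks)/ltW] := sp.
have t0k k : (k <= size s)%N -> 0 <= nth t (0 :: s) k.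
  by elim: k => // k IH ks; apply: le_trans (IH (ltnW ks)) (tn _ ks).
have nt : nth t (0 :: s) (size s) = t.
  by have [_ /eqP] := sp; rewrite (last_nth t).
have ntk i : (i <= size s)%N -> nth t (0 :: s) (size s - i) <= t.
  elim: i => [|i IH] hi; first by rewrite subn0 nt.
  apply: le_trans (IH (ltnW hi)); rewrite -(subnSK hi); apply: tn.
  by rewrite ltn_subrL/= (leq_ltn_trans _ hi).
rewrite /variation; apply: (@le_trans _ _ (\sum_(0 <= n < size s)
    (T (nth t (0 :: s) n.+1) - T (nth t (0 :: s) n)))).
  rewrite !big_nat; apply: ler_sum => n /andP[_ ns] /=.
  apply: hT; [exact: (t0k n (ltnW ns))|exact: (tn _ ns)|].
  by have := ntk (size s - n.+1)%N (leq_subr _ _); rewrite subKn.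
rewrite (telescope_sumr (fun n => T (nth t (0 :: s) n)))//= lerD2r.
by move: nt => /= ->.
Qed.

Lemma bvpathP A : (forall t, 0 <= t -> bounded_variation 0 t A) <-> bvpath A.
Proof.
split=> [h|[T hT] t t0]; last by apply: (@bv_intro _ T) => // u v u0 uv _; exact: hT.
exists (fun t => fine (total_variation 0 t A)) => u v u0 uv.
have v0 : 0 <= v by exact: le_trans uv.
have fu : total_variation 0 u A \is a fin_num by exact/bounded_variationP/h.
have fv : total_variation 0 v A \is a fin_num by exact/bounded_variationP/h.
have E := total_variationD A u0 uv.
have fuv : total_variation u v A \is a fin_num.
  by move: fv; rewrite E fin_numD => /andP[].
rewrite E fineD// addrAC subrr add0r -lee_fin fineK//.
exact: total_variation_ge.
Qed.

End BoundedVariation.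

(** * Continuous semimartingales *)

Section Decomposition.
Context {R : realType} {d : measure_display} {Omega : measurableType d}.
Context (P : probability Omega R) (F : R -> set (set Omega)).
Context (F_usual : usual_filtration P F).
Implicit Types s t u : R.

(** The counterpart of [cont_semimartingale] in which path continuity, bounded variation and the
    decomposition hold at every outcome. *)
Definition csm X := cproc F X /\ exists M A,
  [/\ cproc F M, cont_local_martingale P F M, cproc F A,
      forall x, bvpath (A ^~ x) & forall t x, 0 <= t -> X t x = M t x + A t x].

Lemma martingale_ae L L' : martingale P F L ->
  {ae P, forall x t, 0 <= t -> L' t x = L t x} -> martingale P F L'.
Proof.
move=> [aL iL hL] LL.
have LLt t : 0 <= t -> {ae P, forall x, L' t x = L t x}.
  by move=> t0; move: LL; apply: filterS => x; apply.
have aL' : adapted F L'.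
  apply/(adaptedP F_usual) => t t0; apply: (Fm_ae F_usual t0 _ (LLt t t0)).
  by move: aL => /(adaptedP F_usual); exact.
have mL t : 0 <= t -> measurable_fun setT (L t).
  by move=> t0; apply: (Fm_meas F_usual t0); move: aL => /(adaptedP F_usual); exact.
have mL' t : 0 <= t -> measurable_fun setT (L' t).
  by move=> t0; apply: (Fm_meas F_usual t0); move: aL' => /(adaptedP F_usual); exact.
have E t A : 0 <= t -> measurable A ->
    (\int[P]_(x in A) (L' t x)%:E = \int[P]_(x in A) (L t x)%:E)%E.
  move=> t0 mA; apply: ae_eq_integral => //.
  - by apply/measurable_EFinP; exact: measurable_funS (mL' t t0).
  - by apply/measurable_EFinP; exact: measurable_funS (mL t t0).
  - by move: (LLt t t0); apply: filterS => x -> _.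
split => // [t t0|s t s0 st A FA].
  apply/integrableP; split; first exact/measurable_EFinP/mL'.
  have /integrableP[_] := iL t t0.
  have m1 : measurable_fun setT (fun x => (`|L t x|)%:E).
    by apply/measurable_EFinP; apply: measurableT_comp => //; exact: mL.
  have m2 : measurable_fun setT (fun x => (`|L' t x|)%:E).
    by apply/measurable_EFinP; apply: measurableT_comp => //; exact: mL'.
  have EE : ae_eq P setT (fun x => (`|L' t x|)%:E) (fun x => (`|L t x|)%:E).
    by move: (LLt t t0); apply: filterS => x /= -> _.
  by have /= -> := ae_eq_integral _ _ measurableT m2 m1 EE.
have mA := Fset_meas F_usual s0 FA.
by rewrite !E//; [exact: hL|exact: le_trans st].
Qed.

Lemma cont_local_martingale_ae M M' : cont_local_martingale P F M -> cproc F M' ->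
  {ae P, forall x t, 0 <= t -> M' t x = M t x} -> cont_local_martingale P F M'.
Proof.
move=> [_ _ [tau [h1 h2 h3]]] [aM cM] MM; split => //.
  by apply: aeW => x; exact: continuous_subspaceT.
exists tau; split => // k; apply: martingale_ae (h3 k) _.
move: MM; apply: filterS => x hx t t0.
by rewrite /stopped !hx//; apply: stp_ge0 => //; have [] := h1 k.
Qed.

Lemma semimartingale_csm X : cont_semimartingale P F X ->
  exists2 X', csm X' & {ae P, forall x t, 0 <= t -> X' t x = X t x}.
Proof.
move=> [M [A [hM [aA cA bA] aX XMA]]].
have [aM cM _] := hM.
have trivQ : {ae P, forall x : Omega, True} by exact: aeW.
have [M' [cM' MM' _]] := regularize F_usual aM cM trivQ.
have [A' [cA' AA' hA']] := regularize F_usual aA cA bA.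
exists (fun t x => M' t x + A' t x).
  split.
    split; last by move=> x t; apply: cvgD; [exact: cM'.2|exact: cA'.2].
    by apply/(adaptedP F_usual) => t t0; apply: FmD; exact: (cproc_Fm F_usual).
  exists M', A'; split => //; first exact: cont_local_martingale_ae hM cM' MM'.
  move=> x; have [[Qx hx]|h0] := hA' x; last first.
    by exists (fun=> 0) => u v _ _; rewrite !h0 !subrr normr0.
  have /bvpathP[T hT] := Qx; exists T => u v u0 uv.
  by rewrite !hx//; [exact: hT|exact: le_trans uv].
by move: MM' AA' XMA; apply: filterS3 => x h1 h2 h3 t t0; rewrite h1// h2// h3.
Qed.

Lemma csm_semimartingale X X' : csm X' -> adapted F X ->
  {ae P, forall x t, 0 <= t -> X' t x = X t x} -> cont_semimartingale P F X.
Proof.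
move=> [_ [M [A [cM hM cA bA XMA]]]] aX XX; exists M, A; split => //.
  split; first by have [] := cA.
    by apply: aeW => x; apply: continuous_subspaceT; have [_] := cA; apply.
  by apply: aeW => x t t0; have /bvpathP := bA x; apply.
by move: XX; apply: filterS => x h t t0; rewrite -h// XMA.
Qed.

Lemma cprocD X Y : cproc F X -> cproc F Y -> cproc F (fun t x => X t x + Y t x).
Proof.
move=> hX hY; split; last by move=> x t; apply: cvgD; [exact: hX.2|exact: hY.2].
by apply/(adaptedP F_usual) => t t0; apply: FmD; exact: (cproc_Fm F_usual).
Qed.

Lemma cprocM X Y : cproc F X -> cproc F Y -> cproc F (fun t x => X t x * Y t x).
Proof.
move=> hX hY; split; last by move=> x t; apply: cvgM; [exact: hX.2|exact: hY.2].
by apply/(adaptedP F_usual) => t t0; apply: FmM; exact: (cproc_Fm F_usual).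
Qed.

Lemma cproc_cst c : cproc F (fun _ _ => c).
Proof.
split; last by move=> x t; exact: cvg_cst.
by apply/(adaptedP F_usual) => t t0; exact: Fm_cst.
Qed.

Lemma cproc_init X : cproc F X -> cproc F (fun _ => X 0).
Proof.
move=> hX; split; last by move=> x t; exact: cvg_cst.
apply/(adaptedP F_usual) => t t0; apply: (Fm_mono F_usual (lexx 0) t0).
exact: (cproc_Fm F_usual).
Qed.

Lemma cprocZ c X : cproc F X -> cproc F (fun t x => c * X t x).
Proof. by apply: cprocM; exact: cproc_cst. Qed.

Lemma cprocB X Y : cproc F X -> cproc F Y -> cproc F (fun t x => X t x - Y t x).
Proof.
move=> hX hY; split; last by move=> x t; apply: cvgB; [exact: hX.2|exact: hY.2].
by apply/(adaptedP F_usual) => t t0; apply: FmB; exact: (cproc_Fm F_usual).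
Qed.

Lemma cproc_norm X : cproc F X -> cproc F (fun t x => `|X t x|).
Proof.
move=> hX; split; last by move=> x t; apply: cvg_norm; exact: hX.2.
by apply/(adaptedP F_usual) => t t0; apply: Fm_norm; exact: (cproc_Fm F_usual).
Qed.

Lemma cproc_comp (f : R -> R) X : continuous f -> cproc F X ->
  cproc F (fun t x => f (X t x)).
Proof.
move=> cf hX; split.
  by apply/(adaptedP F_usual) => t t0; apply: Fm_comp => //; exact: (cproc_Fm F_usual).
by move=> x t; apply: (@continuous_cvg _ _ _ _ _ (X ^~ x) f); [exact: cf|exact: hX.2].
Qed.

Lemma martingaleD L L' : martingale P F L -> martingale P F L' ->
  martingale P F (fun t x => L t x + L' t x).
Proof.
move=> /(martingaleP F_usual)[a1 i1 h1] /(martingaleP F_usual)[a2 i2 h2].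
apply/(martingaleP F_usual); split.
- apply/(adaptedP F_usual) => t t0.
  by apply: FmD; [move: a1|move: a2] => /(adaptedP F_usual); exact.
- by move=> t t0; apply: itgD; [exact: i1|exact: i2].
move=> s t A s0 st FA; have t0 : 0 <= t by exact: le_trans st.
have mA := Fset_meas F_usual s0 FA.
rewrite -[RHS]addr0 -{1}(h1 s t A s0 st FA) -(h2 s t A s0 st FA) -ExD.
- by congr Ex; apply/funext => x; ring.
- by apply: itg_mul_indic => //; apply: itgB; exact: i1.
- by apply: itg_mul_indic => //; apply: itgB; exact: i2.
Qed.

Lemma martingaleZ c L : martingale P F L -> martingale P F (fun t x => c * L t x).
Proof.
move=> /(martingaleP F_usual)[a1 i1 h1]; apply/(martingaleP F_usual); split.
- by apply/(adaptedP F_usual) => t t0; apply: FmZ; move: a1 => /(adaptedP F_usual); exact.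
- by move=> t t0; apply: itgZ; exact: i1.
move=> s t A s0 st FA; have t0 : 0 <= t by exact: le_trans st.
have mA := Fset_meas F_usual s0 FA.
rewrite -(mulr0 c) -(h1 s t A s0 st FA) -ExZ.
  by congr Ex; apply/funext => x; ring.
by apply: itg_mul_indic => //; apply: itgB; exact: i1.
Qed.

Lemma loc_martD M M' : cproc F M -> cproc F M' -> cont_local_martingale P F M ->
  cont_local_martingale P F M' -> cont_local_martingale P F (fun t x => M t x + M' t x).
Proof.
move=> c1 c2 h1 h2.
(* One process dominating both increments, so that the two local martingales are stopped at the same
   times. *)
pose Y t x := `|M t x - M 0 x| + `|M' t x - M' 0 x|.
have cY : cproc F Y.
  by apply: cprocD; apply: cproc_norm; apply: cprocB => //; exact: cproc_init.
apply: (@loc_mart_intro _ _ _ _ _ F_usual _ Y) => // [|n]; first exact: cprocD.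
have le1 t x : 0 <= t -> `|M t x - M 0 x| <= `|Y t x|.
  by move=> _; rewrite [leRHS]ger0_norm ?addr_ge0// lerDl.
have le2 t x : 0 <= t -> `|M' t x - M' 0 x| <= `|Y t x|.
  by move=> _; rewrite [leRHS]ger0_norm ?addr_ge0// lerDr.
have [m1 _] := loc_mart_bounded F_usual h1 c1 cY le1 (ler0n _ n).
have [m2 _] := loc_mart_bounded F_usual h2 c2 cY le2 (ler0n _ n).
apply: martingale_ae (martingaleD m1 m2) _; apply: aeW => x t _.
by rewrite /stopped; ring.
Qed.

Lemma loc_martZ c M : cproc F M -> cont_local_martingale P F M ->
  cont_local_martingale P F (fun t x => c * M t x).
Proof.
move=> c1 h1; pose Y t x := M t x - M 0 x.
have cY : cproc F Y by apply: cprocB => //; exact: cproc_init.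
apply: (@loc_mart_intro _ _ _ _ _ F_usual _ Y) => // [|n]; first exact: cprocZ.
have [m1 _] := loc_mart_bounded F_usual h1 c1 cY (fun t x _ => lexx _) (ler0n _ n).
apply: martingale_ae (martingaleZ c m1) _; apply: aeW => x t _.
by rewrite /stopped; ring.
Qed.

Lemma bvpathD A B : @bvpath R A -> bvpath B -> bvpath (fun t => A t + B t).
Proof.
move=> [T hT] [S hS]; exists (fun t => T t + S t) => u v u0 uv.
rewrite (_ : _ - _ = (A v - A u) + (B v - B u)); last by ring.
apply: le_trans (ler_normD _ _) _.
by have := hT _ _ u0 uv; have := hS _ _ u0 uv; lra.
Qed.

Lemma bvpathZ c A : @bvpath R A -> bvpath (fun t => c * A t).
Proof.
move=> [T hT]; exists (fun t => `|c| * T t) => u v u0 uv.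
by rewrite -!mulrBr normrM ler_wpM2l// hT.
Qed.

Lemma csmD X Y : csm X -> csm Y -> csm (fun t x => X t x + Y t x).
Proof.
move=> [cX [M [A [cM hM cA bA XE]]]] [cY [N [B [cN hN cB bB YE]]]].
split; first exact: cprocD.
exists (fun t x => M t x + N t x), (fun t x => A t x + B t x); split.
- exact: cprocD.
- exact: loc_martD.
- exact: cprocD.
- by move=> x; exact: bvpathD.
- by move=> t x t0; rewrite XE// YE//; ring.
Qed.

Lemma csmZ c X : csm X -> csm (fun t x => c * X t x).
Proof.
move=> [cX [M [A [cM hM cA bA XE]]]]; split; first exact: cprocZ.
exists (fun t x => c * M t x), (fun t x => c * A t x); split.
- exact: cprocZ.
- exact: loc_martZ.
- exact: cprocZ.
- by move=> x; exact: bvpathZ.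
- by move=> t x t0; rewrite XE//; ring.
Qed.

Lemma loc_mart0 : cont_local_martingale P F (fun _ _ => 0).
Proof.
have c0 := cproc_cst 0.
apply: (@loc_mart_intro _ _ _ _ _ F_usual _ (fun _ _ => 0)) => // n.
apply/(martingaleP F_usual); split.
- by apply/(adaptedP F_usual) => t t0; rewrite /stopped subrr; exact: Fm_cst.
- by move=> t t0; rewrite /stopped subrr; exact: itg_cst.
move=> s t A s0 st FA; rewrite /stopped.
by under [X in Ex P X]eq_fun do rewrite !subrr mul0r; exact: Ex_cst.
Qed.

Lemma csm_fv A : cproc F A -> (forall x, bvpath (A ^~ x)) -> csm A.
Proof.
move=> cA bA; split => //; exists (fun _ _ => 0), A; split => //.
- exact: cproc_cst.
- exact: loc_mart0.
- by move=> t x _; rewrite add0r.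
Qed.

End Decomposition.

(** * Elementary integrals *)

Section GoodIntegrator.
Context {R : realType} {d : measure_display} {Omega : measurableType d}.
Context (P : probability Omega R) (F : R -> set (set Omega)).
Context (F_usual : usual_filtration P F).
Implicit Types s t u e : R.

Lemma prob_mono (A B : set Omega) : measurable A -> measurable B -> A `<=` B ->
  (P A <= P B)%E.
Proof. by move=> mA mB AB; apply: le_measure => //; rewrite inE. Qed.

Lemma prob_le2 (A B C : set Omega) e1 e2 : measurable A -> measurable B ->
  measurable C -> C `<=` A `|` B -> (P A <= e1%:E)%E -> (P B <= e2%:E)%E ->
  (P C <= (e1 + e2)%:E)%E.
Proof.
move=> mA mB mC CAB PA PB; apply: (@le_trans _ _ (P (A `|` B))).
  by apply: prob_mono => //; exact: measurableU.
by apply: (le_trans (measureU2 _ mA mB)); rewrite EFinD leeD.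
Qed.

Lemma decreasing_small (A : nat -> set Omega) e : 0 < e ->
  (forall n, measurable (A n)) -> (forall n, A n.+1 `<=` A n) ->
  (forall x, exists n, ~ A n x) -> exists n, (P (A n) <= e%:E)%E.
Proof.
move=> e0 mA dA A0.
have A00 : \bigcap_n A n = set0.
  by apply/seteqP; split => x //= h; have [n] := A0 x; apply; exact: h.
have : P \o A @ \oo --> P (\bigcap_n A n).
  apply: nonincreasing_cvg_mu => //.
  - by rewrite (le_lt_trans (probability_le1 _ _))// ltry.
  - by rewrite A00.
  - by apply/nonincreasing_seqP => n; apply/subsetPset; exact: dA.
rewrite A00 measure0 => /fine_cvgP[_ /cvgrPdist_le/(_ e e0)[n _ nP]].
exists n; have := nP n (leqnn n); rewrite sub0r normrN /= ger0_norm ?fine_ge0//.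
rewrite -lee_fin fineK// ge0_fin_numE// (le_lt_trans (probability_le1 _ _))//.
exact: ltry.
Qed.

(** A grid is an infinite sequence in which points may repeat; a finite partition is continued by
    its endpoint, so sums of any length make sense. *)
Definition grid t (p : nat -> R) :=
  [/\ forall i, 0 <= p i, forall i, p i <= t & forall i, p i <= p i.+1].

Lemma grid_mono t p i j : grid t p -> (i <= j)%N -> p i <= p j.
Proof.
move=> [_ _ pS]; elim: j => [|j IH]; first by rewrite leqn0 => /eqP ->.
rewrite leq_eqVlt => /orP[/eqP ->//|]; rewrite ltnS => /IH h.
exact: le_trans (pS j).
Qed.

Definition gsum (p : nat -> R) (h : nat -> Omega -> R) (Z : R -> Omega -> R) N x : R :=
  \sum_(i < N) h i x * (Z (p i.+1) x - Z (p i) x).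

Lemma gsumS p h Z N x : gsum p h Z N.+1 x =
  gsum p h Z N x + h N x * (Z (p N.+1) x - Z (p N) x).
Proof. by rewrite /gsum big_ord_recr. Qed.

Lemma gsum_Fm t p h Z N s : grid t p -> cproc F Z -> (forall i, Fm F (p i) (h i)) ->
  p N <= s -> Fm F s (gsum p h Z N).
Proof.
move=> hp hZ mh pN; apply: Fm_sum => i.
have [p0 _ _] := hp.
have ps k : (k <= N)%N -> p k <= s by move=> kN; exact: le_trans (grid_mono hp kN) pN.
apply: FmM.
  by apply: (Fm_mono F_usual (p0 i) (ps i (ltnW (ltn_ord i)))).
apply: FmB.
  by apply: (Fm_mono F_usual (p0 _) (ps _ (ltn_ord i))); exact: (cproc_Fm F_usual).
by apply: (Fm_mono F_usual (p0 _) (ps _ (ltnW (ltn_ord i)))); exact: (cproc_Fm F_usual).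
Qed.

Lemma gsum_meas t p h Z N : grid t p -> cproc F Z -> (forall i, Fm F (p i) (h i)) ->
  measurable_fun setT (gsum p h Z N).
Proof.
move=> hp hZ mh; have [p0 _ _] := hp; apply: (Fm_meas F_usual (p0 N)).
exact: (gsum_Fm hp hZ mh).
Qed.

Lemma meas_ge (f : Omega -> R) c : measurable_fun setT f ->
  measurable [set x | (c <= `|f x|)%R].
Proof.
move=> mf; rewrite (_ : mkset _ = (fun x => `|f x|) @^-1` [set` `[c, +oo[]).
  have mfn : measurable_fun setT (fun x => `|f x|) by exact: measurableT_comp.
  by rewrite -[_ @^-1` _]setTI; exact: mfn.
by apply/seteqP; split => x /=; rewrite in_itv/= andbT.
Qed.

(* The easy half of the Bichteler-Dellacherie theorem: elementary integrals
   against a semimartingale are bounded in probability. *)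
Definition good (Z : R -> Omega -> R) := forall t e, 0 <= t -> 0 < e ->
  exists2 C, 0 < C & forall N p h, grid t p -> (forall i, Fm F (p i) (h i)) ->
    (forall i x, `|h i x| <= 1) ->
    (P [set x | (C <= `|gsum p h Z N x|)%R] <= e%:E)%E.

(** Increments of a martingale are orthogonal to the past, so cross terms vanish and the second
    moment is at most the sum of those of the increments of [L]. That sum telescopes, whence a bound
    independent of [N]. *)
Lemma bounded_mart_L2 L c t p h N : martingale P F L -> cproc F L -> 0 <= c ->
  (forall t x, 0 <= t -> `|L t x| <= c) -> grid t p ->
  (forall i, Fm F (p i) (h i)) -> (forall i x, `|h i x| <= 1) ->
  itg P (fun x => gsum p h L N x ^+ 2) /\ Ex P (fun x => gsum p h L N x ^+ 2) <= c ^+ 2.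
Proof.
move=> mL cL c0 Lc hp mh h1; have [p0 pt pS] := hp.
have mLp i : measurable_fun setT (L (p i)) by apply: (cproc_meas F_usual).
have Sb n x : `|gsum p h L n x| <= (c + c) * n%:R.
  elim: n => [|n IH]; first by rewrite /gsum big_ord0 normr0 mulr0.
  rewrite gsumS (le_trans (ler_normD _ _))// -natr1 [leRHS]mulrDr mulr1 lerD//.
  rewrite normrM -[leRHS]mul1r ler_pM// (le_trans (ler_normB _ _))// lerD//;
    exact: Lc.
have mS n := gsum_meas n hp cL mh.
have IS2 n : itg P (fun x => gsum p h L n x ^+ 2).
  apply: (@itg_bound _ _ _ _ _ (((c + c) * n%:R) ^+ 2)).
    exact: measurable_funX.
  by move=> x; rewrite normrX lerXn2r ?nnegrE ?mulr_ge0 ?addr_ge0.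
have IL2 n : itg P (fun x => L (p n) x ^+ 2).
  apply: (@itg_bound _ _ _ _ _ (c ^+ 2)); first exact: measurable_funX.
  by move=> x; rewrite normrX lerXn2r ?nnegrE// Lc.
split; first exact: IS2.
suff : Ex P (fun x => gsum p h L N x ^+ 2) <=
    Ex P (fun x => L (p N) x ^+ 2) - Ex P (fun x => L (p 0%N) x ^+ 2).
  move=> h2; apply: (le_trans h2); rewrite lerBlDr -[leLHS]addr0 lerD//.
    rewrite -[leRHS](Ex_cst P); apply: Ex_le => [||x]; [exact: IL2|exact: itg_cst|].
    by rewrite -[leLHS]ger0_norm ?sqr_ge0// normrX lerXn2r ?nnegrE// Lc.
  by apply: Ex_ge0 => x; exact: sqr_ge0.
elim: N => [|N IH].
  rewrite subrr (_ : (fun _ => _) = fun=> 0) ?Ex_cst//.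
  by apply/funext => x; rewrite /gsum big_ord0 expr0n.
pose dL x := L (p N.+1) x - L (p N) x.
have IdL : itg P dL by apply: itgB; apply: (martingale_itg mL).
have o1 : Ex P (fun x => dL x * (gsum p h L N x * h N x)) = 0.
  apply: (mart_orth F_usual (c := (c + c) * N%:R) mL (p0 N) (pS N)).
    by apply: FmM => //; apply: (gsum_Fm hp cL mh).
  by move=> x; rewrite normrM -[leRHS]mulr1 ler_pM.
have o2 : Ex P (fun x => dL x * L (p N) x) = 0.
  apply: (mart_orth F_usual (c := c) mL (p0 N) (pS N)).
    exact: (cproc_Fm F_usual).
  by move=> x; exact: Lc.
have I1 : itg P (fun x => dL x * (gsum p h L N x * h N x)).
  apply: (@itgM _ _ _ _ ((c + c) * N%:R)) => //.
    by apply: measurable_funM => //; exact: (Fm_meas F_usual (p0 N) (mh N)).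
  by move=> x; rewrite normrM -[leRHS]mulr1 ler_pM.
have I2 : itg P (fun x => dL x * L (p N) x).
  by apply: (@itgM _ _ _ _ c) => // x; exact: Lc.
(* The square of the increment [dL] is written as a telescoping term minus twice [dL * L], whose
   expectation is 0 by orthogonality. *)
have IE x : gsum p h L N.+1 x ^+ 2 <= gsum p h L N x ^+ 2 +
    (2 * (dL x * (gsum p h L N x * h N x)) +
     ((L (p N.+1) x ^+ 2 - L (p N) x ^+ 2) - 2 * (dL x * L (p N) x))).
  rewrite gsumS -/(dL x).
  have -> : (L (p N.+1) x ^+ 2 - L (p N) x ^+ 2) - 2 * (dL x * L (p N) x) = dL x ^+ 2.
    by rewrite /dL; ring.
  have : h N x ^+ 2 * dL x ^+ 2 <= dL x ^+ 2.
    rewrite ler_piMl ?sqr_ge0// -[leLHS]ger0_norm ?sqr_ge0// normrX.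
    by rewrite -(expr1n _ 2) lerXn2r ?nnegrE.
  by have -> : (gsum p h L N x + h N x * dL x) ^+ 2 =
    gsum p h L N x ^+ 2 + (2 * (dL x * (gsum p h L N x * h N x)) + h N x ^+ 2 * dL x ^+ 2);
    [ring|lra].
have := @Ex_le _ _ _ P _ _ (IS2 N.+1) _ IE.
rewrite ExD//; last first.
  by apply: itgD; [exact: itgZ|apply: itgB; [exact: itgB|exact: itgZ]].
rewrite ExD; [|exact: itgZ|by apply: itgB; [exact: itgB|exact: itgZ]].
rewrite ExB; [|exact: itgB|exact: itgZ].
rewrite ExB// !ExZ// o1 o2 !mulr0 => h2.
have : itg P (fun x => gsum p h L N x ^+ 2 +
    (2 * (dL x * (gsum p h L N x * h N x)) +
     ((L (p N.+1) x ^+ 2 - L (p N) x ^+ 2) - 2 * (dL x * L (p N) x)))).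
  apply: itgD => //.
  by apply: itgD; [exact: itgZ|apply: itgB; [exact: itgB|exact: itgZ]].
by move=> /h2; lra.
Qed.

(** Stopping at a high level changes the sums only on a rare event, and the stopped process is a
    bounded martingale, to which the L^2 bound and Chebyshev's inequality apply. *)
Lemma good_loc_mart M : cproc F M -> cont_local_martingale P F M -> good M.
Proof.
move=> cM hM t e t0 e0; have e20 : 0 < e / 2 by rewrite divr_gt0.
pose Y t x := M t x - M 0 x.
have cY : cproc F Y by apply: (cprocB F_usual) => //; exact: (cproc_init F_usual).
have mH n : measurable [set x | (hit Y n%:R x <= t%:E)%E].
  apply: (Fset_meas F_usual t0).
  by have [_] := hit_stopping F_usual n%:R cY; apply.
have [n Pn] : exists n, (P [set x | (hit Y n%:R x <= t%:E)%E] <= (e / 2)%:E)%E.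
  apply: decreasing_small => //.
    by move=> n x /=; apply: le_trans; apply: hit_mono; rewrite ler_nat.
  move=> x; have [n0 h0] := hit_infty (cY.2 x) t0.
  by exists n0; apply/negP; rewrite -ltNge; exact: h0.
pose L t x := stopped M (hit Y n%:R) t x - M 0 x.
have [mL bL] := loc_mart_bounded F_usual hM cM cY (fun t x _ => lexx _) (ler0n _ n).
have cL : cproc F L.
  apply: (cprocB F_usual); last exact: (cproc_init F_usual).
  apply: (stopped_cproc F_usual cM); exact: (hit_stopping F_usual).
(* Chosen so that Chebyshev's inequality with the bound [n ^ 2] gives at most [e / 2]; the successor
   keeps [C] positive when [n] is 0. *)
pose C : R := Num.sqrt (2 * n.+1%:R ^+ 2 / e).
have C0 : 0 < C by rewrite sqrtr_gt0 divr_gt0// mulr_gt0// exprn_gt0.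
exists C => // N p h hp mh h1; have [p0 pt pS] := hp.
rewrite [e]splitr; apply: (prob_le2 (mH n) (meas_ge C (gsum_meas N hp cL mh))) => //.
- exact: meas_ge (gsum_meas N hp cM mh).
- move=> x /= Cx; have [h2|h2] := leP (hit Y n%:R x) t%:E; [by left|right].
  rewrite (_ : gsum p h L N x = gsum p h M N x)//; apply: eq_bigr => i _.
  have LE k : L (p k) x = M (p k) x - M 0 x.
    rewrite /L /stopped -/(stp _ _) stp_id//; first exact: hit_ge0.
    by apply: le_trans (ltW h2); rewrite lee_fin.
  by rewrite !LE; congr (_ * _); ring.
- have [IS ES] := bounded_mart_L2 N mL cL (ler0n _ n) bL hp mh h1.
  apply: le_trans (prob_ge C0 IS (gsum_meas N hp cL mh)) _.
  rewrite lee_fin ler_pdivrMr ?exprn_gt0//; apply: le_trans ES _.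
  rewrite sqr_sqrtr; last by rewrite divr_ge0 ?ltW// mulr_gt0// exprn_gt0.
  rewrite (_ : e / 2 * _ = n.+1%:R ^+ 2); last by field; rewrite gt_eqF.
  by rewrite lerXn2r ?nnegrE// ler_nat.
Qed.

(** Path by path the sums are at most [T t - T 0], but this bound is not known to be measurable in
    the outcome. Hence the detour by contradiction: for each [n] a counterexample with threshold
    [n.+1] is chosen, its event [E n] is measurable, and each outcome lies in only finitely many of
    these events. *)
Lemma good_fv A : cproc F A -> (forall x, bvpath (A ^~ x)) -> good A.
Proof.
move=> cA bA t e t0 e0; apply: contrapT => hn.
have bad n : exists N p h, [/\ grid t p, (forall i, Fm F (p i) (h i)),
    (forall i x, `|h i x| <= 1) &
    ~ (P [set x | (n.+1%:R <= `|gsum p h A N x|)%R] <= e%:E)%E].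
  apply: contrapT => hn'; apply: hn; exists n.+1%:R => // N p h hp mh h1.
  by apply: contrapT => hP; apply: hn'; exists N, p, h.
have [f hf] := choice (fun n => bad n).
have [p hp] := choice hf.
have [h hh] := choice hp.
pose E n := [set x | (n.+1%:R <= `|gsum (p n) (h n) A (f n) x|)%R].
have mE n : measurable (E n).
  by have [g mh _ _] := hh n; exact: meas_ge (gsum_meas _ g cA mh).
pose B n := \bigcup_k E (n + k)%N.
have mB n : measurable (B n) by apply: bigcupT_measurable => k.
have [n Pn] : exists n, (P (B n) <= e%:E)%E.
  apply: decreasing_small => //.
    by move=> n x [k _ hk]; exists k.+1 => //; rewrite addnS -addSn.
  move=> x; have [T hT] := bA x.
  pose n0 := Num.truncn (T t - T 0); exists n0.+1 => -[k _]; rewrite /E /=.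
  set n := (n0.+1 + k)%N => hE.
  have [g _ h1 _] := hh n; have [p0 pt pS] := g.
  have : `|gsum (p n) (h n) A (f n) x| <= T t - T 0.
    apply: (@le_trans _ _ (\sum_(i < f n) (T (p n i.+1) - T (p n i)))).
      apply: (le_trans (ler_norm_sum _ _ _)); apply: ler_sum => i _.
      rewrite normrM -[leRHS]mul1r ler_pM//; exact: hT.
    have := telescope_sumr (fun i => T (p n i)) (leq0n (f n)).
    rewrite big_mkord => ->.
    have Tm u v : 0 <= u -> u <= v -> T u <= T v.
      by move=> u0 uv; rewrite -subr_ge0 (le_trans _ (hT u v u0 uv)).
    by rewrite lerB// Tm.
  apply/negP; rewrite -ltNge; apply: lt_le_trans hE.
  apply: lt_le_trans (truncnS_gt _) _; rewrite ler_nat.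
  by rewrite /n ltnS (leq_trans (leqnSn _))// leq_addr.
have [_ _ _] := hh n; apply; apply: le_trans Pn.
apply: prob_mono => //; first exact: mE.
by move=> x hx; exists 0%N; rewrite ?addn0.
Qed.

Lemma goodD Z Z' : cproc F Z -> cproc F Z' -> good Z -> good Z' ->
  good (fun t x => Z t x + Z' t x).
Proof.
move=> cZ cZ' gZ gZ' t e t0 e0; have e20 : 0 < e / 2 by rewrite divr_gt0.
have [C C0 hC] := gZ t _ t0 e20; have [C' C'0 hC'] := gZ' t _ t0 e20.
exists (C + C'); first by rewrite addr_gt0.
move=> N p h hp mh h1; rewrite [e]splitr.
apply: (prob_le2 (meas_ge C (gsum_meas N hp cZ mh))
  (meas_ge C' (gsum_meas N hp cZ' mh))); last 2 first.
- exact: hC.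
- exact: hC'.
- by apply: meas_ge; apply: (gsum_meas N hp _ mh); exact: (cprocD F_usual).
move=> x /= hx; apply/orP; rewrite -implyNb; apply/implyP; rewrite -ltNge => hlt.
have E : gsum p h (fun t x => Z t x + Z' t x) N x = gsum p h Z N x + gsum p h Z' N x.
  by rewrite /gsum -big_split; apply: eq_bigr => i _ /=; ring.
by move: hx; rewrite E; have := ler_normD (gsum p h Z N x) (gsum p h Z' N x); lra.
Qed.

Lemma good_ext Z Z' : (forall t x, 0 <= t -> Z t x = Z' t x) -> good Z -> good Z'.
Proof.
move=> ZZ gZ t e t0 e0; have [C C0 hC] := gZ t e t0 e0; exists C => //.
move=> N p h hp mh h1; rewrite (_ : gsum p h Z' N = gsum p h Z N); first exact: hC.
by apply/funext => x; apply: eq_bigr => i _; have [p0 _ _] := hp; rewrite !ZZ.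
Qed.

Lemma good_csm X : csm P F X -> good X.
Proof.
move=> [cX [M [A [cM hM cA bA XE]]]].
apply: (@good_ext (fun t x => M t x + A t x)); first by move=> t x /XE ->.
by apply: goodD => //; [exact: good_loc_mart|exact: good_fv].
Qed.

(** If the integrand is cut once a partial sum has reached [C], it remains adapted and bounded by 1,
    and its final sum is the first partial sum of size at least [C]. The estimate for final sums
    therefore covers all partial sums, with the same [C]. *)
Lemma good_max Z : cproc F Z -> good Z -> forall t e, 0 <= t -> 0 < e ->
  exists2 C, 0 < C & forall N p h, grid t p -> (forall i, Fm F (p i) (h i)) ->
    (forall i x, `|h i x| <= 1) ->
    exists B, [/\ measurable B, (P B <= e%:E)%E &
      forall x, ~ B x -> forall j, (j <= N)%N -> `|gsum p h Z j x| < C].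
Proof.
move=> cZ gZ t e t0 e0; have [C C0 hC] := gZ t e t0 e0; exists C => //.
move=> N p h hp mh h1; have [p0 pt pS] := hp.
pose b i x := [forall k : 'I_i.+1, `|gsum p h Z k x| < C].
have bP i x : reflect (forall k, (k <= i)%N -> `|gsum p h Z k x| < C) (b i x).
  apply: (iffP forallP) => [H k ki|H k]; first by have := H (Ordinal (ki : (k < i.+1)%N)).
  by apply: H; rewrite -ltnS.
have Fb i : F (p i) [set x | b i x].
  rewrite (_ : mkset _ = \bigcap_(k in [set k | (k <= i)%N]) [set x | `|gsum p h Z k x| < C]).
    rewrite (FsetE F_usual)//; apply: bigcap_measurable => [|k /= ki].
      by exists 0%N.
    rewrite -(FsetE F_usual)//; apply: (Fm_lt F_usual) => //; apply: Fm_norm.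
    by apply: (gsum_Fm hp cZ mh); exact: (grid_mono hp).
  by apply/seteqP; split => x /=; [move=> /bP H k; exact: H|move=> H; apply/bP].
pose h' i x := h i x * \1_[set x | b i x] x.
have mh' i : Fm F (p i) (h' i) by apply: FmM => //; exact: (Fm_indic F_usual).
have h'1 i x : `|h' i x| <= 1.
  rewrite normrM -[leRHS]mul1r ler_pM// indicE.
  by case: (_ \in _); rewrite ?normr1 ?normr0.
exists [set x | (C <= `|gsum p h' Z N x|)%R]; split.
- exact: meas_ge (gsum_meas N hp cZ mh').
- exact: hC.
move=> x /= hx j jN; rewrite ltNge; apply/negP => hj; apply: hx.
have bS i : b i.+1 x -> b i x.
  by move=> /bP H; apply/bP => k ki; apply: H; exact: leqW.
have [l [lN bl nbl hl]] := @telescope_stop R (b ^~ x) N bS.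
have E : gsum p h' Z N x = gsum p h Z l x.
  have g0 : gsum p h Z 0 x = 0 by rewrite /gsum big_ord0.
  have := hl (fun k => gsum p h Z k x); rewrite g0 subr0 => <-; apply: eq_bigr => i _.
  rewrite gsumS addrAC subrr add0r /h' indicE mulrCA mulrA.
  congr (_ * _ * _); rewrite /=.
  by case: (boolP (b i x)) => hb; [rewrite mem_set|rewrite memNset//; exact/negP].
rewrite E; move: lN; rewrite leq_eqVlt => /orP[/eqP lN|lN].
  move: jN; rewrite leq_eqVlt => /orP[/eqP jN|jN]; first by rewrite lN -jN.
  have : b j x by apply: bl; rewrite lN.
  by move=> /bP/(_ j (leqnn j)); rewrite ltNge hj.
rewrite leNgt; apply/negP => hlC; move: (nbl lN) => /negP; apply.
apply/bP => k; rewrite leq_eqVlt => /orP[/eqP ->//|kl].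
by have /bP/(_ k (leqnn k)) := bl k kl.
Qed.

(** The bound on [h] holds only off [B]; clipping makes it hold everywhere, preserves adaptedness
    and changes nothing off [B]. As [C] is chosen before [K], small integrands give small sums. *)
Lemma good_bound Z : cproc F Z -> good Z -> forall t e, 0 <= t -> 0 < e ->
  exists2 C, 0 < C & forall K, 0 < K -> forall N p h B, grid t p ->
    (forall i, Fm F (p i) (h i)) ->
    (forall x, ~ B x -> forall i, (i < N)%N -> `|h i x| <= K) ->
    exists B', [/\ measurable B', (P B' <= e%:E)%E &
      forall x, ~ B x -> ~ B' x -> forall j, (j <= N)%N -> `|gsum p h Z j x| < C * K].
Proof.
move=> cZ gZ t e t0 e0; have [C C0 hC] := good_max cZ gZ t0 e0; exists C => //.
move=> K K0 N p h B hp mh hB.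
have cl : continuous (clip K) by apply: clip_continuous; exact: ltW.
have [||B' [mB' PB' hB']] := hC N p (fun i x => K^-1 * clip K (h i x)) hp.
- by move=> i; apply: FmZ; exact: Fm_comp.
- move=> i x; rewrite normrM (ger0_norm (_ : 0 <= K^-1)) ?invr_ge0 ?(ltW K0)//.
  by rewrite mulrC ler_pdivrMr// mul1r; apply: clip_le; exact: ltW.
exists B'; split => // x Bx B'x j jN.
have := hB' x B'x j jN.
rewrite (_ : gsum p _ Z j x = K^-1 * gsum p h Z j x); last first.
  rewrite /gsum mulr_sumr; apply: eq_bigr => i _; rewrite clip_id ?mulrA//.
  by apply: hB => //; exact: leq_trans jN.
rewrite normrM (ger0_norm (_ : 0 <= K^-1)) ?invr_ge0 ?(ltW K0)//.
by rewrite mulrC ltr_pdivrMr.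
Qed.

End GoodIntegrator.

(** * Integration and convex functions *)

Section UniformLimits.
Context {R : realType}.
Implicit Types (s t u v : R).

(** Terms of a series of sum 1, in the shape used by [epsilon_trick0]. They serve both as distances
    between successive approximations and as probabilities of exceptional sets. *)
Definition heps k : R := 1 / (2 ^ k.+1)%:R.

Lemma heps_gt0 k : 0 < heps k.
Proof. by rewrite divr_gt0// ltr0n expn_gt0. Qed.

Lemma hepsS k : heps k = heps k.+1 + heps k.+1.
Proof.
rewrite /heps (expnS 2 k.+1) natrM; field.
by rewrite pnatr_eq0 expn_eq0.
Qed.

Lemma heps_small (e : R) : 0 < e -> exists k0, forall k, (k0 <= k)%N -> heps k < e.
Proof.
move=> e0; exists (Num.truncn e^-1) => k hk; rewrite /heps mul1r.
rewrite invf_plt ?posrE ?ltr0n ?expn_gt0//.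
apply: lt_le_trans (truncnS_gt _) _; rewrite ler_nat.
apply: leq_trans (ltnW (ltn_expl _ (isT : (1 < 2)%N))).
by rewrite ltnS.
Qed.

(** Each [heps i] equals [2 * heps i - 2 * heps i.+1], so the bounds on the successive distances
    telescope. *)
Lemma dist_heps (f : nat -> R -> R) n0 :
  (forall k, (n0 <= k)%N -> forall t, 0 <= t -> t <= k%:R ->
    `|f k.+1 t - f k t| <= heps k) ->
  forall k n t, (n0 <= k)%N -> (k <= n)%N -> 0 <= t -> t <= k%:R ->
  `|f n t - f k t| <= 2 * heps k - 2 * heps n.
Proof.
move=> h k n t n0k kn t0 tk; rewrite -(subnKC kn).
elim: (n - k)%N => [|i IH]; first by rewrite addn0 !subrr normr0.
rewrite addnS; have := h (k + i)%N (leq_trans n0k (leq_addr _ _)) t t0.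
have tki : t <= (k + i)%:R by apply: (le_trans tk); rewrite ler_nat leq_addr.
move=> /(_ tki); have := hepsS (k + i).
have := ler_normD (f (k + i).+1 t - f (k + i)%N t) (f (k + i)%N t - f k t).
rewrite addrA subrK; lra.
Qed.

Lemma locally_uniform_limit (f : nat -> R -> R) :
  (forall k, continuous (f k)) -> (forall k t, t <= 0 -> f k t = 0) ->
  (exists n0, forall k, (n0 <= k)%N -> forall t, 0 <= t -> t <= k%:R ->
    `|f k.+1 t - f k t| <= heps k) ->
  exists2 g : R -> R, continuous g & forall t, f ^~ t @ \oo --> g t.
Proof.
move=> cf f0 [n0 h].
have D := dist_heps h.
have cv t : cvg (f ^~ t @ \oo).
  have [t0|t0] := leP t 0.
    by apply/cvg_ex; exists 0; apply: cvg_near_cst; apply: nearW => k; rewrite f0.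
  apply: cauchy_cvg; apply: cauchy_exP => e e0.
  have [k0 hk0] := heps_small (divr_gt0 e0 (ltr0n R 2)).
  pose k := maxn (maxn n0 k0) (Num.truncn t).+1.
  have kn0 : (n0 <= k)%N by rewrite /k !leq_max leqnn.
  have kk0 : (k0 <= k)%N by rewrite /k !leq_max leqnn orbT.
  have tk : t <= k%:R.
    by apply: (le_trans (ltW (truncnS_gt t))); rewrite ler_nat leq_max leqnn orbT.
  exists (f k t); exists k => // n /= kn; rewrite /ball/= distrC.
  apply: le_lt_trans (D k n t kn0 kn (ltW t0) tk) _.
  have := hk0 k kk0; have := heps_gt0 n; lra.
pose g t := limn (f ^~ t); exists g => [|t]; last exact: cv.
have Dg k t : (n0 <= k)%N -> t <= k%:R -> `|g t - f k t| <= 2 * heps k.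
  move=> n0k tk; have [t0|t0] := leP t 0.
    rewrite (_ : g t = 0) ?f0 ?subrr ?normr0 ?mulr_ge0 ?(ltW (heps_gt0 _))//.
    by apply: cvg_lim => //; apply: cvg_near_cst; apply: nearW => i; rewrite f0.
  have h1 : (fun n => `|f n t - f k t|) @ \oo --> `|g t - f k t|.
    by apply: cvg_norm; apply: cvgB; [exact: cv|exact: cvg_cst].
  rewrite -(cvg_lim _ h1)//; apply: limr_le; first exact: cvgP h1.
  exists k => // n /= kn; apply: le_trans (D k n t n0k kn (ltW t0) tk) _.
  by have := heps_gt0 n; lra.
move=> t; apply/cvgrPdist_lt => e e0.
have [k0 hk0] := heps_small (divr_gt0 e0 (ltr0n R 6)).
pose k := maxn (maxn n0 k0) (Num.truncn (t + 1)).+1.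
have kn0 : (n0 <= k)%N by rewrite /k !leq_max leqnn.
have kk0 : (k0 <= k)%N by rewrite /k !leq_max leqnn orbT.
have tk : t + 1 < k%:R.
  by apply: (lt_le_trans (truncnS_gt _)); rewrite ler_nat leq_max leqnn orbT.
have tk' : t <= k%:R by lra.
have h1 := Dg k t kn0 tk'.
have fk : \forall s \near t, `|f k t - f k s| < e / 3.
  by have /cvgrPdist_lt := cf k t; apply; rewrite divr_gt0.
near=> s.
have hs : s <= k%:R.
  apply: le_trans (ltW tk); near: s.
  apply/nbhs_ballP; exists 1 => //= s; rewrite /ball/= ltr_norml; lra.
have h2 := Dg k s kn0 hs.
have h3 : `|f k t - f k s| < e / 3 by near: s; exact: fk.
have h4 := hk0 k kk0.
rewrite (_ : g t - g s = (g t - f k t) + (f k t - f k s) + (f k s - g s)); last by ring.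
apply: le_lt_trans (ler_normD _ _) _; rewrite (distrC (f k s)).
apply: le_lt_trans (lerD (ler_normD _ _) (lexx _)) _.
by lra.
Unshelve. all: by end_near. Qed.

Lemma uniform_continuity (f : R -> R) T e : continuous f -> 0 <= T -> 0 < e ->
  exists n : nat, forall u v, 0 <= u -> u <= T -> 0 <= v -> v <= T ->
    `|u - v| < n.+1%:R^-1 -> `|f u - f v| <= e.
Proof.
move=> cf T0 e0; apply: contrapT => hn.
have bad n : exists uv : R * R, [/\ 0 <= uv.1 <= T, 0 <= uv.2 <= T,
    `|uv.1 - uv.2| < n.+1%:R^-1 & e < `|f uv.1 - f uv.2|].
  apply: contrapT => hn'; apply: hn; exists n => u v u0 uT v0 vT uv.
  rewrite leNgt; apply/negP => he; apply: hn'; exists (u, v).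
  by split; rewrite /= ?u0 ?v0.
have [w hw] := choice bad.
have [c [_ cl]] : exists c : R, `[0, T]%classic c /\ cluster ((fun n => (w n).1) @ \oo) c.
  have := @segment_compact R 0 T; move=> /(_ ((fun n => (w n).1) @ \oo) _).
  apply; exists 0%N => // n _ /=; have [h _ _ _] := hw n.
  by rewrite in_itv.
have e2 : 0 < e / 2 by rewrite divr_gt0.
have /cvgrPdist_lt/(_ _ e2)/nbhs_ballP[r /= r0 hr] := cf c.
have r2 : 0 < r / 2 by rewrite divr_gt0.
pose n0 := Num.truncn (r / 2)^-1.
have [_ [[n /= n0n <-] hb]] := cl [set (w n).1 | n in [set n | (n0 <= n)%N]]
   (ball c (r / 2)) (ex_intro2 _ _ n0 I (fun n hn => ex_intro2 _ _ n hn erefl))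
   (nbhsx_ballx _ _ r2).
have [_ _ h1 h2] := hw n.
have nr : n.+1%:R^-1 < r / 2.
  rewrite invf_plt ?posrE// ?ltr0n//; apply: (lt_le_trans (truncnS_gt _)).
  by rewrite ler_nat.
have b1 : `|f c - f (w n).1| < e / 2.
  by apply: hr; move: hb; rewrite /ball/=; lra.
have b2 : `|f c - f (w n).2| < e / 2.
  apply: hr; rewrite /ball/=.
  rewrite (_ : c - _ = (c - (w n).1) + ((w n).1 - (w n).2)); last by ring.
  apply: le_lt_trans (ler_normD _ _) _; rewrite [r]splitr ltrD//.
  exact: lt_trans h1 nr.
move: h2; rewrite ltNge => /negP; apply.
rewrite (_ : _ - _ = (f c - f (w n).2) - (f c - f (w n).1)); last by ring.
apply: le_trans (ler_normB _ _) _; lra.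
Qed.

End UniformLimits.

(** * Oscillation and supremum of continuous processes, off a rare event *)

Section Oscillation.
Context {R : realType} {d : measure_display} {Omega : measurableType d}.
Context (P : probability Omega R) (F : R -> set (set Omega)).
Context (F_usual : usual_filtration P F).
Implicit Types (s t u v T e : R).

(** Uniform continuity makes the events [A n] decrease to the empty set; they are taken over pairs
    of rational times in order to be measurable. The map [cl] projects times on [[0, T]], so that
    endpoints are reached even when [T] is irrational. *)
Lemma osc_small X T dl e : cproc F X -> 0 <= T -> 0 < dl -> 0 < e ->
  exists2 eta, 0 < eta & exists B, [/\ measurable B, (P B <= e%:E)%E &
    forall x, ~ B x -> forall u v, 0 <= u -> u <= T -> 0 <= v -> v <= T ->
      `|u - v| <= eta -> `|X u x - X v x| <= dl].
Proof.
move=> cX T0 dl0 e0.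
have T2 : 0 <= T / 2 by rewrite divr_ge0.
pose cl q := clip (T / 2) (q - T / 2) + T / 2.
have clb q : `|clip (T / 2) (q - T / 2)| <= T / 2 by exact: clip_le.
have cl0 q : 0 <= cl q by have := clb q; rewrite ler_norml /cl; lra.
have clT q : cl q <= T by have := clb q; rewrite ler_norml /cl; lra.
have clE q : 0 <= q -> q <= T -> cl q = q.
  by move=> q0 qT; rewrite /cl clip_id ?subrK// ler_norml; apply/andP; split; lra.
have clc : continuous cl.
  move=> q; apply: cvgD; last exact: cvg_cst.
  apply: (@continuous_cvg _ _ _ _ _ (fun q => q - T / 2) (clip (T / 2))).
    exact: clip_continuous.
  by apply: cvgB; [exact: cvg_id|exact: cvg_cst].
have cll q q' : `|cl q - cl q'| <= `|q - q'|.
  have -> : cl q - cl q' = clip (T / 2) (q - T / 2) - clip (T / 2) (q' - T / 2).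
    by rewrite /cl; ring.
  have := clip_lip (q - T / 2) (q' - T / 2) T2.
  by rewrite (_ : q - T / 2 - (q' - T / 2) = q - q'); [|ring].
pose A n := \bigcup_(q : rat) \bigcup_(q' : rat)
  (if `|ratr q - ratr q' : R| < n.+1%:R^-1 then
     [set x | dl < `|X (cl (ratr q)) x - X (cl (ratr q')) x|] else set0).
have mX u : 0 <= u -> measurable_fun setT (X u) by exact: (cproc_meas F_usual).
have mA n : measurable (A n).
  apply: bigcupT_measurable_rat => q; apply: bigcupT_measurable_rat => q'.
  case: ifP => // _.
  apply: (Fset_meas F_usual T0); apply: (Fm_gt F_usual dl T0); apply: Fm_norm.
  by apply: FmB; apply: (Fm_mono F_usual (cl0 _) (clT _)); exact: (cproc_Fm F_usual).
have dA n : A n.+1 `<=` A n.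
  move=> x [q _ [q' _]]; case: ifP => // h hx; exists q => //; exists q' => //.
  rewrite ifT//; apply: lt_le_trans h _.
  by rewrite lef_pV2 ?posrE ?ltr0n// ler_nat.
have A0 x : exists n, ~ A n x.
  have [n hn] := uniform_continuity (cX.2 x) T0 dl0.
  exists n => -[q _ [q' _]]; case: ifP => // h /=.
  apply/negP; rewrite -leNgt; apply: hn => //.
  exact: le_lt_trans (cll _ _) h.
have [n Pn] := @decreasing_small _ _ _ P A e e0 mA dA A0.
(* Half of the modulus goes to [|u - v|], and a quarter to the rational approximation of each of [u]
   and [v]. *)
exists (n.+1%:R^-1 / 2); first by rewrite divr_gt0// invr_gt0 ltr0n.
exists (A n); split => // x Ax u v u0 uT v0 vT uv.
rewrite leNgt; apply/negP => hdl; apply: Ax.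
have n0 : 0 < n.+1%:R^-1 / 2 :> R by rewrite divr_gt0// invr_gt0 ltr0n.
have cXc : continuous (fun q => X (cl q) x).
  move=> q; apply: (@continuous_comp _ _ _ cl (X ^~ x)); first exact: clc.
  exact: cX.2.
have [q [hq1 hq2]] : exists q : rat, `|u - ratr q| < n.+1%:R^-1 / 4 /\
    dl < `|X (cl (ratr q)) x - X v x|.
  have : \forall q \near u, dl < `|X (cl q) x - X v x|.
    have h : (fun q => `|X (cl q) x - X v x|) @ u --> `|X u x - X v x|.
      rewrite -{2}(clE u u0 uT); apply: cvg_norm; apply: cvgB; last exact: cvg_cst.
      exact: cXc.
    exact: (cvgr_gt _ h _ hdl).
  move=> /nbhs_ballP[r /= r0 hr].
  have : u < u + Num.min r (n.+1%:R^-1 / 4).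
    by rewrite ltrDl lt_min r0 divr_gt0// invr_gt0 ltr0n.
  move=> /rat_in_itvoo[q]; rewrite in_itv/= => /andP[h1 h2]; exists q.
  move: h2; rewrite -ltrBlDl lt_min => /andP[h2 h3].
  by rewrite ltr0_norm ?subr_lt0// opprB; split => //; apply: hr;
    rewrite /ball/= ltr0_norm ?subr_lt0// opprB.
have [q' [hq1' hq2']] : exists q' : rat, `|v - ratr q'| < n.+1%:R^-1 / 4 /\
    dl < `|X (cl (ratr q)) x - X (cl (ratr q')) x|.
  have : \forall q' \near v, dl < `|X (cl (ratr q)) x - X (cl q') x|.
    have h : (fun q' => `|X (cl (ratr q)) x - X (cl q') x|) @ v -->
        `|X (cl (ratr q)) x - X v x|.
      rewrite -{2}(clE v v0 vT); apply: cvg_norm; apply: cvgB; first exact: cvg_cst.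
      exact: cXc.
    exact: (cvgr_gt _ h _ hq2).
  move=> /nbhs_ballP[r /= r0 hr].
  have : v < v + Num.min r (n.+1%:R^-1 / 4).
    by rewrite ltrDl lt_min r0 divr_gt0// invr_gt0 ltr0n.
  move=> /rat_in_itvoo[q']; rewrite in_itv/= => /andP[h1 h2]; exists q'.
  move: h2; rewrite -ltrBlDl lt_min => /andP[h2 h3].
  by rewrite ltr0_norm ?subr_lt0// opprB; split => //; apply: hr;
    rewrite /ball/= ltr0_norm ?subr_lt0// opprB.
exists q => //; exists q' => //; rewrite ifT//.
rewrite (_ : ratr q - ratr q' = (v - ratr q') - (u - ratr q) + (u - v)); last by ring.
apply: le_lt_trans (ler_normD _ _) _.
apply: le_lt_trans (lerD (ler_normB _ _) uv) _.
move: hq1 hq1'; move: (n.+1%:R^-1 : R) => z; lra.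
Qed.

Lemma sup_bounded X T e : cproc F X -> 0 <= T -> 0 < e ->
  exists2 C, 0 < C & exists B, [/\ measurable B, (P B <= e%:E)%E &
    forall x, ~ B x -> forall u, 0 <= u -> u <= T -> `|X u x| <= C].
Proof.
move=> cX T0 e0.
pose A n := [set x | (hit X n.+1%:R x <= T%:E)%E].
have [n Pn] : exists n, (P (A n) <= e%:E)%E.
  apply: decreasing_small => //.
  - by move=> n; apply: (Fset_meas F_usual T0); have [_] := hit_stopping F_usual n.+1%:R cX; apply.
  - by move=> n x /=; apply: le_trans; apply: hit_mono; rewrite ler_nat.
  - move=> x; have [n hn] := hit_infty (cX.2 x) T0.
    by exists n; apply/negP; rewrite -ltNge; exact: hn.
exists n.+1%:R; first by rewrite ltr0n.
exists (A n); split => //.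
  by apply: (Fset_meas F_usual T0); have [_] := hit_stopping F_usual n.+1%:R cX; apply.
move=> x /negP; rewrite -ltNge => hx u u0 uT; apply: lt_hit => //.
by apply: le_lt_trans hx; rewrite lee_fin.
Qed.

End Oscillation.

(** * Dyadic times *)

Section Dyadic.
Context {R : realType}.
Implicit Types (s t u v : R).

Definition dy (k i : nat) : R := i%:R / (2 ^ k)%:R.

Lemma dy_pow_gt0 k : 0 < (2 ^ k)%:R :> R.
Proof. by rewrite ltr0n expn_gt0. Qed.

Lemma dy_ge0 k i : 0 <= dy k i.
Proof. by rewrite divr_ge0. Qed.

Lemma dy_mono k i j : (i <= j)%N -> dy k i <= dy k j.
Proof. by move=> ij; rewrite ler_pM2r ?ler_nat// invr_gt0 dy_pow_gt0. Qed.

Lemma dy0 k : dy k 0 = 0.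
Proof. by rewrite /dy mul0r. Qed.

Lemma dy_nat k n : dy k (n * 2 ^ k)%N = n%:R.
Proof. by rewrite /dy natrM mulfK// gt_eqF// dy_pow_gt0. Qed.

Lemma dy_refine k m i : (k <= m)%N -> dy m (i * 2 ^ (m - k)) = dy k i.
Proof.
move=> km; have E : (2 ^ m = 2 ^ (m - k) * 2 ^ k)%N by rewrite -expnD subnK.
by rewrite /dy E !natrM invfM mulrA mulfK// gt_eqF// dy_pow_gt0.
Qed.

(** Index of the cell of level [k] containing the point [dy m i], for [k <= m]. *)
Definition fdiv k m i := (i %/ 2 ^ (m - k))%N.

Lemma fdiv_le k m i : (k <= m)%N -> dy k (fdiv k m i) <= dy m i.
Proof.
by move=> km; rewrite -(dy_refine _ km); apply: dy_mono; exact: leq_divM.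
Qed.

Lemma fdiv_ge k m i : (k <= m)%N -> dy m i.+1 <= dy k (fdiv k m i).+1.
Proof.
move=> km; rewrite -(dy_refine _ km); apply: dy_mono.
by rewrite ltn_ceil// expn_gt0.
Qed.

Lemma fdiv_lt k m i K : (k <= m)%N -> (i < K * 2 ^ m)%N -> (fdiv k m i < K * 2 ^ k)%N.
Proof.
move=> km h; rewrite /fdiv ltn_divLR ?expn_gt0// -mulnA -expnD.
by rewrite (addnC k) subnK.
Qed.

Lemma dyS k i : dy k i.+1 = dy k i + ((2 ^ k)%:R)^-1.
Proof. by rewrite /dy -natr1 mulrDl mul1r. Qed.

Lemma fdiv_dist k m i : (k <= m)%N ->
  `|dy m i - dy k (fdiv k m i)| <= ((2 ^ k)%:R)^-1.
Proof.
move=> km; have h1 := fdiv_le i km; have h2 := fdiv_ge i km.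
rewrite ger0_norm ?subr_ge0// lerBlDl -dyS; apply: le_trans h2.
exact: dy_mono.
Qed.

Lemma dy_approx t k : 0 <= t -> dy k (Num.truncn (t * (2 ^ k)%:R)) <= t /\
  t - dy k (Num.truncn (t * (2 ^ k)%:R)) <= ((2 ^ k)%:R)^-1.
Proof.
move=> t0; have k0 := dy_pow_gt0 k.
have /truncn_itv/andP[h1 h2] : 0 <= t * (2 ^ k)%:R by rewrite mulr_ge0.
split; first by rewrite /dy ler_pdivrMr.
by rewrite lerBlDl -dyS /dy ler_pdivlMr// ltW.
Qed.

Lemma pow2_small (e : R) : 0 < e -> exists k0, forall k, (k0 <= k)%N -> ((2 ^ k)%:R)^-1 < e.
Proof.
move=> e0; have [k0 h] := heps_small e0; exists k0.+1 => -[//|k]; rewrite ltnS => /h.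
by rewrite /heps mul1r.
Qed.

Lemma dy_approx_cvg t : 0 <= t ->
  (fun k => dy k (Num.truncn (t * (2 ^ k)%:R))) @ \oo --> t.
Proof.
move=> t0; apply/cvgrPdist_lt => e e0; have [k0 h] := pow2_small e0.
exists k0 => // k /= /h; apply: le_lt_trans.
by have [h1 h2] := dy_approx k t0; rewrite ger0_norm ?subr_ge0.
Qed.

Lemma min_incr (f : R -> R) p u v : u <= v ->
  f (Num.min p v) - f (Num.min p u) = f (Num.max u (Num.min p v)) - f u.
Proof.
move=> uv; have [pu|up] := leP p u.
  by rewrite (min_l (le_trans pu uv)) max_l// !subrr.
by rewrite max_r// le_min (ltW up).
Qed.

(** For [u <= v], the projection of [p] on the interval from [u] to [v]. *)
Definition rpt u v p := Num.max u (Num.min p v).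

Lemma rpt_mono u v p q : p <= q -> rpt u v p <= rpt u v q.
Proof.
move=> pq; rewrite /rpt ge_max !le_max lexx/=; apply/orP; right.
by rewrite le_min !ge_min pq lexx orbT.
Qed.

Lemma rpt_ge u v p : u <= rpt u v p.
Proof. by rewrite /rpt le_max lexx. Qed.

Lemma rpt_le u v p : u <= v -> rpt u v p <= v.
Proof. by move=> uv; rewrite /rpt ge_max uv ge_min lexx orbT. Qed.

End Dyadic.

Lemma continuous_bigsum (R : realType) (I : Type) (r : seq I) (f : I -> R -> R) :
  (forall i, continuous (f i)) -> continuous (fun t => \sum_(i <- r) f i t).
Proof.
move=> cf; elim: r => [|i r IH].
  rewrite (_ : (fun _ => _) = cst 0) => [t|]; first exact: cvg_cst.
  by apply/funext => t; rewrite big_nil.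
rewrite (_ : (fun _ => _) = fun t => f i t + \sum_(j <- r) f j t); last first.
  by apply/funext => t; rewrite big_cons.
by move=> t; apply: cvgD; [exact: cf|exact: IH].
Qed.

(** * Convergence of dyadic left-endpoint sums *)

Section DyadicSums.
Context {R : realType} {d : measure_display} {Omega : measurableType d}.
Context (P : probability Omega R) (F : R -> set (set Omega)).
Context (F_usual : usual_filtration P F).
Implicit Types (s t u v T e : R) (X Z : R -> Omega -> R).

(* The level-k left-endpoint sum, with the integrator stopped at time k. *)
Definition dsum X Z k t x : R :=
  \sum_(i < k * 2 ^ k) X (dy k i) x *
    (Z (Num.min (dy k i.+1) t) x - Z (Num.min (dy k i) t) x).

Lemma dsum_incr X Z k u v x : u <= v -> dsum X Z k v x - dsum X Z k u x =
  \sum_(i < k * 2 ^ k) X (dy k i) x *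
    (Z (rpt u v (dy k i.+1)) x - Z (rpt u v (dy k i)) x).
Proof.
move=> uv; rewrite /dsum -sumrB; apply: eq_bigr => i _.
rewrite -mulrBr; congr (_ * _).
have h1 := min_incr (Z ^~ x) (dy k i.+1) uv.
have h2 := min_incr (Z ^~ x) (dy k i) uv.
by move: h1 h2; rewrite /rpt /=; lra.
Qed.

Lemma dsum_cell X Z k l u v x : (l < k * 2 ^ k)%N -> dy k l <= u -> u <= v ->
  v <= dy k l.+1 -> dsum X Z k v x - dsum X Z k u x = X (dy k l) x * (Z v x - Z u x).
Proof.
move=> lk lu uv vl; rewrite dsum_incr// (bigD1 (Ordinal lk))//= big1 ?addr0.
  rewrite /rpt (min_r vl) (min_l (le_trans lu uv)) (max_r uv) (max_l lu)//.
move=> i il; have {}il : (i < l)%N || (l < i)%N by rewrite -neq_ltn.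
case/orP: il => il.
  have h1 : dy k i.+1 <= u by apply: le_trans lu; exact: dy_mono.
  have h2 : dy k i <= u by apply: le_trans h1; exact: dy_mono.
  rewrite /rpt (min_l (le_trans h1 uv)) (min_l (le_trans h2 uv)).
  by rewrite (max_l h1) (max_l h2) subrr mulr0.
have h1 : v <= dy k i by apply: le_trans vl _; exact: dy_mono.
have h2 : v <= dy k i.+1 by apply: le_trans h1 _; exact: dy_mono.
by rewrite /rpt (min_r h1) (min_r h2) subrr mulr0.
Qed.

Lemma dsum_le0 X Z k t x : t <= 0 -> dsum X Z k t x = 0.
Proof.
move=> t0; rewrite /dsum big1// => i _.
have h j : t <= dy k j by apply: (le_trans t0); exact: dy_ge0.
by rewrite !min_r// subrr mulr0.
Qed.

(** At points of a finer level the sum of level [k] is an elementary integral over the finer grid,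
    which lets sums of different levels be subtracted term by term. *)
Lemma dsum_refine X Z k m j x : (k <= m)%N -> (j <= k * 2 ^ m)%N ->
  dsum X Z k (dy m j) x =
  \sum_(i < j) X (dy k (fdiv k m i)) x * (Z (dy m i.+1) x - Z (dy m i) x).
Proof.
move=> km; elim: j => [|j IH] jk; first by rewrite dy0 dsum_le0// big_ord0.
rewrite big_ord_recr/= -IH; last exact: ltnW.
rewrite -(@dsum_cell X Z k (fdiv k m j)); first by rewrite addrC subrK.
- exact: fdiv_lt.
- exact: fdiv_le.
- exact: dy_mono.
- exact: fdiv_ge.
Qed.

Lemma dsum_continuous X Z k x : continuous (Z ^~ x) -> continuous (dsum X Z k ^~ x).
Proof.
move=> cZ; apply: continuous_bigsum => i t; apply: cvgMl_tmp.
have cm p : continuous (fun t : R => Z (Num.min p t) x).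
  move=> s; apply: (@continuous_comp _ _ _ (fun t : R => Num.min p t) (Z ^~ x)).
    apply: (@min_fun_continuous _ R R (cst p) id) => r; [exact: cvg_cst|exact: cvg_id].
  exact: cZ.
by apply: cvgB; exact: cm.
Qed.

Lemma dsum_cproc X Z k : cproc F X -> cproc F Z -> cproc F (dsum X Z k).
Proof.
move=> cX cZ; split; last by move=> x; apply: dsum_continuous; exact: cZ.2.
apply/(adaptedP F_usual) => t t0; apply: Fm_sum => i.
(* The time [dy k i] may lie beyond [t], but then the increment of [Z] is 0, so it may be capped at
   [t] to make the term [F t]-measurable. *)
have E x : X (dy k i) x * (Z (Num.min (dy k i.+1) t) x - Z (Num.min (dy k i) t) x) =
    X (Num.min (dy k i) t) x * (Z (Num.min (dy k i.+1) t) x - Z (Num.min (dy k i) t) x).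
  have [h|h] := leP (dy k i) t; first by [].
  have h2 : t <= dy k i.+1 by apply: (le_trans (ltW h)); exact: dy_mono.
  by rewrite (min_r h2) subrr !mulr0.
have m0 p : 0 <= p -> 0 <= Num.min p t by move=> p0; rewrite le_min p0.
have mt p : Num.min p t <= t by rewrite ge_min lexx orbT.
rewrite (funext E); apply: FmM.
  by apply: (Fm_mono F_usual (m0 _ (dy_ge0 _ _)) (mt _)); apply: (cproc_Fm F_usual) => //;
    exact/m0/dy_ge0.
by apply: FmB; apply: (Fm_mono F_usual (m0 _ (dy_ge0 _ _)) (mt _));
  apply: (cproc_Fm F_usual) => //; exact/m0/dy_ge0.
Qed.

(** On the grid of level [m] the difference between levels [a] and [b] is one elementary integral,
    whose integrand is an increment of [X] over a time at most [eta] and hence small off [B0]. The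
    threshold [m0] does not depend on [m]. *)
Lemma dsum_cauchy_grid X Z (K : nat) e ep : cproc F X -> cproc F Z -> good P F Z ->
  0 < e -> 0 < ep -> exists m0, forall a b, (m0 <= a)%N -> (m0 <= b)%N ->
  forall m, (a <= m)%N -> (b <= m)%N -> exists B, [/\ measurable B, (P B <= ep%:E)%E &
    forall x, ~ B x -> forall j, (j <= K * 2 ^ m)%N ->
      `|dsum X Z a (dy m j) x - dsum X Z b (dy m j) x| < e].
Proof.
move=> cX cZ gZ e0 ep0; have ep2 : 0 < ep / 2 by rewrite divr_gt0.
have [C C0 hC] := good_bound F_usual cZ gZ (ler0n R K) ep2.
have dl0 : 0 < e / C by rewrite divr_gt0.
have [eta eta0 [B0 [mB0 PB0 hB0]]] := osc_small F_usual cX (ler0n R K) dl0 ep2.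
have eta2 : 0 < eta / 2 by rewrite divr_gt0.
have [k0 hk0] := pow2_small eta2.
exists (maxn k0 K) => a b; rewrite !geq_max => /andP[k0a Ka] /andP[k0b Kb] m am bm.
pose p i : R := Num.min (dy m i) K%:R.
have pE i : (i <= K * 2 ^ m)%N -> p i = dy m i.
  by move=> iK; rewrite /p min_l// -(dy_nat m K); exact: dy_mono.
pose h i x := if (i < K * 2 ^ m)%N then
  X (dy a (fdiv a m i)) x - X (dy b (fdiv b m i)) x else 0.
have gp : grid K%:R p.
  split => i; rewrite /p ?le_min ?ge_min ?dy_ge0//= ?lexx ?orbT//.
  by rewrite dy_mono.
have mh i : Fm F (p i) (h i).
  have [iK|iK] := boolP (i < K * 2 ^ m)%N; last first.
    rewrite (_ : h i = cst 0); first exact: Fm_cst.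
    by apply/funext => x; rewrite /h (negbTE iK).
  rewrite (_ : h i = fun x => X (dy a (fdiv a m i)) x - X (dy b (fdiv b m i)) x);
    last by apply/funext => x; rewrite /h iK.
  rewrite pE ?(ltnW iK)//; apply: FmB.
    apply: (Fm_mono F_usual (dy_ge0 _ _) (fdiv_le i am)).
    by apply: (cproc_Fm F_usual cX); exact: dy_ge0.
  apply: (Fm_mono F_usual (dy_ge0 _ _) (fdiv_le i bm)).
  by apply: (cproc_Fm F_usual cX); exact: dy_ge0.
have hb x : ~ B0 x -> forall i, (i < K * 2 ^ m)%N -> `|h i x| <= e / C.
  move=> Bx i iK; rewrite /h iK.
  have hle c : (c <= m)%N -> dy c (fdiv c m i) <= K%:R.
    move=> cm; apply: le_trans (fdiv_le i cm) _; rewrite -(dy_nat m K).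
    by apply: dy_mono; exact: ltnW.
  apply: hB0 => //; [exact: dy_ge0|exact: hle|exact: dy_ge0|exact: hle|].
  rewrite (_ : dy a _ - _ = (dy m i - dy b (fdiv b m i)) - (dy m i - dy a (fdiv a m i)));
    last by ring.
  apply: le_trans (ler_normB _ _) _; rewrite [eta]splitr; apply: lerD.
    by apply: le_trans (fdiv_dist i bm) _; apply: ltW; exact: hk0.
  by apply: le_trans (fdiv_dist i am) _; apply: ltW; exact: hk0.
have [B' [mB' PB' hB']] := hC _ dl0 (K * 2 ^ m)%N p h B0 gp mh hb.
exists (B0 `|` B'); split.
- exact: measurableU.
- by rewrite [ep]splitr; apply: (@prob_le2 _ _ _ P B0 B') => //; exact: measurableU.
move=> x Hx j jK.
have [Bx B'x] : ~ B0 x /\ ~ B' x by split=> h0; apply: Hx; [left|right].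
have := hB' x Bx B'x j jK; rewrite [C * _]mulrC divfK ?gt_eqF//; apply: le_lt_trans.
rewrite !dsum_refine//; [|by apply: leq_trans jK _; rewrite leq_mul2r Kb orbT|
  by apply: leq_trans jK _; rewrite leq_mul2r Ka orbT].
rewrite le_eqVlt; apply/orP; left; apply/eqP; congr (`| _ |).
rewrite -sumrB; apply: eq_bigr => i _.
have iK : (i < K * 2 ^ m)%N by apply: leq_trans (ltn_ord i) jK.
by rewrite /h iK !pE ?(ltnW iK)// mulrBl.
Qed.

Lemma increasing_prob (E : nat -> set Omega) e : (forall n, measurable (E n)) ->
  (forall n, E n `<=` E n.+1) -> (forall n, (P (E n) <= e%:E)%E) ->
  (P (\bigcup_n E n) <= e%:E)%E.
Proof.
move=> mE sE PE.
have h : P \o E @ \oo --> P (\bigcup_n E n).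
  apply: nondecreasing_cvg_mu => //; first exact: bigcupT_measurable.
  by apply/nondecreasing_seqP => n; apply/subsetPset; exact: sE.
rewrite -(cvg_lim _ h)//; apply: lime_le; first exact: cvgP h.
exact: nearW.
Qed.

(** The events where the bound fails on the grid [m] increase with [m], while their probabilities
    have a common bound; so their union is rare too. Off it the bound holds at all dyadic times, and
    at all times by continuity. *)
Lemma dsum_cauchy X Z (K : nat) e ep : cproc F X -> cproc F Z -> good P F Z ->
  0 < e -> 0 < ep -> exists m0, forall a b, (m0 <= a)%N -> (m0 <= b)%N ->
  exists B, [/\ measurable B, (P B <= ep%:E)%E &
    forall x, ~ B x -> forall t, 0 <= t -> t <= K%:R ->
      `|dsum X Z a t x - dsum X Z b t x| <= e].
Proof.
move=> cX cZ gZ e0 ep0.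
have [m0 hm0] := dsum_cauchy_grid K cX cZ gZ e0 ep0.
exists m0 => a b ha hb.
pose D t x := dsum X Z a t x - dsum X Z b t x.
have cD : cproc F D by apply: (cprocB F_usual); exact: dsum_cproc.
pose m1 := maxn a b.
pose E n := \bigcup_(j in [set j | (j <= K * 2 ^ (m1 + n))%N])
  [set x | (e <= `|D (dy (m1 + n) j) x|)%R].
have mE n : measurable (E n).
  apply: bigcup_measurable => j _; apply: meas_ge.
  by apply: (cproc_meas F_usual cD); exact: dy_ge0.
have sE n : E n `<=` E n.+1.
  move=> x [j /= jK hj]; exists (j * 2)%N => /=.
    by rewrite addnS expnS [(2 * _)%N]mulnC mulnA leq_mul2r jK orbT.
  have := @dy_refine R (m1 + n) (m1 + n.+1) j; rewrite addnS leqnSn => /(_ isT).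
  by rewrite subSnn expn1 => ->.
have PE n : (P (E n) <= ep%:E)%E.
  have am : (a <= m1 + n)%N by rewrite (leq_trans _ (leq_addr _ _))// leq_maxl.
  have bm : (b <= m1 + n)%N by rewrite (leq_trans _ (leq_addr _ _))// leq_maxr.
  have [B [mB PB hB]] := hm0 a b ha hb _ am bm.
  apply: le_trans PB; apply: prob_mono => // x [j /= jK hj].
  by apply: contrapT => /hB/(_ j jK); rewrite ltNge hj.
exists (\bigcup_n E n); split.
- exact: bigcupT_measurable.
- exact: increasing_prob.
move=> x Ex t t0 tK.
have cDx : continuous (fun t => `|D t x|) by move=> s; apply: cvg_norm; exact: cD.2.
have h : (fun k => `|D (dy k (Num.truncn (t * (2 ^ k)%:R))) x|) @ \oo --> `|D t x|.
  apply: (@continuous_cvg _ _ _ _ _ _ (fun t => `|D t x|)); first exact: cDx.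
  exact: dy_approx_cvg.
rewrite -(cvg_lim _ h)//; apply: limr_le; first exact: cvgP h.
exists m1 => // k /= m1k; rewrite leNgt; apply/negP => hlt; apply: Ex.
exists (k - m1)%N => //; exists (Num.truncn (t * (2 ^ k)%:R)) => /=; rewrite subnKC//;
  last exact: ltW.
rewrite -(@ler_nat R) natrM; apply: (@le_trans _ _ (t * (2 ^ k)%:R)).
  by rewrite truncn_le mulr_ge0.
by rewrite ler_wpM2r.
Qed.

(** [phi] is a rate rather than one subsequence: every [lam] above it works, so that two integrators
    can share the same levels. *)
Lemma ito_limit X Z : cproc F X -> cproc F Z -> good P F Z ->
  exists phi : nat -> nat, forall lam : nat -> nat, (forall k, (phi k <= lam k)%N) ->
  exists2 J, cproc F J & {ae P, forall x t,
    (fun k => dsum X Z (lam k) t x) @ \oo --> J t x}.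
Proof.
move=> cX cZ gZ.
have [m0 hm0] := choice (fun k => dsum_cauchy k cX cZ gZ (heps_gt0 k) (heps_gt0 k)).
pose phi k := \max_(i < k.+1) m0 i.
have phiS k : (phi k <= phi k.+1)%N by rewrite /phi [leqRHS]big_ord_recr leq_maxl.
have phim k : (m0 k <= phi k)%N by rewrite /phi big_ord_recr leq_maxr.
exists phi => lam hlam.
have hB k := hm0 k (lam k.+1) (lam k) (leq_trans (phim k) (leq_trans (phiS k) (hlam k.+1)))
   (leq_trans (phim k) (hlam k)).
have [B hBk] := choice hB.
have mB k : measurable (B k) by have [] := hBk k.
have sumB : (\sum_(0 <= n <oo) P (B n) < +oo)%E.
  apply: (@le_lt_trans _ _ 1%:E); last exact: ltry.
  apply: le_trans (@epsilon_trick0 R 1 xpredT ler01).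
  by apply: lee_nneseries => k _ //; have [] := hBk k.
(* Borel-Cantelli: almost every outcome lies in finitely many of the [B k], so its dyadic sums
   converge locally uniformly. *)
have PN0 := lim_sup_set_cvg0 mB sumB.
pose G := [set x | exists2 g : R -> R, continuous g &
  forall t, (fun k => dsum X Z (lam k) t x) @ \oo --> g t].
have aeG : {ae P, forall x, G x}.
  exists (lim_sup_set B); split => //.
    apply: bigcap_measurable => [|n _]; first by exists 0%N.
    exact: bigcup_measurable.
  move=> x /= hx; apply: contrapT => hn; apply: hx.
  have {}hn : exists n0, forall k, (n0 <= k)%N -> ~ B k x.
    apply: contrapT => hn'; apply: hn => n _ /=; apply: contrapT => hb; apply: hn'.
    by exists n => k nk Bx; apply: hb; exists k.
  apply: (@locally_uniform_limit R (fun k t => dsum X Z (lam k) t x)).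
  - by move=> k; apply: dsum_continuous; exact: cZ.2.
  - by move=> k t t0; exact: dsum_le0.
  - have [n0 hn0] := hn; exists n0 => k n0k t t0 tk.
    by have [_ _] := hBk k; apply => //; exact: hn0.
pose J t x := if x \in G then lim ((fun k => dsum X Z (lam k) t x) @ \oo) else 0.
have JE x : G x -> forall t, (fun k => dsum X Z (lam k) t x) @ \oo --> J t x.
  move=> Gx t; rewrite /J mem_set//; have [g _ hg] := Gx.
  by apply/cvg_ex; exists (g t); exact: hg.
exists J; last by move: aeG; apply: filterS => x; exact: JE.
split.
  apply/(adaptedP F_usual) => t t0.
  apply: (@Fm_cvg _ _ _ _ _ (fun k x => if x \in G then dsum X Z (lam k) t x else 0)).
    move=> k; have : Fm F t (dsum X Z (lam k) t).
      exact: (cproc_Fm F_usual (dsum_cproc _ cX cZ)).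
    move=> /(Fm_ae F_usual t0); apply.
    by move: aeG; apply: filterS => x Gx; rewrite mem_set.
  move=> x; have [xG|xG] := boolP (x \in G).
    by apply: JE; exact: set_mem.
  by rewrite /J (negbTE xG); exact: cvg_cst.
move=> x; have [xG|xG] := boolP (x \in G).
  have [g cg hg] := set_mem xG.
  rewrite (_ : J ^~ x = g)//; apply/funext => t.
  by rewrite /J xG; apply: cvg_lim => //; exact: hg.
by rewrite (_ : J ^~ x = cst 0) => [t|]; [exact: cvg_cst|
  apply/funext => t; rewrite /J (negbTE xG)].
Qed.

End DyadicSums.

(** * Stochastic integrals as limits of dyadic sums, and convex functions of semimartingales *)

Section ItoIntegral.
Context {R : realType} {d : measure_display} {Omega : measurableType d}.
Context (P : probability Omega R) (F : R -> set (set Omega)).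
Context (F_usual : usual_filtration P F).
Implicit Types (s t u v T e : R) (X Z N M J : R -> Omega -> R).

Lemma stp_rpt s t p (u : \bar R) : (0 <= u)%E ->
  stp (rpt s t p) u = rpt (stp s u) (stp t u) p.
Proof.
move=> /stpP[[r [_ _ h]]|[_ h]]; rewrite !h// /rpt.
by rewrite min_maxl minA.
Qed.

(** Stopping when [|X| + |N - N 0|] exceeds [n] bounds integrand and integrator, so the increments
    of the sums have a second moment bounded independently of the level. They are therefore
    uniformly integrable, and orthogonality to [F s] passes to the limit. *)
Lemma ito_loc_mart X N J lam : cproc F X -> cproc F N -> cproc F J ->
  cont_local_martingale P F N ->
  {ae P, forall x t, (fun k => dsum X N (lam k) t x) @ \oo --> J t x} ->
  cont_local_martingale P F J.
Proof.
move=> cX cN cJ hN hJ.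
pose Y t x := `|X t x| + `|N t x - N 0 x|.
have cY : cproc F Y.
  apply: (cprocD F_usual); apply: (cproc_norm F_usual) => //.
  by apply: (cprocB F_usual) => //; exact: (cproc_init F_usual).
have YN t x : 0 <= t -> `|N t x - N 0 x| <= `|Y t x|.
  by move=> _; rewrite [leRHS]ger0_norm ?addr_ge0// lerDr.
have YX t x : 0 <= t -> `|X t x| <= `|Y t x|.
  by move=> _; rewrite [leRHS]ger0_norm ?addr_ge0// lerDl.
apply: (loc_mart_intro F_usual cJ cY) => n.
pose sg := hit Y n%:R.
have hs : stopping_time F sg := hit_stopping F_usual n%:R cY.
have sg0 x : (0 <= sg x)%E by exact: hit_ge0.
have cJS := stopped_cproc F_usual cJ hs.
have [mL bL] := loc_mart_bounded F_usual hN cN cY YN (ler0n _ n).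
pose L t x := stopped N sg t x - N 0 x.
have cL : cproc F L.
  apply: (cprocB F_usual); last exact: (cproc_init F_usual).
  exact: (stopped_cproc F_usual cN hs).
have key s t : 0 <= s -> s <= t ->
    itg P (fun x => stopped J sg t x - stopped J sg s x) /\
    forall A, F s A -> Ex P (fun x => (stopped J sg t x - stopped J sg s x) * \1_A x) = 0.
  move=> s0 st; have t0 : 0 <= t by exact: le_trans st.
  pose p k i := rpt s t (dy k i : R).
  (* The first factor drops the steps after the stopping time. The second drops those starting at or
     after [t], whose projected point is [t], a time at which [X (dy k i)] need not be
     measurable. *)
  pose w k i x : R := ((dy k i)%:E < sg x)%E%:R * (dy k i < t)%R%:R.
  pose h k i x := n.+1%:R^-1 * (X (dy k i) x * w k i x).
  pose f k x := n.+1%:R * gsum (p k) (h k) L (k * 2 ^ k) x.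
  have ps k i : s <= p k i by exact: rpt_ge.
  have p0 k i : 0 <= p k i by exact: le_trans (ps k i).
  have gp k : grid t (p k).
    by split=> // i; [exact: rpt_le|apply: rpt_mono; exact: dy_mono].
  have mh k i : Fm F (p k i) (h k i).
    apply: FmZ; rewrite /w; have [dt|dt] := ltP (dy k i) t; last first.
      rewrite (_ : (fun _ => _) = cst 0); first exact: Fm_cst.
      by apply/funext => x; rewrite /= !mulr0.
    have dp : dy k i <= p k i by rewrite /p /rpt (min_l (ltW dt)) le_max lexx orbT.
    apply: (Fm_mono F_usual (dy_ge0 _ _) dp); apply: FmM.
      by apply: (cproc_Fm F_usual cX); exact: dy_ge0.
    rewrite (_ : (fun _ => _) = fun x => 1 * \1_[set x | ((dy k i)%:E < sg x)%E] x).
      apply: FmZ; apply: (Fm_indic F_usual (dy_ge0 _ _)).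
      exact: (stopping_time_lt F_usual (dy_ge0 _ _)).
    by apply/funext => x; rewrite stop_weightE /= mulrC.
  have n1 : 0 < n.+1%:R :> R by rewrite ltr0n.
  have h1 k i x : `|h k i x| <= 1.
    rewrite /h normrM ger0_norm ?invr_ge0// mulrC ler_pdivrMr// mul1r /w.
    have [hi|hi] := ltP (dy k i)%:E (sg x); last by rewrite /= mul0r mulr0 normr0.
    rewrite /= mul1r normrM (@le_trans _ _ n%:R)// ?ler_nat//.
    rewrite -[leRHS]mulr1 ler_pM//; last by case: (_ < _); rewrite ?normr1 ?normr0.
    apply: le_trans (YX _ _ (dy_ge0 _ _)) _; apply: lt_hit hi; exact: dy_ge0.
  (* Stopping commutes with projection on an interval, so evaluating the dyadic sum at stopped times
     amounts to integrating against the stopped process; the dropped steps have zero increment. *)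
  have fE k x : f k x = dsum X N k (stp t (sg x)) x - dsum X N k (stp s (sg x)) x.
    rewrite dsum_incr ?stp_mono// /f /gsum mulr_sumr; apply: eq_bigr => i _.
    rewrite /h mulrA mulrA mulfV ?gt_eqF// mul1r -mulrA; congr (_ * _).
    have -> : L (p k i.+1) x - L (p k i) x =
        N (rpt (stp s (sg x)) (stp t (sg x)) (dy k i.+1)) x -
        N (rpt (stp s (sg x)) (stp t (sg x)) (dy k i)) x.
      by rewrite -!stp_rpt// /L /stopped -!/(stp _ _) /p; ring.
    rewrite /w.
    have triv : stp t (sg x) <= dy k i ->
        N (rpt (stp s (sg x)) (stp t (sg x)) (dy k i.+1)) x -
        N (rpt (stp s (sg x)) (stp t (sg x)) (dy k i)) x = 0.
      move=> h2; have h3 : stp t (sg x) <= dy k i.+1.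
        by apply: (le_trans h2); exact: dy_mono.
      by rewrite /rpt (min_r h2) (min_r h3) subrr.
    have [hi|hi] := ltP (dy k i)%:E (sg x); last first.
      rewrite triv ?mulr0//; have [[r [_ E ->]]|[E _]] := stpP (sg0 x).
        by move: hi; rewrite E lee_fin ge_min => ->; rewrite orbT.
      by move: hi; rewrite E leye_eq.
    have [dt|dt] := ltP (dy k i) t; first by rewrite /= !mul1r.
    by rewrite triv ?mulr0//; apply: le_trans (stp_le _ (sg0 x)) dt.
  have mG k := gsum_meas F_usual (k * 2 ^ k)%N (gp k) cL (mh k).
  have L2 k := bounded_mart_L2 F_usual (k * 2 ^ k)%N mL cL (ler0n _ n) bL (gp k) (mh k) (h1 k).
  have mf k : measurable_fun setT (f k) by exact: measurable_funM.
  have If2 k : itg P (fun x => f k x ^+ 2).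
    rewrite (_ : (fun _ => _) = fun x => n.+1%:R ^+ 2 * gsum (p k) (h k) L (k * 2 ^ k) x ^+ 2).
      by apply: itgZ; have [] := L2 k.
    by apply/funext => x; rewrite /f exprMn.
  have Ef2 k : Ex P (fun x => f k x ^+ 2) <= n.+1%:R ^+ 2 * n%:R ^+ 2.
    rewrite (_ : (fun _ => _) = fun x => n.+1%:R ^+ 2 * gsum (p k) (h k) L (k * 2 ^ k) x ^+ 2).
      rewrite ExZ; last by have [] := L2 k.
      by rewrite ler_wpM2l ?sqr_ge0//; have [] := L2 k.
    by apply/funext => x; rewrite /f exprMn.
  have If k : itg P (f k).
    apply: (@itg_le _ _ _ _ _ (fun x => 1 + f k x ^+ 2)) => //.
      by apply: itgD => //; exact: itg_cst.
    move=> x; rewrite [leRHS]ger0_norm ?addr_ge0 ?sqr_ge0//.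
    rewrite -(real_normK (num_real (f k x))); have := sqr_ge0 (`|f k x| - 1).
    by have := normr_ge0 (f k x); nra.
  have [||||I E0] := @UI_limit _ _ _ P (fun k => f (lam k))
     (fun x => stopped J sg t x - stopped J sg s x).
  - by move=> k; exact: If.
  - by apply: measurable_funB; apply: (cproc_meas F_usual cJS).
  - move: hJ; apply: filterS => x hx; rewrite (_ : (fun k => _) = fun k =>
      dsum X N (lam k) (stp t (sg x)) x - dsum X N (lam k) (stp s (sg x)) x).
      by apply: cvgB; exact: hx.
    by apply/funext => k; rewrite fE.
  - move=> e e0; pose C : R := n.+1%:R ^+ 2 * n%:R ^+ 2 / e + 1.
    have C0 : 0 < C by rewrite ltr_wpDl// divr_ge0 ?(ltW e0)// mulr_ge0// sqr_ge0.
    exists C; first exact: ltW.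
    move=> k; apply: (@le_trans _ _ (C^-1 * Ex P (fun x => f (lam k) x ^+ 2))).
      rewrite -ExZ//; apply: Ex_le; [exact: itg_clip_rest (ltW C0) _|exact: itgZ|] => x.
      exact: clip_rest_sqr.
    rewrite mulrC ler_pdivrMr//; apply: le_trans (Ef2 _) _.
    by rewrite /C mulrDr mulr1 [e * _]mulrC divfK ?gt_eqF// lerDl ltW.
  split=> // A FA; apply: E0.
  - by apply: measurable_indic; exact: (Fset_meas F_usual s0).
  - by move=> x; rewrite indicE; case: (_ \in _); rewrite ?normr1 ?normr0.
  move=> k; set l := lam k.
  have mA := Fset_meas F_usual s0 FA.
  rewrite (_ : (fun _ => _) = fun x => n.+1%:R * \sum_(i < l * 2 ^ l)
    (L (p l i.+1) x - L (p l i) x) * (h l i x * \1_A x)); last first.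
    apply/funext => x; rewrite /f -mulrA /gsum mulr_suml; congr (_ * _).
    by apply: eq_bigr => i _; ring.
  have pS i : p l i <= p l i.+1 by have [_ _] := gp l; apply.
  have o i : Fm F (p l i) (fun x => h l i x * \1_A x) /\
      forall x, `|h l i x * \1_A x| <= 1.
    split.
      apply: FmM; first exact: mh.
      by apply: (Fm_indic F_usual) => //; exact: (Fset_mono F_usual s0 (ps l i)).
    move=> x; rewrite normrM -[leRHS]mulr1 ler_pM// indicE.
    by case: (_ \in _); rewrite ?normr1 ?normr0.
  have Io i : itg P (fun x => (L (p l i.+1) x - L (p l i) x) * (h l i x * \1_A x)).
    have [m1 m2] := o i; apply: (@itgM _ _ _ _ 1) => //.
      by apply: itgB; exact: (martingale_itg mL).
    exact: (Fm_meas F_usual (p0 l i) m1).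
  rewrite ExZ; last exact: itg_sum.
  rewrite Ex_sum// big1 ?mulr0// => i _; have [m1 m2] := o i.
  exact: (mart_orth F_usual mL (p0 l i) (pS i) m1 m2).
have s00 x : stopped J sg 0 x = J 0 x.
  rewrite /stopped -/(stp 0 (sg x)) (_ : stp 0 (sg x) = 0)//.
  by apply: le_anti; rewrite stp_le//= stp_ge0.
apply/(martingaleP F_usual); split.
- apply/(adaptedP F_usual) => t t0; apply: FmB.
    exact: (cproc_Fm F_usual cJS).
  by apply: (Fm_mono F_usual (lexx 0) t0); exact: (cproc_Fm F_usual cJ).
- move=> t t0; have [I _] := key 0 t (lexx 0) t0.
  by move: I; congr (itg P _); apply/funext => x; rewrite s00.
- move=> s t A s0 st FA; have [_ /(_ A FA) <-] := key s t s0 st.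
  by congr Ex; apply/funext => x; rewrite -/sg; ring.
Qed.

Lemma dsum_bv X (A : R -> Omega -> R) k t x C (T : R -> R) u v :
  (forall s, 0 <= s -> s <= t -> `|X s x| <= C) -> 0 <= C ->
  (forall u v, 0 <= u -> u <= v -> `|A v x - A u x| <= T v - T u) ->
  0 <= u -> u <= v -> v <= t ->
  `|dsum X A k v x - dsum X A k u x| <= C * T v - C * T u.
Proof.
move=> XC C0 hT u0 uv vt; rewrite dsum_incr//.
have Tm a b : 0 <= a -> a <= b -> T a <= T b.
  by move=> a0 ab; rewrite -subr_ge0 (le_trans _ (hT a b a0 ab)).
have r0 p : 0 <= rpt u v p by apply: le_trans (rpt_ge _ _ _).
have rS i : rpt u v (dy k i) <= rpt u v (dy k i.+1) by apply: rpt_mono; exact: dy_mono.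
apply: (@le_trans _ _ (\sum_(i < k * 2 ^ k)
   (C * T (rpt u v (dy k i.+1)) - C * T (rpt u v (dy k i))))).
  apply: (le_trans (ler_norm_sum _ _ _)); apply: ler_sum => i _.
  rewrite normrM -mulrBr.
  have [dt|dt] := leP (dy k i) t.
    by apply: ler_pM => //; [apply: XC => //; exact: dy_ge0|exact: hT].
  have h1 : v <= dy k i by apply: (le_trans vt); exact: ltW.
  have h2 : v <= dy k i.+1 by apply: (le_trans h1); exact: dy_mono.
  by rewrite /rpt (min_r h1) (min_r h2) !subrr normr0 !mulr0.
have := telescope_sumr (fun i => C * T (rpt u v (dy k i))) (leq0n (k * 2 ^ k)).
rewrite big_mkord => ->.
rewrite lerB// ler_wpM2l//; apply: Tm => //; first exact: rpt_le.
exact: rpt_ge.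
Qed.

(** The bounding function depends on [t], because the bound [C] on [X] holds on [[0, t]] only; this
    is why [bv_intro] is stated on a bounded interval. *)
Lemma ito_fv X (A : R -> Omega -> R) J lam x : continuous (X ^~ x) -> @bvpath R (A ^~ x) ->
  (forall t, (fun k => dsum X A (lam k) t x) @ \oo --> J t x) ->
  forall t, 0 <= t -> exists T : R -> R, forall u v, 0 <= u -> u <= v -> v <= t ->
    `|J v x - J u x| <= T v - T u.
Proof.
move=> cX [T hT] hJ t t0; have [C hC] := cont_bounded cX t0.
have C0 : 0 <= C by exact: le_trans (hC 0 (lexx 0) t0).
exists (fun s => C * T s) => u v u0 uv vt.
have h : (fun k => `|dsum X A (lam k) v x - dsum X A (lam k) u x|) @ \oo -->
    `|J v x - J u x| by apply: cvg_norm; apply: cvgB; exact: hJ.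
rewrite -(cvg_lim _ h)//; apply: limr_le; first exact: cvgP h.
by apply: nearW => k; exact: (dsum_bv (lam k) hC C0 hT u0 uv vt).
Qed.

Lemma dyadic_monotone (Q : R -> R) : continuous Q ->
  (forall m i, Q (dy m i) <= Q (dy m i.+1)) -> forall u v, 0 <= u -> u <= v -> Q u <= Q v.
Proof.
move=> cQ hQ u v u0 uv; have v0 : 0 <= v by exact: le_trans uv.
have mono m i j : (i <= j)%N -> Q (dy m i) <= Q (dy m j).
  move=> ij; rewrite -(subnKC ij); elim: (j - i)%N => [|k IH]; first by rewrite addn0.
  by rewrite addnS; apply: le_trans IH (hQ _ _).
have cvQ t : 0 <= t -> (fun k => Q (dy k (Num.truncn (t * (2 ^ k)%:R)))) @ \oo --> Q t.
  move=> t0; apply: (@continuous_cvg _ _ _ _ _ _ Q); first exact: cQ.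
  exact: dy_approx_cvg.
have hu := cvQ u u0; have hv := cvQ v v0.
rewrite -(cvg_lim _ hu)// -(cvg_lim _ hv)//.
apply: ler_lim; [exact: cvgP hu|exact: cvgP hv|].
by apply: nearW => k; apply: mono; apply: le_truncn; rewrite ler_wpM2r.
Qed.

(* [f X - \int g(X) dX] is a limit of sums of the nonnegative terms
   [f y - f x - g x * (y - x)], hence increasing. *)
Lemma semimart_convex_csm (f g : R -> R) X : continuous f -> continuous g ->
  (forall y z, 0 <= f z - f y - g y * (z - y)) -> csm P F X ->
  cont_semimartingale P F (fun t x => f (X t x)).
Proof.
move=> cf cg fg [cX [M [A [cM hM cA bA XE]]]].
pose H t x := g (X t x).
have cH : cproc F H by exact: (cproc_comp F_usual).
have cfX : cproc F (fun t x => f (X t x)) by exact: (cproc_comp F_usual).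
have [ph1 h1] := ito_limit F_usual cH cM (good_loc_mart F_usual cM hM).
have [ph2 h2] := ito_limit F_usual cH cA (good_fv F_usual cA bA).
(* Above both rates, so that the integrals against [M] and [A] are limits along the same levels; the
   summand [k] makes the levels tend to infinity. *)
pose lam k := (ph1 k + ph2 k + k)%N.
have [|J1 cJ1 hJ1] := h1 lam.
  by move=> k; rewrite /lam -addnA leq_addr.
have [|J2 cJ2 hJ2] := h2 lam.
  by move=> k; rewrite /lam addnAC leq_addl.
have hMJ := ito_loc_mart cH cM cJ1 hM hJ1.
have cB : cproc F (fun t x => f (X t x) - J1 t x) by exact: (cprocB F_usual).
exists J1, (fun t x => f (X t x) - J1 t x); split => //.
- split; first by have [] := cB.
    by apply: aeW => x; apply: continuous_subspaceT; exact: cB.2.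
  move: hJ1 hJ2; apply: filterS2 => x k1 k2 t t0.
  have [T hT] := @ito_fv H A J2 lam x (cH.2 x) (bA x) k2 t t0.
  (* The candidate for the finite variation part is [J2 + Q], with [J2] of bounded variation on
     [[0, t]] and [Q] nondecreasing. *)
  pose Q t := f (X t x) - J1 t x - J2 t x.
  have cQ : continuous Q.
    by move=> s; apply: cvgB; [exact: cB.2|exact: cJ2.2].
  have Qm : forall u v, 0 <= u -> u <= v -> Q u <= Q v.
    apply: dyadic_monotone => // m i.
    have q s : (fun k => f (X s x) - dsum H M (lam k) s x - dsum H A (lam k) s x) @ \oo --> Q s.
      by apply: cvgB; [apply: cvgB; [exact: cvg_cst|exact: k1]|exact: k2].
    have qu := q (dy m i); have qv := q (dy m i.+1).
    rewrite -(cvg_lim _ qu)// -(cvg_lim _ qv)//.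
    apply: ler_lim; [exact: cvgP qu|exact: cvgP qv|].
    exists (m + i.+1)%N => // k /= mk.
    have mik : (m + i.+1 <= lam k)%N by rewrite (leq_trans mk)// /lam leq_addl.
    move: (lam k) mik => l mik.
    have ml : (m <= l)%N by rewrite (leq_trans _ mik)// leq_addr.
    have il : (i.+1 <= l)%N by rewrite (leq_trans _ mik)// leq_addl.
    pose D s := f (X s x) - dsum H M l s x - dsum H A l s x.
    (* Over one cell the increment of [D] is exactly [f z - f y - g y * (z - y)] between the values
       of [X] at the two ends. *)
    have step j : (j < l * 2 ^ l)%N -> D (dy l j) <= D (dy l j.+1).
      move=> jl; rewrite -subr_ge0.
      have e1 := @dsum_cell _ _ _ H M l j (dy l j) (dy l j.+1) x jl (lexx _)
        (dy_mono _ (leqnSn j)) (lexx _).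
      have e2 := @dsum_cell _ _ _ H A l j (dy l j) (dy l j.+1) x jl (lexx _)
        (dy_mono _ (leqnSn j)) (lexx _).
      have := fg (X (dy l j) x) (X (dy l j.+1) x).
      have -> : X (dy l j.+1) x - X (dy l j) x =
          (M (dy l j.+1) x - M (dy l j) x) + (A (dy l j.+1) x - A (dy l j) x).
        by rewrite !XE ?dy_ge0//; ring.
      by rewrite mulrDr -[g _]/(H (dy l j) x) -e1 -e2 /D; lra.
    have monoD a b : (a <= b)%N -> (b <= l * 2 ^ l)%N -> D (dy l a) <= D (dy l b).
      move=> ab; rewrite -(subnKC ab); elim: (b - a)%N => [|c IH] hc; first by rewrite addn0.
      rewrite addnS in hc *; apply: le_trans (IH (ltnW hc)) (step _ hc).
    rewrite -(dy_refine i ml) -(dy_refine i.+1 ml); apply: monoD.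
      by rewrite leq_mul2r leqnSn orbT.
    apply: leq_mul => //; apply: leq_pexp2l => //; exact: leq_subr.
  apply: (@bv_intro _ _ (fun s => T s + Q s)) => // u v u0 uv vt.
  rewrite (_ : _ - _ = (J2 v x - J2 u x) + (Q v - Q u)); last by rewrite /Q; ring.
  apply: le_trans (ler_normD _ _) _; rewrite (ger0_norm (_ : 0 <= Q v - Q u)).
    by have := hT u v u0 uv vt; lra.
  by rewrite subr_ge0 Qm.
- by have [] := cfX.
- by apply: aeW => x t _; ring.
Qed.

End ItoIntegral.

(** * Stability of semimartingales under algebraic operations *)

Section SemimartingaleAlgebra.
Context {R : realType} {d : measure_display} {Omega : measurableType d}.
Context (P : probability Omega R) (F : R -> set (set Omega)).
Context (F_usual : usual_filtration P F).
Implicit Types (s t u v e : R) (X Y : R -> Omega -> R).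

Local Notation semi := (cont_semimartingale P F).

Lemma semimart_adapted X : semi X -> adapted F X.
Proof. by move=> [M [A []]]. Qed.

Lemma semimart_Fm X t : semi X -> 0 <= t -> Fm F t (X t).
Proof. by move=> /semimart_adapted /(adaptedP F_usual); exact. Qed.

Lemma semimart_ae X Y : semi X -> adapted F Y ->
  {ae P, forall x t, 0 <= t -> X t x = Y t x} -> semi Y.
Proof.
move=> /(semimartingale_csm F_usual)[X' cX XX] aY XY.
apply: (csm_semimartingale cX aY).
by move: XX XY; apply: filterS2 => x h1 h2 t t0; rewrite h1// h2.
Qed.

Lemma semimartD X Y : semi X -> semi Y -> semi (fun t x => X t x + Y t x).
Proof.
move=> hX hY.
have [X' cX XX] := semimartingale_csm F_usual hX.
have [Y' cY YY] := semimartingale_csm F_usual hY.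
apply: (csm_semimartingale (csmD F_usual cX cY)).
  by apply/(adaptedP F_usual) => t t0; apply: FmD; exact: semimart_Fm.
by move: XX YY; apply: filterS2 => x h1 h2 t t0; rewrite h1// h2.
Qed.

Lemma semimartZ c X : semi X -> semi (fun t x => c * X t x).
Proof.
move=> hX; have [X' cX XX] := semimartingale_csm F_usual hX.
apply: (csm_semimartingale (csmZ F_usual c cX)).
  by apply/(adaptedP F_usual) => t t0; apply: FmZ; exact: semimart_Fm.
by move: XX; apply: filterS => x h t t0; rewrite h.
Qed.

Lemma semimart_cst c : semi (fun _ _ => c).
Proof.
have cc := cproc_cst F_usual c.
apply: (csm_semimartingale (X' := fun _ _ => c)); last 2 first.
- by have [] := cc.
- exact: aeW.
apply: (csm_fv F_usual cc) => x; exists (fun=> 0) => u v _ _.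
by rewrite !subrr normr0.
Qed.

Lemma semimart_sum (I : Type) (r : seq I) (X : I -> R -> Omega -> R) :
  (forall i, semi (X i)) -> semi (fun t x => \sum_(i <- r) X i t x).
Proof.
move=> hX; elim: r => [|i r IH].
  rewrite (_ : (fun _ _ => _) = fun _ _ => 0); first exact: semimart_cst.
  by apply/funext => t; apply/funext => x; rewrite big_nil.
rewrite (_ : (fun _ _ => _) = fun t x => X i t x + \sum_(j <- r) X j t x).
  exact: semimartD.
by apply/funext => t; apply/funext => x; rewrite big_cons.
Qed.

Lemma semimart_convex (f g : R -> R) X : continuous f -> continuous g ->
  (forall y z, 0 <= f z - f y - g y * (z - y)) -> semi X ->
  semi (fun t x => f (X t x)).
Proof.
move=> cf cg fg hX; have [X' cX XX] := semimartingale_csm F_usual hX.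
apply: (semimart_ae (semimart_convex_csm F_usual cf cg fg cX)).
  by apply/(adaptedP F_usual) => t t0; apply: Fm_comp => //; exact: semimart_Fm.
by move: XX; apply: filterS => x h t t0; rewrite h.
Qed.

Lemma semimart_sqr X : semi X -> semi (fun t x => X t x ^+ 2).
Proof.
apply: (@semimart_convex (fun y => y ^+ 2) (fun y => 2 * y)).
- by move=> y; exact: exprn_continuous.
- by move=> y; apply: cvgMl_tmp; exact: cvg_id.
- move=> y z; rewrite (_ : _ - _ = (z - y) ^+ 2); first exact: sqr_ge0.
  by ring.
Qed.

(** Polarization reduces products to squares, which are convex. *)
Lemma semimartM X Y : semi X -> semi Y -> semi (fun t x => X t x * Y t x).
Proof.
move=> hX hY.
have h1 := semimart_sqr (semimartD hX hY).
have h2 := semimart_sqr (semimartD hX (semimartZ (-1) hY)).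
have := semimartZ 4^-1 (semimartD h1 (semimartZ (-1) h2)).
congr (cont_semimartingale P F); apply/funext => t; apply/funext => x.
by field.
Qed.

(* The convex extension of [y |-> (1 + y) ^ (-1/2)] to the real line. *)
Definition rsqrt_ext (y : R) : R :=
  (Num.sqrt (1 + Num.max 0 y))^-1 + 2^-1 * Num.max 0 (- y).

Definition rsqrt_ext' (y : R) : R := - (2^-1 * (Num.sqrt (1 + Num.max 0 y))^-1 ^+ 3).

Lemma rsqrt_ext_base_gt0 (y : R) : 0 < Num.sqrt (1 + Num.max 0 y).
Proof. by rewrite sqrtr_gt0 ltr_pwDl// le_max lexx. Qed.

Lemma rsqrt_base_continuous : continuous (fun y : R => (Num.sqrt (1 + Num.max 0 y))^-1).
Proof.
move=> y; apply: cvgV; first by rewrite gt_eqF// rsqrt_ext_base_gt0.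
apply: (@continuous_cvg _ _ _ _ _ (fun y : R => 1 + Num.max 0 y) Num.sqrt).
  exact: sqrt_continuous.
apply: cvgD; first exact: cvg_cst.
by apply: (@max_fun_continuous _ R R (cst 0) id) => r; [exact: cvg_cst|exact: cvg_id].
Qed.

Lemma rsqrt_ext_convex (y z : R) :
  0 <= rsqrt_ext z - rsqrt_ext y - rsqrt_ext' y * (z - y).
Proof.
rewrite /rsqrt_ext /rsqrt_ext'.
have u0 := rsqrt_ext_base_gt0 y; have v0 := rsqrt_ext_base_gt0 z.
have uE : Num.sqrt (1 + Num.max 0 y) ^+ 2 = 1 + Num.max 0 y.
  by rewrite sqr_sqrtr// addr_ge0// le_max lexx.
have vE : Num.sqrt (1 + Num.max 0 z) ^+ 2 = 1 + Num.max 0 z.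
  by rewrite sqr_sqrtr// addr_ge0// le_max lexx.
have u1 : 1 <= Num.sqrt (1 + Num.max 0 y).
  by rewrite -{1}(@sqrtr1 R) ler_wsqrtr// lerDl le_max lexx.
move: u0 v0 uE vE u1.
set u := Num.sqrt (1 + Num.max 0 y); set v := Num.sqrt (1 + Num.max 0 z).
move=> u0 v0 uE vE u1.
have zE : z = (v ^+ 2 - 1) - Num.max 0 (- z).
  by rewrite vE; case: (leP 0 z) => h; [rewrite max_l|rewrite max_r]; lra.
have yE : y = (u ^+ 2 - 1) - Num.max 0 (- y).
  by rewrite uE; case: (leP 0 y) => h; [rewrite max_l|rewrite max_r]; lra.
(* In terms of the square roots [u] and [v] the convexity gap of the inverse square root has a
   double root at [u = v] and otherwise positive factors. *)
have c0 : 0 <= v^-1 - u^-1 + 2^-1 * u^-1 ^+ 3 * (v ^+ 2 - u ^+ 2).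
  rewrite (_ : _ + _ = (u - v) ^+ 2 * (2 * u + v) / (2 * u ^+ 3 * v)); last first.
    by field; rewrite !gt_eqF.
  apply: divr_ge0; last by rewrite ltW// !mulr_gt0// exprn_gt0.
  by apply: mulr_ge0; [exact: sqr_ge0|rewrite ltW// addr_gt0// mulr_gt0].
have ui1 : u^-1 ^+ 3 <= 1.
  by rewrite exprn_ile1// ?invr_ge0 ?(ltW u0)// invf_le1.
(* Convexity across 0: the slope [-1/2] on the negative side is at most every slope
   [- u^-1 ^+ 3 / 2] on the other side. *)
have c1 : 0 <= (Num.max 0 (- z) - Num.max 0 (- y)) * (2^-1 - 2^-1 * u^-1 ^+ 3).
  have [y0|y0] := leP 0 y.
    rewrite (max_l (_ : - y <= 0)) ?oppr_le0// subr0; apply: mulr_ge0.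
      by rewrite le_max lexx.
    lra.
  have -> : u = 1 by rewrite /u (max_l (ltW y0)) addr0 sqrtr1.
  by rewrite invr1 expr1n mulr1 subrr mulr0.
have -> : z - y = (v ^+ 2 - 1 - Num.max 0 (- z)) - (u ^+ 2 - 1 - Num.max 0 (- y)).
  by rewrite -zE -yE.
move: c0 c1; clear.
move: (Num.max 0 (- z)) (Num.max 0 (- y)) => mz my c0 c1.
have := addr_ge0 c0 c1; congr (0 <= _); ring.
Qed.

Lemma semimart_rsqrt X : semi X -> (forall t x, 0 <= X t x) ->
  semi (fun t x => (Num.sqrt (1 + X t x))^-1).
Proof.
move=> hX X0.
have cf : continuous rsqrt_ext.
  move=> y; apply: cvgD; first exact: rsqrt_base_continuous.
  apply: cvgMl_tmp; apply: (@max_fun_continuous _ R R (cst 0) -%R) => r.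
    exact: cvg_cst.
  by apply: cvgN; exact: cvg_id.
have cg : continuous rsqrt_ext'.
  move=> y; apply: cvgN; apply: cvgMl_tmp.
  apply: (@continuous_cvg _ _ _ _ _ _ (fun z : R => z ^+ 3)).
    exact: exprn_continuous.
  exact: rsqrt_base_continuous.
have := semimart_convex cf cg rsqrt_ext_convex hX.
congr (cont_semimartingale P F); apply/funext => t; apply/funext => x.
by rewrite /rsqrt_ext max_r// max_l ?oppr_le0// mulr0 addr0.
Qed.

End SemimartingaleAlgebra.

(** * Small triangular arrays *)

(* Convergence to 0 and boundedness in probability, uniformly along the rows of
   a triangular array, are stated with measurable exceptional sets, so that no
   measurability of the array is ever required. *)
Section Arrays.
Context {R : realType} {d : measure_display} {Omega : measurableType d}.
Context (P : probability Omega R) (N : nat -> nat).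
Implicit Types (e ep C : R) (Y Z : nat -> nat -> Omega -> R).

Definition opa Y := forall e ep, 0 < e -> 0 < ep -> \forall k \near \oo,
  exists B, [/\ measurable B, (P B <= ep%:E)%E &
    forall x, ~ B x -> forall i, (i <= N k)%N -> `|Y k i x| < e].

Definition bpa Y := forall ep, 0 < ep -> exists2 C, 0 < C & \forall k \near \oo,
  exists B, [/\ measurable B, (P B <= ep%:E)%E &
    forall x, ~ B x -> forall i, (i <= N k)%N -> `|Y k i x| <= C].

Lemma exc_setU (B1 B2 : set Omega) ep : measurable B1 -> measurable B2 ->
  (P B1 <= (ep / 2)%:E)%E -> (P B2 <= (ep / 2)%:E)%E ->
  measurable (B1 `|` B2) /\ (P (B1 `|` B2) <= ep%:E)%E.
Proof.
move=> m1 m2 P1 P2; split; first exact: measurableU.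
by rewrite [ep]splitr; apply: (@prob_le2 _ _ _ P B1 B2) => //; exact: measurableU.
Qed.

Lemma notU (B1 B2 : set Omega) x : ~ (B1 `|` B2) x -> ~ B1 x /\ ~ B2 x.
Proof. by move=> h; split=> hb; apply: h; [left|right]. Qed.

Lemma opa_bpa Y : opa Y -> bpa Y.
Proof.
move=> hY ep ep0; exists 1 => //; move: (hY 1 ep ltr01 ep0).
apply: filterS => k [B [mB PB hB]]; exists B; split => // x Bx i iN.
by apply: ltW; exact: hB.
Qed.

Lemma opa_le Y Z : opa Z -> (forall k i x, (i <= N k)%N -> `|Y k i x| <= `|Z k i x|) ->
  opa Y.
Proof.
move=> hZ YZ e ep e0 ep0; move: (hZ e ep e0 ep0).
apply: filterS => k [B [mB PB hB]]; exists B; split => // x Bx i iN.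
by apply: le_lt_trans (YZ _ _ _ iN) _; exact: hB.
Qed.

Lemma bpa_le Y Z : bpa Z -> (forall k i x, (i <= N k)%N -> `|Y k i x| <= `|Z k i x|) ->
  bpa Y.
Proof.
move=> hZ YZ ep ep0; have [C C0 hC] := hZ ep ep0; exists C => //; move: hC.
apply: filterS => k [B [mB PB hB]]; exists B; split => // x Bx i iN.
by apply: le_trans (YZ _ _ _ iN) _; exact: hB.
Qed.

Lemma opa_ext Y Z : opa Z -> (forall k i x, (i <= N k)%N -> Y k i x = Z k i x) -> opa Y.
Proof. by move=> hZ YZ; apply: (opa_le hZ) => k i x iN; rewrite YZ. Qed.

Lemma bpa_ext Y Z : bpa Z -> (forall k i x, (i <= N k)%N -> Y k i x = Z k i x) -> bpa Y.
Proof. by move=> hZ YZ; apply: (bpa_le hZ) => k i x iN; rewrite YZ. Qed.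

Lemma opaD Y Z : opa Y -> opa Z -> opa (fun k i x => Y k i x + Z k i x).
Proof.
move=> hY hZ e ep e0 ep0; have e2 : 0 < e / 2 by rewrite divr_gt0.
have ep2 : 0 < ep / 2 by rewrite divr_gt0.
move: (hY _ _ e2 ep2) (hZ _ _ e2 ep2); apply: filterS2 => k [B1 [m1 P1 h1]] [B2 [m2 P2 h2]].
have [mU PU] := exc_setU m1 m2 P1 P2; exists (B1 `|` B2); split => // x xU i iN; have [x1 x2] := notU xU.
by rewrite [e]splitr (le_lt_trans (ler_normD _ _))// ltrD// ?h1 ?h2.
Qed.

Lemma bpaD Y Z : bpa Y -> bpa Z -> bpa (fun k i x => Y k i x + Z k i x).
Proof.
move=> hY hZ ep ep0; have ep2 : 0 < ep / 2 by rewrite divr_gt0.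
have [C1 C10 hC1] := hY _ ep2; have [C2 C20 hC2] := hZ _ ep2.
exists (C1 + C2); first exact: addr_gt0.
move: hC1 hC2; apply: filterS2 => k [B1 [m1 P1 h1]] [B2 [m2 P2 h2]].
have [mU PU] := exc_setU m1 m2 P1 P2; exists (B1 `|` B2); split => // x xU i iN; have [x1 x2] := notU xU.
by rewrite (le_trans (ler_normD _ _))// lerD// ?h1 ?h2.
Qed.

Lemma bpaM Y Z : bpa Y -> bpa Z -> bpa (fun k i x => Y k i x * Z k i x).
Proof.
move=> hY hZ ep ep0; have ep2 : 0 < ep / 2 by rewrite divr_gt0.
have [C1 C10 hC1] := hY _ ep2; have [C2 C20 hC2] := hZ _ ep2.
exists (C1 * C2); first exact: mulr_gt0.
move: hC1 hC2; apply: filterS2 => k [B1 [m1 P1 h1]] [B2 [m2 P2 h2]].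
have [mU PU] := exc_setU m1 m2 P1 P2; exists (B1 `|` B2); split => // x xU i iN; have [x1 x2] := notU xU.
by rewrite normrM ler_pM// ?h1 ?h2.
Qed.

Lemma opaM Y Z : opa Y -> bpa Z -> opa (fun k i x => Y k i x * Z k i x).
Proof.
move=> hY hZ e ep e0 ep0; have ep2 : 0 < ep / 2 by rewrite divr_gt0.
have [C C0 hC] := hZ _ ep2; have eC : 0 < e / C by rewrite divr_gt0.
move: (hY _ _ eC ep2) hC; apply: filterS2 => k [B1 [m1 P1 h1]] [B2 [m2 P2 h2]].
have [mU PU] := exc_setU m1 m2 P1 P2; exists (B1 `|` B2); split => // x xU i iN; have [x1 x2] := notU xU.
rewrite normrM (@le_lt_trans _ _ (`|Y k i x| * C))//; first by rewrite ler_wpM2l// h2.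
by rewrite -ltr_pdivlMr// h1.
Qed.

Lemma bpa_cst c : bpa (fun _ _ _ => c).
Proof.
move=> ep ep0; exists (`|c| + 1); first by rewrite ltr_wpDl.
apply: nearW => k; exists set0; split=> [//||x _ i _].
  by rewrite measure0 lee_fin ltW.
by rewrite lerDl.
Qed.

Lemma opa0 : opa (fun _ _ _ => 0).
Proof.
move=> e ep e0 ep0; apply: nearW => k; exists set0; split=> [//||x _ i _].
  by rewrite measure0 lee_fin ltW.
by rewrite normr0.
Qed.

Lemma opaZ c Y : opa Y -> opa (fun k i x => c * Y k i x).
Proof.
move=> hY; apply: (opa_ext (opaM hY (bpa_cst c))) => k i x _; exact: mulrC.
Qed.

Lemma opaB Y Z : opa Y -> opa Z -> opa (fun k i x => Y k i x - Z k i x).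
Proof.
move=> hY hZ; apply: (opa_ext (opaD hY (opaZ (-1) hZ))) => k i x _.
by rewrite mulN1r.
Qed.

Lemma bpaB Y Z : bpa Y -> bpa Z -> bpa (fun k i x => Y k i x - Z k i x).
Proof.
move=> hY hZ; apply: (bpa_ext (bpaD hY (bpaM (bpa_cst (-1)) hZ))) => k i x _.
by rewrite mulN1r.
Qed.

Lemma opa_sum (I : Type) (r : seq I) (Y : I -> nat -> nat -> Omega -> R) :
  (forall l, opa (Y l)) -> opa (fun k i x => \sum_(l <- r) Y l k i x).
Proof.
move=> hY; elim: r => [|l r IH].
  by apply: (opa_ext opa0) => k i x _; rewrite big_nil.
by apply: (opa_ext (opaD (hY l) IH)) => k i x _; rewrite big_cons.
Qed.

Definition psum Y k j x : R := \sum_(i < j) Y k i x.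

Lemma psumS Y k j x : psum Y k j.+1 x = psum Y k j x + Y k j x.
Proof. by rewrite /psum big_ord_recr. Qed.

Lemma psum0 Y k x : psum Y k 0 x = 0.
Proof. by rewrite /psum big_ord0. Qed.

Lemma psumD Y Z k j x : psum (fun k i x => Y k i x + Z k i x) k j x =
  psum Y k j x + psum Z k j x.
Proof. by rewrite /psum big_split. Qed.

Lemma psumZ c Y k j x : psum (fun k i x => c * Y k i x) k j x = c * psum Y k j x.
Proof. by rewrite /psum mulr_sumr. Qed.

Lemma psum_sum (I : Type) (r : seq I) (Y : I -> nat -> nat -> Omega -> R) k j x :
  psum (fun k i x => \sum_(l <- r) Y l k i x) k j x = \sum_(l <- r) psum (Y l) k j x.
Proof. by rewrite /psum exchange_big. Qed.

(** The device that removes products of three increments: one small factor against squares whose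
    sums are bounded in probability. *)
Lemma opa_psum_le c A Y : opa c -> bpa (psum A) ->
  (forall k i x, 0 <= A k i x) ->
  (forall k i x, (i < N k)%N -> `|Y k i x| <= `|c k i x| * A k i x) -> opa (psum Y).
Proof.
move=> hc hA A0 YA e ep e0 ep0; have ep2 : 0 < ep / 2 by rewrite divr_gt0.
have [C C0 hC] := hA _ ep2; have eC : 0 < e / (C + 1) by rewrite divr_gt0// addr_gt0.
move: (hc _ _ eC ep2) hC; apply: filterS2 => k [B1 [m1 P1 h1]] [B2 [m2 P2 h2]].
have [mU PU] := exc_setU m1 m2 P1 P2; exists (B1 `|` B2); split => // x xU j jN; have [x1 x2] := notU xU.
apply: (@le_lt_trans _ _ (e / (C + 1) * psum A k j x)).
  rewrite /psum mulr_sumr; apply: (le_trans (ler_norm_sum _ _ _)); apply: ler_sum => i _.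
  have iN : (i < N k)%N by exact: leq_trans (ltn_ord i) jN.
  apply: (le_trans (YA _ _ _ iN)); apply: ler_wpM2r => //.
  by apply: ltW; apply: h1 => //; exact: ltnW.
apply: (@le_lt_trans _ _ (e / (C + 1) * C)).
  rewrite ler_wpM2l ?(ltW eC)//; apply: le_trans (h2 x x2 j jN); exact: ler_norm.
by rewrite mulrAC ltr_pdivrMr ?addr_gt0// ltr_pM2l// ltrDl.
Qed.

(** Cauchy-Schwarz in the form [2 |y z| <= lam z ^ 2 + lam^-1 y ^ 2]. With [lam = e / C], the sum of
    squares of [Z] contributes at most [e], and that of [Y] less than [e] once it is below
    [e * lam]. *)
Lemma opa_psum_CS Y Z : opa (psum (fun k i x => Y k i x ^+ 2)) ->
  bpa (psum (fun k i x => Z k i x ^+ 2)) -> opa (psum (fun k i x => Y k i x * Z k i x)).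
Proof.
move=> hY hZ e ep e0 ep0; have ep2 : 0 < ep / 2 by rewrite divr_gt0.
have [C C0 hC] := hZ _ ep2.
pose lam := e / C; have lam0 : 0 < lam by rewrite divr_gt0.
have el : 0 < e * lam by rewrite mulr_gt0.
move: (hY _ _ el ep2) hC; apply: filterS2 => k [B1 [m1 P1 h1]] [B2 [m2 P2 h2]].
have [mU PU] := exc_setU m1 m2 P1 P2; exists (B1 `|` B2); split => // x xU j jN; have [x1 x2] := notU xU.
apply: (@le_lt_trans _ _ (2^-1 * (lam * psum (fun k i x => Z k i x ^+ 2) k j x +
   lam^-1 * psum (fun k i x => Y k i x ^+ 2) k j x))).
  rewrite /psum !mulr_sumr -big_split/= mulr_sumr.
  apply: (le_trans (ler_norm_sum _ _ _)); apply: ler_sum => i _.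
  rewrite normrM -(real_normK (num_real (Y k i x))) -(real_normK (num_real (Z k i x))).
  move: (normr_ge0 (Y k i x)) (normr_ge0 (Z k i x)).
  move: `|Y k i x| `|Z k i x| => y z y0 z0.
  have : 0 <= lam^-1 * (lam * z - y) ^+ 2 by rewrite mulr_ge0 ?sqr_ge0// invr_ge0 ltW.
  rewrite (_ : lam^-1 * _ = lam * z ^+ 2 + lam^-1 * y ^+ 2 - 2 * (y * z)).
    by lra.
  by field; rewrite gt_eqF.
have h3 : lam * psum (fun k i x => Z k i x ^+ 2) k j x <= e.
  rewrite /lam mulrAC ler_pdivrMr// ler_pM2l//.
  by apply: le_trans (h2 x x2 j jN); exact: ler_norm.
have h4 : lam^-1 * psum (fun k i x => Y k i x ^+ 2) k j x < e.
  rewrite mulrC ltr_pdivrMr//; apply: le_lt_trans (h1 x x1 j jN); exact: ler_norm.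
by lra.
Qed.

End Arrays.

(** * Continuous processes sampled along partitions *)

Section PartitionArrays.
Context {R : realType} {d : measure_display} {Omega : measurableType d}.
Context (P : probability Omega R) (F : R -> set (set Omega)).
Context (F_usual : usual_filtration P F).
Context (t : R) (t0 : 0 <= t) (N : nat -> nat) (p : nat -> nat -> R).
Context (gp : forall k, grid t (p k)).
Context (mesh : forall e, 0 < e -> \forall k \near \oo, forall i, p k i.+1 - p k i <= e).
Implicit Types (e ep C : R) (X Y Z H : R -> Omega -> R).

Local Notation opa := (opa P N).
Local Notation bpa := (bpa P N).

Definition arr_pt X k i x : R := X (p k i) x.
Definition arr_inc X k i x : R := X (p k i.+1) x - X (p k i) x.
Definition arr_mid X k i x : R := 2^-1 * (X (p k i) x + X (p k i.+1) x).

Lemma pt_ge0 k i : 0 <= p k i. Proof. by have [] := gp k. Qed.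
Lemma pt_le k i : p k i <= t. Proof. by have [] := gp k. Qed.
Lemma pt_leS k i : p k i <= p k i.+1. Proof. by have [] := gp k. Qed.

Lemma bpa_pr X : cproc F X -> bpa (arr_pt X).
Proof.
move=> cX ep ep0; have [C C0 [B [mB PB hB]]] := sup_bounded F_usual cX t0 ep0.
exists C => //; apply: nearW => k; exists B; split => // x Bx i _.
by apply: hB => //; [exact: pt_ge0|exact: pt_le].
Qed.

Lemma opa_inc X : cproc F X -> opa (arr_inc X).
Proof.
move=> cX e ep e0 ep0; have e2 : 0 < e / 2 by rewrite divr_gt0.
have [eta eta0 [B [mB PB hB]]] := osc_small F_usual cX t0 e2 ep0.
move: (mesh eta0); apply: filterS => k hk; exists B; split => // x Bx i _.
apply: (@le_lt_trans _ _ (e / 2)); last by lra.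
apply: hB => //; [exact: pt_ge0|exact: pt_le|exact: pt_ge0|exact: pt_le|].
by rewrite ger0_norm ?subr_ge0 ?pt_leS.
Qed.

Lemma psum_gsum h X k j x : psum (fun k i x => h k i x * arr_inc X k i x) k j x =
  gsum (p k) (h k) X j x.
Proof. by []. Qed.

Definition arr_adapted (h : nat -> nat -> Omega -> R) := forall k i, Fm F (p k i) (h k i).

Lemma adapted_pr X : cproc F X -> arr_adapted (arr_pt X).
Proof. by move=> cX k i; apply: (cproc_Fm F_usual cX); exact: pt_ge0. Qed.

Lemma bpa_gsum h X : cproc F X -> good P F X -> arr_adapted h -> bpa h ->
  bpa (psum (fun k i x => h k i x * arr_inc X k i x)).
Proof.
move=> cX gX ah hh ep ep0; have ep2 : 0 < ep / 2 by rewrite divr_gt0.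
have [K K0 hK] := hh _ ep2.
have [C C0 hC] := good_bound F_usual cX gX t0 ep2.
exists (C * K); first exact: mulr_gt0.
move: hK; apply: filterS => k [B1 [m1 P1 h1]].
have [||B2 [m2 P2 h2]] := hC K K0 (N k) (p k) (h k) B1 (gp k).
- exact: ah.
- by move=> x x1 i iN; apply: h1 => //; exact: ltnW.
have [mU PU] := exc_setU m1 m2 P1 P2; exists (B1 `|` B2); split => // x xU i iN; have [x1 x2] := notU xU.
by apply: ltW; exact: h2.
Qed.

Lemma opa_gsum h X : cproc F X -> good P F X -> arr_adapted h -> opa h ->
  opa (psum (fun k i x => h k i x * arr_inc X k i x)).
Proof.
move=> cX gX ah hh e ep e0 ep0; have ep2 : 0 < ep / 2 by rewrite divr_gt0.
have [C C0 hC] := good_bound F_usual cX gX t0 ep2.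
have K0 : 0 < e / C by rewrite divr_gt0.
move: (hh _ _ K0 ep2); apply: filterS => k [B1 [m1 P1 h1]].
have [||B2 [m2 P2 h2]] := hC _ K0 (N k) (p k) (h k) B1 (gp k).
- exact: ah.
- by move=> x x1 i iN; apply: ltW; apply: h1 => //; exact: ltnW.
have [mU PU] := exc_setU m1 m2 P1 P2; exists (B1 `|` B2); split => // x xU i iN; have [x1 x2] := notU xU.
by have := h2 x x1 x2 i iN; rewrite [C * _]mulrC divfK ?gt_eqF.
Qed.

(** The sum of squared increments is the difference of the final and initial squares minus twice the
    elementary integral of [X] against itself, and all of these are bounded in probability. *)
Lemma bpa_qv X : cproc F X -> good P F X -> bpa (psum (fun k i x => arr_inc X k i x ^+ 2)).
Proof.
move=> cX gX; have bX := bpa_pr cX.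
have h1 := bpa_gsum cX gX (adapted_pr cX) bX.
have h2 := bpaM bX bX.
have h3 : bpa (fun k _ x => X 0 x * X 0 x).
  have b0 : bpa (fun k _ x => X 0 x).
    exact: (@bpa_pr (fun _ => X 0) (cproc_init F_usual cX)).
  exact: bpaM.
have h4 : bpa (fun k _ x => X (p k 0%N) x).
  move=> ep ep0; have [C C0 hC] := bX ep ep0; exists C => //; move: hC.
  by apply: filterS => k [B [mB PB hB]]; exists B; split => // x Bx i _; exact: (hB x Bx 0%N).
apply: (bpa_ext (bpaB (bpaB h2 (bpaM h4 h4)) (bpaM (bpa_cst P N 2) h1))) => k j x _.
elim: j => [|j IH]; first by rewrite !psum0 /arr_pt; ring.
by rewrite !psumS IH /arr_inc /arr_pt; ring.
Qed.

Lemma opa_third c X Y : cproc F X -> good P F X -> cproc F Y -> good P F Y -> opa c ->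
  opa (psum (fun k i x => c k i x * (arr_inc X k i x * arr_inc Y k i x))).
Proof.
move=> cX gX cY gY hc.
have hA := bpaD (bpa_qv cX gX) (bpa_qv cY gY).
apply: (@opa_psum_le _ _ _ P N c (fun k i x => arr_inc X k i x ^+ 2 + arr_inc Y k i x ^+ 2)) => //.
- by apply: (bpa_ext hA) => k j x _; rewrite psumD.
- by move=> k i x; rewrite addr_ge0// sqr_ge0.
move=> k i x _; rewrite !normrM ler_wpM2l//.
rewrite -(real_normK (num_real (arr_inc X k i x))) -(real_normK (num_real (arr_inc Y k i x))).
have := normr_ge0 (arr_inc X k i x); have := normr_ge0 (arr_inc Y k i x).
by have := sqr_ge0 (`|arr_inc X k i x| - `|arr_inc Y k i x|); nra.
Qed.

End PartitionArrays.

(** * Errors of Stratonovich sums *)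

Section StratonovichArrays.
Context {R : realType} {d : measure_display} {Omega : measurableType d}.
Context (P : probability Omega R) (F : R -> set (set Omega)).
Context (F_usual : usual_filtration P F).
Context (t : R) (t0 : 0 <= t) (N : nat -> nat) (p : nat -> nat -> R).
Context (gp : forall k, grid t (p k)).
Context (mesh : forall e, 0 < e -> \forall k \near \oo, forall i, p k i.+1 - p k i <= e).
Implicit Types (e ep C eta u v q : R) (X Y Z H : R -> Omega -> R).

Local Notation opa := (opa P N).
Local Notation bpa := (bpa P N).
Local Notation pr := (arr_pt p).
Local Notation inc := (arr_inc p).
Local Notation mid := (arr_mid p).

Definition diag_small (f : R -> R -> Omega -> R) := forall e ep, 0 < e -> 0 < ep ->
  exists2 eta, 0 < eta & exists B, [/\ measurable B, (P B <= ep%:E)%E &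
    forall x, ~ B x -> forall u v, 0 <= u -> u <= t -> 0 <= v -> v <= t ->
      `|u - v| <= eta -> `|f u v x| <= e].

Lemma diag_small0 : diag_small (fun _ _ _ => 0).
Proof.
move=> e ep e0 ep0; exists 1 => //; exists set0; split => //.
  by rewrite measure0 lee_fin ltW.
by move=> x _ u v _ _ _ _ _; rewrite normr0 ltW.
Qed.

Lemma diag_smallD f g : diag_small f -> diag_small g ->
  diag_small (fun u v x => f u v x + g u v x).
Proof.
move=> hf hg e ep e0 ep0; have e2 : 0 < e / 2 by rewrite divr_gt0.
have ep2 : 0 < ep / 2 by rewrite divr_gt0.
have [eta1 eta10 [B1 [m1 P1 h1]]] := hf _ _ e2 ep2.
have [eta2 eta20 [B2 [m2 P2 h2]]] := hg _ _ e2 ep2.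
exists (Num.min eta1 eta2); first by rewrite lt_min eta10.
have [mU PU] := exc_setU m1 m2 P1 P2; exists (B1 `|` B2); split => // x xU u v u0 ut v0 vt.
have [x1 x2] := notU xU; rewrite le_min => /andP[uv1 uv2].
by rewrite [e]splitr (le_trans (ler_normD _ _))// lerD// ?h1 ?h2.
Qed.

Lemma diag_smallZ c f : diag_small f -> diag_small (fun u v x => c * f u v x).
Proof.
move=> hf e ep e0 ep0; have e2 : 0 < e / (`|c| + 1) by rewrite divr_gt0// ltr_wpDl.
have [eta1 eta10 [B1 [m1 P1 h1]]] := hf _ _ e2 ep0.
exists eta1 => //; exists B1; split => // x x1 u v u0 ut v0 vt uv.
rewrite normrM (@le_trans _ _ (`|c| * (e / (`|c| + 1))))// ?ler_wpM2l// ?h1//.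
by rewrite mulrCA ler_piMr ?(ltW e0)// ler_pdivrMr ?ltr_wpDl// mul1r lerDl.
Qed.

Lemma diag_small_sum (I : Type) (r : seq I) (f : I -> R -> R -> Omega -> R) :
  (forall l, diag_small (f l)) -> diag_small (fun u v x => \sum_(l <- r) f l u v x).
Proof.
move=> hf; elim: r => [|l r IH].
  rewrite (_ : (fun _ _ _ => _) = fun _ _ _ => 0); first exact: diag_small0.
  by apply/funext => u; apply/funext => v; apply/funext => x; rewrite big_nil.
rewrite (_ : (fun _ _ _ => _) = fun u v x => f l u v x + \sum_(j <- r) f j u v x).
  exact: diag_smallD.
by apply/funext => u; apply/funext => v; apply/funext => x; rewrite big_cons.
Qed.

Lemma diag_small_incr X : cproc F X -> diag_small (fun u v x => X v x - X u x).
Proof.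
move=> cX e ep e0 ep0; have [eta eta0 [B [mB PB hB]]] := osc_small F_usual cX t0 e0 ep0.
exists eta => //; exists B; split => // x Bx u v u0 ut v0 vt uv.
by rewrite distrC; exact: hB.
Qed.

Lemma diag_small_mid X Y : cproc F X -> cproc F Y ->
  diag_small (fun u v x => 2^-1 * (X u x + X v x) * (Y v x - Y u x)).
Proof.
move=> cX cY e ep e0 ep0; have ep2 : 0 < ep / 2 by rewrite divr_gt0.
have [C C0 [B1 [m1 P1 h1]]] := sup_bounded F_usual cX t0 ep2.
have eC : 0 < e / C by rewrite divr_gt0.
have [eta eta0 [B2 [m2 P2 h2]]] := diag_small_incr cY eC ep2.
exists eta => //; have [mU PU] := exc_setU m1 m2 P1 P2.
exists (B1 `|` B2); split => // x xU u v u0 ut v0 vt uv; have [x1 x2] := notU xU.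
rewrite normrM (_ : e = C * (e / C)); last by rewrite mulrC divfK// gt_eqF.
apply: ler_pM => //; last exact: h2.
rewrite normrM ger0_norm ?invr_ge0//.
have := ler_normD (X u x) (X v x); have := h1 x x1 u u0 ut; have := h1 x x1 v v0 vt.
lra.
Qed.

(* Uniform smallness of the oscillation of [Y k] inside the cells
   [[c * eta, (c + 1) * eta[] of a coarse partition. *)
Definition cell_small (Y : nat -> nat -> Omega -> R) := forall e ep, 0 < e -> 0 < ep ->
  exists2 eta0, 0 < eta0 & forall eta, 0 < eta -> eta <= eta0 -> \forall k \near \oo,
  exists B, [/\ measurable B, (P B <= ep%:E)%E &
    forall x, ~ B x -> forall (c : nat) i j, (i <= j)%N -> (j <= N k)%N ->
      c%:R * eta <= p k i -> p k j < c.+1%:R * eta -> `|Y k j x - Y k i x| <= e].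

Lemma cell_smallD (Y Z : nat -> nat -> Omega -> R) : cell_small Y -> cell_small Z ->
  cell_small (fun k i x => Y k i x + Z k i x).
Proof.
move=> hY hZ e ep e0 ep0; have e2 : 0 < e / 2 by rewrite divr_gt0.
have ep2 : 0 < ep / 2 by rewrite divr_gt0.
have [eta1 eta10 h1] := hY _ _ e2 ep2; have [eta2 eta20 h2] := hZ _ _ e2 ep2.
exists (Num.min eta1 eta2); first by rewrite lt_min eta10.
move=> eta eta0; rewrite le_min => /andP[le1 le2].
move: (h1 eta eta0 le1) (h2 eta eta0 le2).
apply: filterS2 => k [B1 [m1 P1 hB1]] [B2 [m2 P2 hB2]].
have [mU PU] := exc_setU m1 m2 P1 P2; exists (B1 `|` B2); split => // x xU c i j ij jN ci cj.
have [x1 x2] := notU xU.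
rewrite (_ : _ - _ = (Y k j x - Y k i x) + (Z k j x - Z k i x)); last by ring.
rewrite [e]splitr (le_trans (ler_normD _ _))// lerD//.
  exact: (hB1 x x1 c).
exact: (hB2 x x2 c).
Qed.

Lemma cell_smallZ a (Y : nat -> nat -> Omega -> R) : cell_small Y -> cell_small (fun k i x => a * Y k i x).
Proof.
move=> hY e ep e0 ep0; have e2 : 0 < e / (`|a| + 1) by rewrite divr_gt0// ltr_wpDl.
have [eta1 eta10 h1] := hY _ _ e2 ep0; exists eta1 => // eta eta0 le1.
move: (h1 eta eta0 le1); apply: filterS => k [B1 [m1 P1 hB1]].
exists B1; split => // x x1 c i j ij jN ci cj.
rewrite -mulrBr normrM (@le_trans _ _ (`|a| * (e / (`|a| + 1))))//.
  by rewrite ler_wpM2l//; exact: (hB1 x x1 c).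
by rewrite mulrCA ler_piMr ?(ltW e0)// ler_pdivrMr ?ltr_wpDl// mul1r lerDl.
Qed.

Lemma cell_small_ext (Y Z : nat -> nat -> Omega -> R) : (forall k i x, Y k i x = Z k i x) -> cell_small Z -> cell_small Y.
Proof.
move=> YZ; rewrite (_ : Y = Z)//.
by apply/funext => k; apply/funext => i; apply/funext => x.
Qed.

Lemma cell_small_sum (I : Type) (r : seq I) (Y : I -> nat -> nat -> Omega -> R) :
  (forall l, cell_small (Y l)) -> cell_small (fun k i x => \sum_(l <- r) Y l k i x).
Proof.
move=> hY; elim: r => [|l r IH].
  move=> e ep e0 ep0; exists 1 => // eta _ _; apply: nearW => k; exists set0.
  split => //; first by rewrite measure0 lee_fin ltW.
  by move=> x _ c i j _ _ _ _; rewrite !big_nil subrr normr0 ltW.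
apply: (cell_small_ext (Z := fun k i x => Y l k i x + \sum_(j <- r) Y j k i x)).
  by move=> k i x; rewrite big_cons.
exact: cell_smallD.
Qed.

Lemma cell_dist c eta i j k : 0 < eta -> (i <= j)%N -> c%:R * eta <= p k i ->
  p k j < c.+1%:R * eta -> `|p k i - p k j| <= eta.
Proof.
move=> eta0 ij ci cj; have pij := grid_mono (gp k) ij.
rewrite distrC ger0_norm ?subr_ge0//; move: cj; rewrite -natr1 mulrDl mul1r.
by move: (c%:R * eta) ci => z ci cj; lra.
Qed.

Lemma cell_small_pr X : cproc F X -> cell_small (pr X).
Proof.
move=> cX e ep e0 ep0; have [eta1 eta10 [B [mB PB hB]]] := diag_small_incr cX e0 ep0.
exists eta1 => // eta eta0 le1; apply: nearW => k; exists B; split => // x Bx c i j ij jN ci cj.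
apply: hB => //; try exact: (pt_ge0 gp); try exact: (pt_le gp).
by apply: le_trans le1; exact: (cell_dist eta0 ij ci cj).
Qed.

(** Left end of the cell of width [eta] that contains [u]. *)
Definition cell eta u : R := (Num.truncn (u / eta))%:R * eta.

Lemma cell_ge0 eta u : 0 < eta -> 0 <= cell eta u.
Proof. by move=> eta0; rewrite mulr_ge0// ltW. Qed.

Lemma cell_le eta u : 0 < eta -> 0 <= u -> cell eta u <= u.
Proof.
move=> eta0 u0; rewrite /cell -ler_pdivlMr// truncn_le.
by apply: divr_ge0 => //; exact: ltW.
Qed.

Lemma cell_gt eta u : 0 < eta -> u < (Num.truncn (u / eta)).+1%:R * eta.
Proof. by move=> eta0; rewrite -ltr_pdivrMr//; exact: truncnS_gt. Qed.

Lemma cellE eta u (c : nat) : 0 < eta -> c%:R * eta <= u -> u < c.+1%:R * eta ->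
  cell eta u = c%:R * eta.
Proof.
move=> eta0 h1 h2; rewrite /cell (@truncn_def _ _ c)//.
by rewrite ler_pdivlMr// ltr_pdivrMr// h1.
Qed.

(** With [x] and [y] the deviations of [X] and [Y] from their values at the cell start [q], one
    midpoint term for [x] is half of [d(x y) + x dy - y dx]. The deviations are small adapted
    integrands defined along the whole row, so the sums [SX] and [SY] are controlled for all cells
    at once. *)
Lemma cell_incr X Y c eta k i j x : 0 < eta -> (i <= j)%N -> c%:R * eta <= p k i ->
  p k j < c.+1%:R * eta ->
  let q := c%:R * eta in
  let hX k i x := X (p k i) x - X (cell eta (p k i)) x in
  let hY k i x := Y (p k i) x - Y (cell eta (p k i)) x in
  let V := psum (fun k i x => mid X k i x * inc Y k i x) in
  let SX := psum (fun k i x => hX k i x * inc Y k i x) in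
  let SY := psum (fun k i x => hY k i x * inc X k i x) in
  V k j x - V k i x = X q x * (Y (p k j) x - Y (p k i) x)
    + 2^-1 * ((X (p k j) x - X q x) * (Y (p k j) x - Y q x)
              - (X (p k i) x - X q x) * (Y (p k i) x - Y q x))
    + 2^-1 * (SX k j x - SX k i x) - 2^-1 * (SY k j x - SY k i x).
Proof.
move=> eta0 ij ci cj q hX hY V SX SY.
suff : forall n, (i + n <= j)%N -> V k (i + n)%N x - V k i x =
    X q x * (Y (p k (i + n)%N) x - Y (p k i) x)
    + 2^-1 * ((X (p k (i + n)%N) x - X q x) * (Y (p k (i + n)%N) x - Y q x)
              - (X (p k i) x - X q x) * (Y (p k i) x - Y q x))
    + 2^-1 * (SX k (i + n)%N x - SX k i x) - 2^-1 * (SY k (i + n)%N x - SY k i x).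
  by move=> /(_ (j - i)%N); rewrite subnKC//; apply.
elim=> [_|n IH nj]; first by rewrite addn0 !subrr !mulr0 !addr0 subr0.
rewrite addnS in nj *.
have {}IH := IH (ltnW nj).
have E : cell eta (p k (i + n)%N) = q.
  apply: cellE => //.
    by apply: le_trans ci _; apply: (grid_mono (gp k)); exact: leq_addr.
  by apply: le_lt_trans cj; apply: (grid_mono (gp k)); exact: ltnW nj.
have vS : V k (i + n).+1 x = V k (i + n)%N x + mid X k (i + n) x * inc Y k (i + n) x.
  exact: psumS.
have sX : SX k (i + n).+1 x = SX k (i + n)%N x + hX k (i + n)%N x * inc Y k (i + n) x.
  exact: psumS.
have sY : SY k (i + n).+1 x = SY k (i + n)%N x + hY k (i + n)%N x * inc X k (i + n) x.
  exact: psumS.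
rewrite vS sX sY addrAC IH /hX /hY E /arr_mid /arr_inc.
by field.
Qed.

Lemma cell_small_mid X Y : cproc F X -> good P F X -> cproc F Y -> good P F Y ->
  cell_small (psum (fun k i x => mid X k i x * inc Y k i x)).
Proof.
move=> cX gX cY gY e ep e0 ep0.
have ep2 : 0 < ep / 2 by rewrite divr_gt0.
have ep4 : 0 < ep / 2 / 2 by rewrite divr_gt0.
have ep8 : 0 < ep / 2 / 2 / 2 by rewrite divr_gt0.
have [C C0 [B1 [m1 P1 h1]]] := sup_bounded F_usual cX t0 ep4.
have [CX CX0 hCX] := good_bound F_usual cX gX t0 ep4.
have [CY CY0 hCY] := good_bound F_usual cY gY t0 ep4.
(* The four terms of [cell_incr] are at most [C], [1], [CY] and [CX] times [dl]; the second one uses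
   [dl <= 1]. *)
pose K := C + 1 + CX + CY.
have K1 : 1 <= K by rewrite /K; lra.
have K0 : 0 < K by apply: lt_le_trans K1.
pose dl := Num.min 1 (e / K).
have dl0 : 0 < dl by rewrite lt_min ltr01 divr_gt0.
have dl1 : dl <= 1 by rewrite ge_min lexx.
have dlK : dl * K <= e by rewrite -ler_pdivlMr// ge_min lexx orbT.
have [e1 e10 [D1 [n1 Q1 g1]]] := diag_small_incr cX dl0 ep8.
have [e2 e20 [D2 [n2 Q2 g2]]] := diag_small_incr cY dl0 ep8.
have [m12 P12] := exc_setU n1 n2 Q1 Q2.
have [mB0 PB0] := exc_setU m1 m12 P1 P12.
set B0 := B1 `|` (D1 `|` D2) in mB0 PB0.
exists (Num.min e1 e2); first by rewrite lt_min e10.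
move=> eta eta0; rewrite le_min => /andP[le1 le2].
apply: nearW => k.
pose hX k i x := X (p k i) x - X (cell eta (p k i)) x.
pose hY k i x := Y (p k i) x - Y (cell eta (p k i)) x.
have p0 k' i : 0 <= p k' i by exact: (pt_ge0 gp).
have pt k' i : p k' i <= t by exact: (pt_le gp).
have c0 u : 0 <= cell eta u by exact: cell_ge0.
have cp k' i : cell eta (p k' i) <= p k' i by exact: cell_le.
have ct k' i : cell eta (p k' i) <= t by exact: le_trans (pt k' i).
have cd k' i : `|cell eta (p k' i) - p k' i| <= eta.
  rewrite distrC ger0_norm ?subr_ge0//; have := cell_gt (p k' i) eta0.
  rewrite -natr1 mulrDl mul1r -/(cell eta (p k' i)); lra.
have aX k' i : Fm F (p k' i) (hX k' i).
  apply: FmB; first exact: (cproc_Fm F_usual cX).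
  by apply: (Fm_mono F_usual (c0 _) (cp _ _)); exact: (cproc_Fm F_usual cX).
have aY k' i : Fm F (p k' i) (hY k' i).
  apply: FmB; first exact: (cproc_Fm F_usual cY).
  by apply: (Fm_mono F_usual (c0 _) (cp _ _)); exact: (cproc_Fm F_usual cY).
have B0n x : ~ B0 x -> ~ B1 x /\ ~ D1 x /\ ~ D2 x.
  by move=> h; have [a b] := notU h; have [b1 b2] := notU b.
have bX x : ~ B0 x -> forall i, (i < N k)%N -> `|hX k i x| <= dl.
  move=> /B0n[_ [d1 _]] i _; apply: g1 => //.
  by apply: le_trans (cd _ _) le1.
have bY x : ~ B0 x -> forall i, (i < N k)%N -> `|hY k i x| <= dl.
  move=> /B0n[_ [_ d2]] i _; apply: g2 => //.
  by apply: le_trans (cd _ _) le2.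
have [E1 [r1 T1 f1]] := hCY _ dl0 (N k) (p k) (hX k) B0 (gp k) (aX k) bX.
have [E2 [r2 T2 f2]] := hCX _ dl0 (N k) (p k) (hY k) B0 (gp k) (aY k) bY.
have [mE PE] := exc_setU r1 r2 T1 T2.
have [mU PU] := exc_setU mB0 mE PB0 PE.
exists (B0 `|` (E1 `|` E2)); split => // x xU c i j ij jN ci cj.
have [x0 xE] := notU xU; have [xE1 xE2] := notU xE.
have [xB1 [xD1 xD2]] := B0n x x0.
rewrite (cell_incr X Y x eta0 ij ci cj) -/hX -/hY.
have iN : (i <= N k)%N by exact: leq_trans jN.
have a1 := f1 x x0 xE1 j jN; have a2 := f1 x x0 xE1 i iN.
have a3 := f2 x x0 xE2 j jN; have a4 := f2 x x0 xE2 i iN.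
set q := c%:R * eta.
have q0 : 0 <= q by rewrite mulr_ge0// ltW.
have pij := grid_mono (gp k) ij.
have qt : q <= t by apply: le_trans ci (pt _ _).
have dj : `|q - p k j| <= eta.
  rewrite distrC ger0_norm ?subr_ge0 ?(le_trans ci)//; move: cj.
  by rewrite -natr1 mulrDl mul1r -/q; lra.
have di : `|q - p k i| <= eta.
  rewrite distrC ger0_norm ?subr_ge0//; move: dj; rewrite distrC ger0_norm ?subr_ge0.
    by lra.
  exact: le_trans ci pij.
have b1 : `|X q x| <= C by exact: h1.
have b2 : `|Y (p k j) x - Y (p k i) x| <= dl.
  by apply: g2 => //; apply: le_trans le2; exact: (cell_dist eta0 ij ci cj).
have b3 : `|X (p k j) x - X q x| <= dl by apply: g1 => //; exact: le_trans dj le1.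
have b4 : `|Y (p k j) x - Y q x| <= dl by apply: g2 => //; exact: le_trans dj le2.
have b5 : `|X (p k i) x - X q x| <= dl by apply: g1 => //; exact: le_trans di le1.
have b6 : `|Y (p k i) x - Y q x| <= dl by apply: g2 => //; exact: le_trans di le2.
have m1' : `|X q x * (Y (p k j) x - Y (p k i) x)| <= C * dl by rewrite normrM ler_pM.
have m2' : `|(X (p k j) x - X q x) * (Y (p k j) x - Y q x)| <= dl.
  by rewrite normrM -[leRHS]mul1r ler_pM// (le_trans b3).
have m3' : `|(X (p k i) x - X q x) * (Y (p k i) x - Y q x)| <= dl.
  by rewrite normrM -[leRHS]mul1r ler_pM// (le_trans b5).
apply: le_trans dlK; rewrite /K.
rewrite -!(psum_gsum p) in a1 a2 a3 a4.
move: m1' m2' m3' a1 a2 a3 a4.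
move: (X q x * _) ((X (p k j) x - X q x) * _) ((X (p k i) x - X q x) * _).
move: (psum _ k j x) (psum _ k i x) (psum _ k j x) (psum _ k i x).
move=> s1 s2 s3 s4 z1 z2 z3; rewrite !ler_norml !ltr_norml.
move=> /andP[? ?] /andP[? ?] /andP[? ?] /andP[? ?] /andP[? ?] /andP[? ?] /andP[? ?].
by apply/andP; split; lra.
Qed.

End StratonovichArrays.

(** * From fixed times to uniform control of the error, then to its squares and weighted sums *)

Section StratonovichError.
Context {R : realType} {d : measure_display} {Omega : measurableType d}.
Context (P : probability Omega R) (F : R -> set (set Omega)).
Context (F_usual : usual_filtration P F).
Context (t : R) (t0 : 0 <= t) (N : nat -> nat) (p : nat -> nat -> R).
Context (gp : forall k, grid t (p k)).
Context (mesh : forall e, 0 < e -> \forall k \near \oo, forall i, p k i.+1 - p k i <= e).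
Context (I : finType) (c : I -> R) (X Y : I -> R -> Omega -> R) (Z : R -> Omega -> R).
Context (cX : forall l, cproc F (X l)) (gX : forall l, good P F (X l)).
Context (cY : forall l, cproc F (Y l)) (gY : forall l, good P F (Y l)).
Context (cZ : cproc F Z) (gZ : good P F Z).
Implicit Types (e ep eta u v q : R).

Local Notation opa := (opa P N).
Local Notation bpa := (bpa P N).
Local Notation pr := (arr_pt p).
Local Notation inc := (arr_inc p).
Local Notation mid := (arr_mid p).

(** Defect over one step of the trapezoidal rule for [dZ = \sum_l c_l X_l o dY_l]. The times are
    arbitrary because a partition cut at [q] ends with an incomplete step. *)
Definition serr u v x : R := (Z v x - Z u x) -
  \sum_l c l * (2^-1 * (X l u x + X l v x) * (Y l v x - Y l u x)).

Definition serr_arr k i x : R := serr (p k i) (p k i.+1) x.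

Lemma serr_arrE k i x : serr_arr k i x =
  inc Z k i x - \sum_l c l * (mid (X l) k i x * inc (Y l) k i x).
Proof. by []. Qed.

Lemma diag_small_serr : diag_small P t serr.
Proof.
rewrite (_ : serr = fun u v x => (Z v x - Z u x) + -1 *
  \sum_l c l * (2^-1 * (X l u x + X l v x) * (Y l v x - Y l u x))); last first.
  by apply/funext => u; apply/funext => v; apply/funext => x; rewrite mulN1r.
apply: diag_smallD; first exact: (diag_small_incr F_usual t0).
apply: diag_smallZ; apply: diag_small_sum => l; apply: diag_smallZ.
exact: (diag_small_mid F_usual t0).
Qed.

Lemma psum_serr k j x : psum serr_arr k j x = (Z (p k j) x - Z (p k 0%N) x) +
  \sum_l - c l * psum (fun k i x => mid (X l) k i x * inc (Y l) k i x) k j x.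
Proof.
elim: j => [|j IH].
  by rewrite psum0 subrr add0r big1// => l _; rewrite psum0 mulr0.
rewrite psumS IH serr_arrE /arr_inc.
under [X in _ = _ + X]eq_bigr do rewrite psumS mulrDr.
rewrite big_split/=.
under [X in _ = _ + (_ + X)]eq_bigr do rewrite mulNr.
by rewrite sumrN; ring.
Qed.

Lemma cell_small_serr : cell_small P N p (psum serr_arr).
Proof.
apply: (cell_small_ext psum_serr); apply: cell_smallD.
  apply: (cell_small_ext (Z := fun k i x => pr Z k i x + -1 * Z (p k 0%N) x)).
    by move=> k i x; rewrite mulN1r.
  apply: cell_smallD; first exact: (cell_small_pr F_usual t0).
  apply: cell_smallZ => e ep e0 ep0; exists 1 => // eta _ _; apply: nearW => k.
  exists set0; split => //; first by rewrite measure0 lee_fin ltW.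
  by move=> x _ c' i j _ _ _ _; rewrite subrr normr0 ltW.
apply: cell_small_sum => l; apply: cell_smallZ.
exact: (cell_small_mid F_usual t0).
Qed.

Definition op1 (f : nat -> Omega -> R) := forall e ep, 0 < e -> 0 < ep ->
  \forall k \near \oo, exists B, [/\ measurable B, (P B <= ep%:E)%E &
    forall x, ~ B x -> `|f k x| < e].

Lemma op1D f g : op1 f -> op1 g -> op1 (fun k x => f k x + g k x).
Proof.
move=> hf hg e ep e0 ep0; have e2 : 0 < e / 2 by rewrite divr_gt0.
have ep2 : 0 < ep / 2 by rewrite divr_gt0.
move: (hf _ _ e2 ep2) (hg _ _ e2 ep2); apply: filterS2 => k [B1 [m1 P1 h1]] [B2 [m2 P2 h2]].
have [mU PU] := exc_setU m1 m2 P1 P2; exists (B1 `|` B2); split => // x xU.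
have [x1 x2] := notU xU.
by rewrite [e]splitr (le_lt_trans (ler_normD _ _))// ltrD// ?h1 ?h2.
Qed.

Lemma op1B f g : op1 f -> op1 g -> op1 (fun k x => f k x - g k x).
Proof.
move=> hf hg; apply: op1D => // e ep e0 ep0; move: (hg e ep e0 ep0).
by apply: filterS => k [B [mB PB hB]]; exists B; split => // x Bx; rewrite normrN hB.
Qed.

Lemma op1_fin M (f : nat -> nat -> Omega -> R) : (forall m, (m < M)%N -> op1 (f m)) ->
  forall e ep, 0 < e -> 0 < ep -> \forall k \near \oo,
  exists B, [/\ measurable B, (P B <= ep%:E)%E &
    forall x, ~ B x -> forall m, (m < M)%N -> `|f m k x| < e].
Proof.
elim: M => [|M IH] hf e ep e0 ep0.
  by apply: nearW => k; exists set0; split => //; rewrite measure0 lee_fin ltW.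
have ep2 : 0 < ep / 2 by rewrite divr_gt0.
have hM : forall m, (m < M)%N -> op1 (f m) by move=> m mM; apply: hf; exact: ltnW.
move: (IH hM _ _ e0 ep2) (hf M (ltnSn M) _ _ e0 ep2).
apply: filterS2 => k [B1 [m1 P1 h1]] [B2 [m2 P2 h2]].
have [mU PU] := exc_setU m1 m2 P1 P2; exists (B1 `|` B2); split => // x xU m.
have [x1 x2] := notU xU; rewrite ltnS leq_eqVlt => /orP[/eqP ->|mM]; first exact: h2.
exact: h1.
Qed.

Lemma op1_serr (f : nat -> R * R) : (forall k, 0 <= (f k).1 <= t /\ 0 <= (f k).2 <= t) ->
  (forall e, 0 < e -> \forall k \near \oo, `|(f k).1 - (f k).2| <= e) ->
  op1 (fun k x => serr (f k).1 (f k).2 x).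
Proof.
move=> hf fsm e ep e0 ep0; have e2 : 0 < e / 2 by rewrite divr_gt0.
have [eta eta0 [B [mB PB hB]]] := diag_small_serr e2 ep0.
move: (fsm _ eta0); apply: filterS => k hk; exists B; split => // x Bx.
have [/andP[u0 ut] /andP[v0 vt]] := hf k.
by apply: (@le_lt_trans _ _ (e / 2)); [exact: hB|lra].
Qed.

(* Convergence at fixed times, along partitions of [[0, q]] whose last point
   before [q] is [p k (b k)]. *)
Context (fixed : forall q, 0 < q -> q <= t -> exists b : nat -> nat,
  (forall k, [/\ (b k < N k)%N, p k (b k) < q & q <= p k (b k).+1]) /\
  op1 (fun k x => psum serr_arr k (b k) x + serr (p k (b k)) q x)).

(** The incomplete step ending at [q] is replaced by the full step across [q]; both defects vanish
    with the mesh by [diag_small_serr]. The index obtained is that of the first partition point at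
    or after [q]. *)
Lemma op1_before q : 0 <= q -> q <= t -> exists b : nat -> nat,
  (forall k, [/\ (b k <= N k)%N, q <= p k (b k) &
     forall i, q <= p k i -> (b k <= i)%N]) /\
  op1 (fun k x => psum serr_arr k (b k) x).
Proof.
move=> q0 qt; have [q_eq0|q_neq0] := eqVneq q 0.
  exists (fun=> 0%N); split; first by move=> k; split=> //; rewrite q_eq0 (pt_ge0 gp).
  move=> e ep e0 ep0; apply: nearW => k; exists set0; split => //.
    by rewrite measure0 lee_fin ltW.
  by move=> x _; rewrite psum0 normr0.
have qpos : 0 < q by rewrite lt_neqAle eq_sym q_neq0.
have [b [hb ob]] := fixed qpos qt; exists (fun k => (b k).+1); split.
  move=> k; have [bN pq qp] := hb k; split => // i qi; rewrite ltnNge; apply/negP => ib.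
  have := grid_mono (gp k) ib => h; have := lt_le_trans pq qi; lra.
have p0 k i : 0 <= p k i by exact: (pt_ge0 gp).
have pt k i : p k i <= t by exact: (pt_le gp).
have o1 : op1 (fun k x => serr (p k (b k)) q x).
  apply: (@op1_serr (fun k => (p k (b k), q))) => [k|e e0] /=.
    by rewrite p0 pt q0 qt.
  move: (mesh e0); apply: filterS => k hk; have [bN pq qp] := hb k.
  by have := hk (b k); rewrite distrC gtr0_norm ?subr_gt0//; lra.
have o2 : op1 (fun k x => serr (p k (b k)) (p k (b k).+1) x).
  apply: (@op1_serr (fun k => (p k (b k), p k (b k).+1))) => [k|e e0] /=.
    by rewrite !p0 !pt.
  move: (mesh e0); apply: filterS => k hk; have [bN pq qp] := hb k.
  have := hk (b k); rewrite distrC ger0_norm// subr_ge0.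
  exact: (pt_leS gp).
have := op1D (op1B ob o1) o2.
congr op1; apply/funext => k; apply/funext => x.
by rewrite psumS /serr_arr; ring.
Qed.

(** Control at the finitely many times [m * eta] extends to all partition points because partial
    sums vary little inside a cell. The width [eta] is fixed before [k] tends to infinity, so the
    number [M] of cells is fixed too. *)
Lemma opa_serr : opa (psum serr_arr).
Proof.
move=> e ep e0 ep0; have e2 : 0 < e / 2 by rewrite divr_gt0.
have ep2 : 0 < ep / 2 by rewrite divr_gt0.
have [eta eta0 hcell] := cell_small_serr e2 ep2.
have {}hcell := hcell eta eta0 (lexx _).
pose M := (Num.truncn (t / eta)).+1.
have cellt m : (m < M)%N -> m%:R * eta <= t.
  move=> mM; rewrite -ler_pdivlMr//; apply: (@le_trans _ _ (Num.truncn (t / eta))%:R).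
    by rewrite ler_nat.
  by rewrite truncn_le; apply: divr_ge0 => //; exact: ltW.
have ex m : exists b : nat -> nat, (m < M)%N -> 
  (forall k, [/\ (b k <= N k)%N, m%:R * eta <= p k (b k) &
     forall i, m%:R * eta <= p k i -> (b k <= i)%N]) /\
  op1 (fun k x => psum serr_arr k (b k) x).
  have [mM|mM] := ltnP m M; last by exists (fun=> 0%N).
  have m0 : 0 <= m%:R * eta by rewrite mulr_ge0// ltW.
  by have [b hb] := op1_before m0 (cellt m mM); exists b.
have [b hb] := choice ex.
have ob m : (m < M)%N -> op1 (fun k x => psum serr_arr k (b m k) x).
  by move=> mM; have [_] := hb m mM.
have := op1_fin ob e2 ep2.
move: hcell; apply: filterS2 => k [B1 [m1 P1 h1]] [B2 [m2 P2 h2]].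
have [mU PU] := exc_setU m1 m2 P1 P2; exists (B1 `|` B2); split => // x xU i iN.
have [x1 x2] := notU xU.
pose m := Num.truncn (p k i / eta).
have pi0 : 0 <= p k i by exact: (pt_ge0 gp).
have mM : (m < M)%N.
  rewrite ltnS; apply: le_truncn; rewrite ler_pM2r ?invr_gt0//; exact: (pt_le gp).
have mi : m%:R * eta <= p k i.
  rewrite -ler_pdivlMr// truncn_le; apply: divr_ge0 => //; exact: ltW.
have im : p k i < m.+1%:R * eta by rewrite -ltr_pdivrMr//; exact: truncnS_gt.
have [/(_ k)[bN mb bi] _] := hb m mM.
have d1 := h1 x x1 m (b m k) i (bi i mi) iN mb im.
have d2 := h2 x x2 m mM.
rewrite (_ : psum serr_arr k i x = (psum serr_arr k i x - psum serr_arr k (b m k) x)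
  + psum serr_arr k (b m k) x); last by rewrite subrK.
by rewrite [e]splitr (le_lt_trans (ler_normD _ _))// ler_ltD.
Qed.

Lemma Fm_psum_serr : arr_adapted F p (psum serr_arr).
Proof.
move=> k i; apply: Fm_sum => j.
have [p0 _ _] := gp k.
have pj : p k j <= p k i by apply: (grid_mono (gp k)); exact: ltnW.
have pj1 : p k j.+1 <= p k i by exact: (grid_mono (gp k)).
have m (W : R -> Omega -> R) q : cproc F W -> 0 <= q -> q <= p k i -> Fm F (p k i) (W q).
  by move=> cW q0 qi; apply: (Fm_mono F_usual q0 qi); exact: (cproc_Fm F_usual cW).
apply: FmB; first by apply: FmB; exact: m.
apply: Fm_sum => l; apply: FmZ; apply: FmM; last by apply: FmB; exact: m.
by apply: FmZ; apply: FmD; exact: m.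
Qed.

(** With [u] the partial sums of the errors [e], the sum of squares is [u_j ^ 2 - 2 \sum_i u_i e_i].
    Expanding [e_i] turns the last sum into elementary integrals with integrands [u] and [u X_l],
    and sums of [u dX_l dY_l]; all are small since [u] is small and adapted. *)
Lemma opa_serr_sqr : opa (psum (fun k i x => serr_arr k i x ^+ 2)).
Proof.
have ou := opa_serr; have au := Fm_psum_serr.
have o1 := opa_gsum F_usual t0 gp cZ gZ au ou.
have o2 l : opa (psum (fun k i x => (psum serr_arr k i x * pr (X l) k i x) * inc (Y l) k i x)).
  apply: (opa_gsum F_usual t0 gp) => //.
    by move=> k i; apply: FmM; [exact: au|exact: (adapted_pr F_usual gp)].
  by apply: (opaM ou); exact: (bpa_pr F_usual t0 _ gp (cX l)).
have o3 l : opa (psum (fun k i x => psum serr_arr k i x * (inc (X l) k i x * inc (Y l) k i x))).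
  exact: (opa_third F_usual t0 gp).
have o4 := opaB o1 (opa_sum (index_enum I)
  (fun l => opaZ (c l) (opaD (o2 l) (opaZ 2^-1 (o3 l))))).
have o5 := opaB (opaM ou (opa_bpa ou)) (opaZ 2 o4).
apply: (opa_ext o5) => k j x _.
have E : psum (fun k i x => psum serr_arr k i x * serr_arr k i x) k j x =
  psum (fun k i x => psum serr_arr k i x * inc Z k i x) k j x -
  \sum_l c l * (psum (fun k i x => (psum serr_arr k i x * pr (X l) k i x) * inc (Y l) k i x) k j x
   + 2^-1 * psum (fun k i x => psum serr_arr k i x * (inc (X l) k i x * inc (Y l) k i x)) k j x).
  elim: j => [|j IH].
    rewrite !psum0 big1 ?subr0// => l _.
    by rewrite !psum0 mulr0 addr0 mulr0.
  rewrite !psumS IH serr_arrE.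
  under [X in _ = _ - X]eq_bigr do rewrite !psumS.
  set u := psum serr_arr k j x.
  rewrite mulrBr mulr_sumr.
  rewrite [X in _ = _ - X](_ : _ = \sum_l (c l *
    (psum (fun k i x => (psum serr_arr k i x * pr (X l) k i x) * inc (Y l) k i x) k j x
   + 2^-1 * psum (fun k i x => psum serr_arr k i x * (inc (X l) k i x * inc (Y l) k i x)) k j x)
   + u * (c l * (mid (X l) k j x * inc (Y l) k j x)))).
    by rewrite big_split/=; ring.
  apply: eq_bigr => l _; rewrite -/u /arr_mid /arr_inc /arr_pt; by field.
rewrite -E; elim: j {E} => [|j IH]; first by rewrite !psum0; ring.
by rewrite !psumS IH; ring.
Qed.

Lemma opa_serr_CS w : bpa (psum (fun k i x => w k i x ^+ 2)) ->
  opa (psum (fun k i x => w k i x * serr_arr k i x)).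
Proof.
move=> hw; apply: (opa_ext (opa_psum_CS opa_serr_sqr hw)) => k j x _.
by apply: eq_bigr => i _; exact: mulrC.
Qed.

(** Abel summation: [\sum_i H_i e_i = H_j u_j - \sum_i u_i dH_i - \sum_i dH_i e_i]. The last sum is
    treated by Cauchy-Schwarz, the one before as an elementary integral of a small integrand. *)
Lemma opa_serr_pr H : cproc F H -> good P F H ->
  opa (psum (fun k i x => pr H k i x * serr_arr k i x)).
Proof.
move=> cH gH; have ou := opa_serr.
have o1 := opaM ou (bpa_pr F_usual t0 N gp cH).
have o2 := opa_gsum F_usual t0 gp cH gH Fm_psum_serr ou.
have o3 := opa_serr_CS (bpa_qv F_usual t0 N gp cH gH).
apply: (opa_ext (opaB (opaB o1 o2) o3)) => k j x _.
elim: j => [|j IH]; first by rewrite !psum0; ring.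
by rewrite !psumS IH /arr_pt /arr_inc; ring.
Qed.

End StratonovichError.

(** * Points of a partition and its restriction to a shorter interval *)

Section PartitionPoints.
Context {R : realType}.
Implicit Types (s : seq R) (t q e : R).

(** The default value [t] continues the partition by its endpoint, which makes it a [grid].
    Stratonovich sums are written with default 0, which agrees up to the last point. *)
Definition ppt t s i : R := nth t (0 :: s) i.

Lemma ppt_nth0 t s i : (i <= size s)%N -> ppt t s i = nth 0 (0 :: s) i.
Proof. by move=> h; apply: set_nth_default. Qed.

Lemma ppt0 t s : ppt t s 0 = 0. Proof. by []. Qed.

Lemma ppt_size t s : itv_partition 0 t s -> ppt t s (size s) = t.
Proof. by move=> [_ /eqP]; rewrite (last_nth t). Qed.

Lemma ppt_big t s i : itv_partition 0 t s -> (size s <= i)%N -> ppt t s i = t.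
Proof.
move=> hs; rewrite leq_eqVlt => /orP[/eqP <-|h]; first exact: ppt_size.
by rewrite /ppt nth_default.
Qed.

Lemma ppt_leS t s i : itv_partition 0 t s -> ppt t s i <= ppt t s i.+1.
Proof.
move=> hs; have [h|h] := ltnP i (size s).
  by have [/(pathP t)/(_ i h)/ltW] := hs.
by rewrite !(ppt_big hs)// (leq_trans h).
Qed.

Lemma ppt_mono t s i j : itv_partition 0 t s -> (i <= j)%N -> ppt t s i <= ppt t s j.
Proof.
move=> hs; elim: j => [|j IH]; first by rewrite leqn0 => /eqP ->.
rewrite leq_eqVlt => /orP[/eqP ->//|]; rewrite ltnS => /IH h.
exact: le_trans (ppt_leS _ hs).
Qed.

Lemma ppt_grid t s : itv_partition 0 t s -> grid t (ppt t s).
Proof.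
move=> hs; split => i.
- by rewrite -[leLHS](ppt0 t s) ppt_mono.
- rewrite -[leRHS](ppt_big hs (leq_maxl (size s) i)); apply: ppt_mono => //.
  exact: leq_maxr.
- exact: ppt_leS.
Qed.

Lemma ppt_mesh t s e : itv_partition 0 t s -> 0 <= e -> mesh_le s e ->
  forall i, ppt t s i.+1 - ppt t s i <= e.
Proof.
move=> hs e0 hm i; have [h|h] := ltnP i (size s).
  by rewrite !ppt_nth0//; [exact: hm|exact: ltnW].
by rewrite !(ppt_big hs) ?subrr// (leq_trans h).
Qed.

(** As an index into [s] this is the first point at or after [q]; as an index into [0 :: s], shifted
    by one, it is the last point before [q]. *)
Definition pbefore s q := find (fun y => q <= y) s.
Definition pcut s q := rcons (take (pbefore s q) s) q.

Section Cut.
Context (t q : R) (s : seq R) (hs : itv_partition 0 t s) (q0 : 0 < q) (qt : q <= t).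

Lemma pbefore_has : has (fun y => q <= y) s.
Proof.
have st : last 0 s = t by have [_ /eqP] := hs.
case: s st => [|y s'] h; first by move: q0 qt; rewrite -h /=; lra.
by apply/hasP; exists t => //; have := mem_last y s'; rewrite -[last y s']/(last 0 (y :: s')) h.
Qed.

Lemma pbefore_lt : (pbefore s q < size s)%N.
Proof. by rewrite -has_find pbefore_has. Qed.

Lemma ppt_pbefore_lt i : (i <= pbefore s q)%N -> ppt t s i < q.
Proof.
case: i => [|i] // ib; rewrite /ppt /=.
by have := before_find t ib => /negbT; rewrite -ltNge.
Qed.

Lemma ppt_pbefore_ge : q <= ppt t s (pbefore s q).+1.
Proof. exact: (nth_find t pbefore_has). Qed.

Lemma size_pcut : size (pcut s q) = (pbefore s q).+1.
Proof. by rewrite size_rcons size_take pbefore_lt. Qed.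

Lemma nth_pcut i : (i <= pbefore s q)%N -> nth 0 (0 :: pcut s q) i = ppt t s i.
Proof.
move=> ib; rewrite ppt_nth0; last by rewrite (leq_trans ib)// ltnW// pbefore_lt.
case: i ib => [|i] ib //=.
by rewrite nth_rcons size_take pbefore_lt ib nth_take.
Qed.

Lemma nth_pcut_last : nth 0 (0 :: pcut s q) (pbefore s q).+1 = q.
Proof. by rewrite /= nth_rcons size_take pbefore_lt ltnn eqxx. Qed.

Lemma pcut_partition : itv_partition 0 q (pcut s q).
Proof.
split; last by rewrite last_rcons.
apply/(pathP 0) => i; rewrite size_pcut ltnS => ib.
have e1 := nth_pcut ib.
rewrite -[nth 0 (pcut s q) i]/(nth 0 (0 :: pcut s q) i.+1) e1.
move: ib; rewrite leq_eqVlt => /orP[/eqP ->|ib].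
  by rewrite nth_pcut_last ppt_pbefore_lt.
rewrite nth_pcut//; have [/(pathP t) hp _] := hs; apply: hp.
exact: ltn_trans ib pbefore_lt.
Qed.

Lemma pcut_mesh e : mesh_le s e -> mesh_le (pcut s q) e.
Proof.
move=> hm i; rewrite size_pcut ltnS => ib; rewrite (nth_pcut ib).
have isz : (i < size s)%N by exact: leq_ltn_trans ib pbefore_lt.
have := hm i isz; rewrite -(ppt_nth0 t isz) -(ppt_nth0 t (ltnW isz)).
apply: le_trans; rewrite lerD2r.
move: ib; rewrite leq_eqVlt => /orP[/eqP ->|ib].
  by rewrite nth_pcut_last ppt_pbefore_ge.
by rewrite nth_pcut.
Qed.

End Cut.

End PartitionPoints.

(** * Convergence of Stratonovich sums at fixed times, expressed through errors *)

Section FixedTimes.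
Context {R : realType} {d : measure_display} {Omega : measurableType d}.
Context (P : probability Omega R) (F : R -> set (set Omega)).
Context (F_usual : usual_filtration P F).
Implicit Types (e ep t q : R).

Lemma op1_of_cvg (Y : nat -> Omega -> R) (Z : Omega -> R) :
  (forall k, measurable_fun setT (Y k)) -> measurable_fun setT Z ->
  cvg_in_probability P Y Z -> op1 P (fun k x => Y k x - Z x).
Proof.
move=> mY mZ h e ep e0 ep0.
have /fine_cvgP[_ /cvgrPdist_le/(_ ep ep0)] := h e e0.
apply: filterS => k; rewrite sub0r normrN /= => hk.
have mE : measurable [set x | (e <= `|Y k x - Z x|)%R].
  by apply: meas_ge; exact: measurable_funB.
exists [set x | (e <= `|Y k x - Z x|)%R]; split => //; last first.
  by move=> x /negP; rewrite -ltNge.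
rewrite -[leLHS]fineK ?lee_fin; first exact: le_trans (ler_norm _) hk.
by rewrite ge0_fin_numE// (le_lt_trans (probability_le1 _ mE))// ltry.
Qed.

Lemma cvg_of_op1 (Y : nat -> Omega -> R) (Z : Omega -> R) :
  (forall k, measurable_fun setT (Y k)) -> measurable_fun setT Z ->
  op1 P (fun k x => Y k x - Z x) -> cvg_in_probability P Y Z.
Proof.
move=> mY mZ h e e0; apply/fine_cvgP; split.
  apply: nearW => k; rewrite ge0_fin_numE// (@le_lt_trans _ _ 1%E)// ?ltry//.
  by apply: probability_le1; apply: meas_ge; exact: measurable_funB.
apply/cvgrPdist_le => ep ep0; move: (h e ep e0 ep0).
apply: filterS => k [B [mB PB hB]]; rewrite sub0r normrN /= ger0_norm ?fine_ge0//.
have mE : measurable [set x | (e <= `|Y k x - Z x|)%R].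
  by apply: meas_ge; exact: measurable_funB.
rewrite -lee_fin fineK; last first.
  by rewrite ge0_fin_numE// (le_lt_trans (probability_le1 _ mE))// ltry.
apply: le_trans PB; apply: prob_mono => // x /= hx; apply: contrapT => /hB.
by rewrite ltNge hx.
Qed.

Lemma op1_ae (f g : nat -> Omega -> R) : op1 P f ->
  {ae P, forall x k, g k x = f k x} -> op1 P g.
Proof.
move=> hf [A [mA PA hA]] e ep e0 ep0; move: (hf e ep e0 ep0).
apply: filterS => k [B [mB PB hB]]; exists (B `|` A); split.
- exact: measurableU.
- apply: (le_trans (measureU2 _ mB mA)).
  rewrite -[leRHS]adde0 leeD// le_eqVlt; apply/orP; left; apply/eqP.
  exact: PA.
move=> x xU; have [xB xA] : ~ B x /\ ~ A x.
  by split=> hx; apply: xU; [left|right].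
have gf : forall k, g k x = f k x.
  by apply: contrapT => hn; apply: xA; apply: hA => /= h; apply: hn.
by rewrite gf; exact: hB.
Qed.

(* The Stratonovich sums of [\sum_l c l X_l dY_l] and their limit [Z], with
   regularized versions [X'], [Y'], [Z'] of the processes. *)
Lemma strat_fixed (I : finType) (c : I -> R) (X Y X' Y' : I -> R -> Omega -> R)
    (Z Z' : R -> Omega -> R) (S : seq R -> Omega -> R) t (s : nat -> seq R) :
  (forall l, adapted F (X l)) -> (forall l, adapted F (Y l)) -> adapted F Z ->
  (forall r x, S r x = \sum_(0 <= i < size r) \sum_l c l *
     (2^-1 * (X l (nth 0 (0 :: r) i) x + X l (nth 0 (0 :: r) i.+1) x) *
      (Y l (nth 0 (0 :: r) i.+1) x - Y l (nth 0 (0 :: r) i) x))) ->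
  (forall q, 0 <= q -> forall r : nat -> seq R,
     (forall k, itv_partition 0 q (r k)) ->
     (forall e : R, 0 < e -> \forall k \near \oo, mesh_le (r k) e) ->
     cvg_in_probability P (fun k => S (r k)) (fun x => Z q x - Z 0 x)) ->
  {ae P, forall x l q, 0 <= q -> X' l q x = X l q x /\ Y' l q x = Y l q x} ->
  {ae P, forall x q, 0 <= q -> Z' q x = Z q x} ->
  (forall k, itv_partition 0 t (s k)) ->
  (forall e : R, 0 < e -> \forall k \near \oo, mesh_le (s k) e) ->
  forall q, 0 < q -> q <= t -> exists b : nat -> nat,
  (forall k, [/\ (b k < size (s k))%N, ppt t (s k) (b k) < q & q <= ppt t (s k) (b k).+1]) /\
  op1 P (fun k x => psum (serr_arr (fun k => ppt t (s k)) c X' Y' Z') k (b k) x +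
     serr c X' Y' Z' (ppt t (s k) (b k)) q x).
Proof.
move=> aX aY aZ SE hcv hXY hZ hs hm q q0 qt.
exists (fun k => pbefore (s k) q); split.
  move=> k; split; first exact: (pbefore_lt (hs k) q0 qt).
    exact: (ppt_pbefore_lt t q0).
  exact: (ppt_pbefore_ge (hs k) q0 qt).
have hr k := pcut_partition (hs k) q0 qt.
have hrm e : 0 < e -> \forall k \near \oo, mesh_le (pcut (s k) q) e.
  by move=> /hm; apply: filterS => k; exact: (pcut_mesh (hs k) q0 qt).
have mp (W : R -> Omega -> R) u : adapted F W -> 0 <= u -> measurable_fun setT (W u).
  by move=> /(adaptedP F_usual) h u0; apply: (Fm_meas F_usual u0); exact: h.
have gr k : grid q (ppt q (pcut (s k) q)) by exact: ppt_grid.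
have mS k : measurable_fun setT (S (pcut (s k) q)).
  rewrite (_ : S _ = fun x => \sum_(0 <= i < size (pcut (s k) q)) \sum_l c l *
     (2^-1 * (X l (ppt q (pcut (s k) q) i) x + X l (ppt q (pcut (s k) q) i.+1) x) *
      (Y l (ppt q (pcut (s k) q) i.+1) x - Y l (ppt q (pcut (s k) q) i) x))).
    have [p0 _ _] := gr k.
    apply: measurable_sum => i; apply: measurable_sum => l.
    apply: measurable_funM => //; apply: measurable_funM.
      by apply: measurable_funM => //; apply: measurable_funD; exact: mp.
    by apply: measurable_funB; exact: mp.
  apply/funext => x; rewrite SE !big_nat; apply: eq_bigr => i /andP[_ ir].
  by apply: eq_bigr => l _; rewrite !ppt_nth0// ltnW.
have mZ : measurable_fun setT (fun x => Z q x - Z 0 x).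
  by apply: measurable_funB; apply: mp => //; exact: ltW.
have o := op1_of_cvg mS mZ (hcv q (ltW q0) _ hr hrm).
have o0 : op1 P (fun _ _ => 0).
  move=> e ep e0 ep0; apply: nearW => k; exists set0; split => //.
    by rewrite measure0 lee_fin ltW.
  by move=> x _; rewrite normr0.
apply: op1_ae (op1B o0 o) _.
move: hXY hZ; apply: filterS2 => x hx hz k.
have [p0 _ _] := ppt_grid (hs k).
have szc := size_pcut (hs k) q0 qt.
(* The sum along the cut partition consists of the full steps up to the last point before [q] and of
   one incomplete step ending at [q]. *)
have E : S (pcut (s k) q) x = \sum_(i < pbefore (s k) q) (\sum_l c l *
     (2^-1 * (X' l (ppt t (s k) i) x + X' l (ppt t (s k) i.+1) x) *
      (Y' l (ppt t (s k) i.+1) x - Y' l (ppt t (s k) i) x))) +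
   \sum_l c l * (2^-1 * (X' l (ppt t (s k) (pbefore (s k) q)) x + X' l q x) *
      (Y' l q x - Y' l (ppt t (s k) (pbefore (s k) q)) x)).
  rewrite SE szc big_mkord big_ord_recr/=; congr (_ + _).
    apply: eq_bigr => i _; apply: eq_bigr => l _.
    have := nth_pcut (hs k) q0 qt (ltnW (ltn_ord i)) => /= ->.
    have := nth_pcut (hs k) q0 qt (ltn_ord i) => /= ->.
    by have [-> ->] := hx l _ (p0 i); have [-> ->] := hx l _ (p0 i.+1).
  apply: eq_bigr => l _.
  have := nth_pcut (hs k) q0 qt (leqnn _) => /= ->.
  have := nth_pcut_last (hs k) q0 qt => /= ->.
  by have [-> ->] := hx l _ (p0 (pbefore (s k) q)); have [-> ->] := hx l _ (ltW q0).
have EZ j : \sum_(i < j) (Z' (ppt t (s k) i.+1) x - Z' (ppt t (s k) i) x) =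
   Z' (ppt t (s k) j) x - Z' 0 x.
  have := telescope_sumr (fun i => Z' (ppt t (s k) i) x) (leq0n j).
  by rewrite big_mkord.
rewrite E /psum /serr_arr /serr sumrB EZ.
by rewrite -!hz//; [ring|exact: ltW].
Qed.

End FixedTimes.

(** * Quaternions *)

Section QuaternionAlgebra.
Context {R : realType}.
Implicit Types (p q : quat R) (j : 'I_4).

Lemma sum_quat (V : nmodType) (f : 'I_4 -> V) :
  \sum_b f b = f (inord 0) + f (inord 1) + f (inord 2) + f (inord 3).
Proof.
rewrite !big_ord_recl big_ord0 addr0 !addrA.
by congr (f _ + f _ + f _ + f _); apply/val_inj; rewrite /= inordK.
Qed.

Lemma quat_ind (Q : 'I_4 -> Prop) : Q (inord 0) -> Q (inord 1) -> Q (inord 2) ->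
  Q (inord 3) -> forall j, Q j.
Proof.
move=> h0 h1 h2 h3 [[|[|[|[|//]]]] hj].
- by rewrite (_ : Ordinal hj = inord 0)//; apply/val_inj; rewrite /= inordK.
- by rewrite (_ : Ordinal hj = inord 1)//; apply/val_inj; rewrite /= inordK.
- by rewrite (_ : Ordinal hj = inord 2)//; apply/val_inj; rewrite /= inordK.
- by rewrite (_ : Ordinal hj = inord 3)//; apply/val_inj; rewrite /= inordK.
Qed.

Lemma mkquatE (a b c e : R) :
  ((mkquat a b c e ord0 (inord 0) = a) * (mkquat a b c e ord0 (inord 1) = b) *
   (mkquat a b c e ord0 (inord 2) = c) * (mkquat a b c e ord0 (inord 3) = e))%type.
Proof. by rewrite !mxE !inordK. Qed.

Lemma qmulE0 p q : qmul p q = mkquat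
  (p ord0 (inord 0) * q ord0 (inord 0) - p ord0 (inord 1) * q ord0 (inord 1) -
   p ord0 (inord 2) * q ord0 (inord 2) - p ord0 (inord 3) * q ord0 (inord 3))
  (p ord0 (inord 0) * q ord0 (inord 1) + p ord0 (inord 1) * q ord0 (inord 0) +
   p ord0 (inord 2) * q ord0 (inord 3) - p ord0 (inord 3) * q ord0 (inord 2))
  (p ord0 (inord 0) * q ord0 (inord 2) - p ord0 (inord 1) * q ord0 (inord 3) +
   p ord0 (inord 2) * q ord0 (inord 0) + p ord0 (inord 3) * q ord0 (inord 1))
  (p ord0 (inord 0) * q ord0 (inord 3) + p ord0 (inord 1) * q ord0 (inord 2) -
   p ord0 (inord 2) * q ord0 (inord 1) + p ord0 (inord 3) * q ord0 (inord 0)).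
Proof. by []. Qed.

(** Structure constants of the product in the basis 1, I, J, K. They bring quaternionic forms to the
    scalar shape [\sum_l c_l X_l o dY_l] to which [serr] applies. *)
Definition qc (a b j : 'I_4) : R := qmul (delta_mx 0 a) (delta_mx 0 b) 0 j.

Lemma delta_quat (k l : nat) : (k < 4)%N -> (l < 4)%N ->
  (delta_mx 0 (inord k) : quat R) ord0 (inord l) = (l == k)%:R.
Proof. by move=> k4 l4; rewrite mxE eqxx /= -(inj_eq val_inj) /= !inordK. Qed.

Lemma qmulE p q j :
  qmul p q 0 j = \sum_a \sum_b qc a b j * (p 0 a * q 0 b).
Proof.
rewrite sum_quat !sum_quat /qc !qmulE0 !delta_quat//=.
by elim/quat_ind: j; rewrite !mkquatE; ring.
Qed.

Definition qsg (b : 'I_4) : R := if b == inord 0 then 1 else - 1.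

Lemma qconjE q j : qconj q 0 j = qsg j * q 0 j.
Proof.
by elim/quat_ind: j; rewrite /qconj /qcoord mkquatE /qsg -val_eqE /= !inordK//=; ring.
Qed.

Lemma qmul_sum (I : Type) (r : seq I) (f : I -> quat R) p :
  qmul p (\sum_(i <- r) f i) = \sum_(i <- r) qmul p (f i).
Proof.
apply/rowP => j; rewrite qmulE summxE.
under [RHS]eq_bigr do rewrite qmulE.
rewrite [RHS]exchange_big/=; apply: eq_bigr => a _; rewrite [RHS]exchange_big/=.
by apply: eq_bigr => b _; rewrite summxE !mulr_sumr.
Qed.

Lemma qmul_suml (I : Type) (r : seq I) (f : I -> quat R) p :
  qmul (\sum_(i <- r) f i) p = \sum_(i <- r) qmul (f i) p.
Proof.
apply/rowP => j; rewrite qmulE summxE.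
under [RHS]eq_bigr do rewrite qmulE.
rewrite [RHS]exchange_big/=; apply: eq_bigr => a _; rewrite [RHS]exchange_big/=.
by apply: eq_bigr => b _; rewrite summxE mulr_suml mulr_sumr.
Qed.

Lemma qmulA p q r : qmul p (qmul q r) = qmul (qmul p q) r.
Proof. by apply/rowP; elim/quat_ind; rewrite !qmulE0 !mkquatE; ring. Qed.

Lemma qconjM p q : qconj (qmul p q) = qmul (qconj q) (qconj p).
Proof.
by apply/rowP; elim/quat_ind; rewrite !qmulE0 !mkquatE /qconj /qcoord !mkquatE; ring.
Qed.

Lemma qconj_sum (I : Type) (r : seq I) (f : I -> quat R) :
  qconj (\sum_(i <- r) f i) = \sum_(i <- r) qconj (f i).
Proof.
apply/rowP => j; rewrite qconjE !summxE mulr_sumr.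
by apply: eq_bigr => i _; rewrite qconjE.
Qed.

Lemma qconjK : involutive (@qconj R).
Proof. by move=> q; apply/rowP; elim/quat_ind; rewrite /qconj /qcoord !mkquatE ?opprK. Qed.

Lemma qmulZl (c : R) p q : qmul (c *: p) q = c *: qmul p q.
Proof. by apply/rowP; elim/quat_ind; rewrite [RHS]mxE !qmulE0 !mkquatE !mxE; ring. Qed.

Lemma qmulZr (c : R) p q : qmul p (c *: q) = c *: qmul p q.
Proof. by apply/rowP; elim/quat_ind; rewrite [RHS]mxE !qmulE0 !mkquatE !mxE; ring. Qed.

Lemma qconjZ (c : R) p : qconj (c *: p) = c *: qconj p.
Proof. by apply/rowP => j; rewrite [RHS]mxE !qconjE [in LHS]mxE; ring. Qed.

Lemma qmul1q q : qmul qone q = q.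
Proof. by apply/rowP; elim/quat_ind; rewrite !qmulE0 !mkquatE; ring. Qed.

Lemma hnorm2_quat q : hnorm2 q = \sum_j q 0 j ^+ 2.
Proof. by rewrite /hnorm2 /hdot big_ord1. Qed.

Lemma hnorm2_rows m (h : hvec R m) : hnorm2 h = \sum_i hnorm2 (row i h).
Proof.
by apply: eq_bigr => i _; rewrite hnorm2_quat; apply: eq_bigr => j _; rewrite mxE expr2.
Qed.

(** Euler's four-square identity. *)
Lemma hnorm2M p q : hnorm2 (qmul p q) = hnorm2 p * hnorm2 q.
Proof. by rewrite !hnorm2_quat !sum_quat !qmulE0 !mkquatE; ring. Qed.

Lemma hnorm2_ge0 m (h : hvec R m) : 0 <= hnorm2 h.
Proof. by rewrite sumr_ge0// => i _; rewrite sumr_ge0// => j _; rewrite -expr2 sqr_ge0. Qed.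

Lemma hnorm2Z m (c : R) (h : hvec R m) : hnorm2 (c *: h) = c ^+ 2 * hnorm2 h.
Proof.
rewrite /hnorm2 /hdot mulr_sumr; apply: eq_bigr => i _; rewrite mulr_sumr.
by apply: eq_bigr => j _; rewrite !mxE; ring.
Qed.

Lemma qinvM q : hnorm2 q != 0 -> qmul (qinv q) q = qone.
Proof.
move=> q0; rewrite /qinv qmulZl.
rewrite (_ : qmul (qconj q) q = hnorm2 q *: qone) ?scalerA ?mulVf ?scale1r//.
apply/rowP; elim/quat_ind; rewrite [RHS]mxE hnorm2_quat sum_quat !qmulE0;
  by rewrite /qconj /qcoord !mkquatE; ring.
Qed.

Lemma row_hlmul m q (h : hvec R m) i : row i (hlmul q h) = qmul q (row i h).
Proof. by apply/rowP => j; rewrite !mxE. Qed.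

Lemma hnorm2_hlmul m q (h : hvec R m) : hnorm2 (hlmul q h) = hnorm2 q * hnorm2 h.
Proof.
rewrite (hnorm2_rows (hlmul _ _)) (hnorm2_rows h) mulr_sumr.
by apply: eq_bigr => i _; rewrite row_hlmul hnorm2M.
Qed.

End QuaternionAlgebra.

(** * Transfer of the estimates from regular versions to the given semimartingales *)

Section SemimartingaleArrays.
Context {R : realType} {d : measure_display} {Omega : measurableType d}.
Context (P : probability Omega R) (F : R -> set (set Omega)).
Context (F_usual : usual_filtration P F).
Implicit Types (X Y Z H : R -> Omega -> R) (A B : nat -> nat -> Omega -> R).

Local Notation semi := (cont_semimartingale P F).

Lemma opa_ae N A B : opa P N B -> {ae P, forall x k i, A k i x = B k i x} -> opa P N A.
Proof.
move=> hB [E [mE PE hE]] e ep e0 ep0; move: (hB e ep e0 ep0).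
apply: filterS => k [C [mC PC hC]]; exists (C `|` E); split.
- exact: measurableU.
- apply: (le_trans (measureU2 _ mC mE)).
  rewrite -[leRHS]adde0 leeD// le_eqVlt; apply/orP; left; apply/eqP.
  exact: PE.
move=> x xU i iN; have [xC xE] := notU xU.
have AB : forall k i, A k i x = B k i x.
  by apply: contrapT => hn; apply: xE; apply: hE => /= h; apply: hn.
by rewrite AB; exact: hC.
Qed.

Lemma bpa_ae N A B : bpa P N B -> {ae P, forall x k i, A k i x = B k i x} -> bpa P N A.
Proof.
move=> hB AB; have o : opa P N (fun k i x => A k i x - B k i x).
  apply: (opa_ae (opa0 P N)); move: AB; apply: filterS => x h k i.
  by rewrite h subrr.
apply: (bpa_ext (bpaD (opa_bpa o) hB)) => k i x _.
by rewrite subrK.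
Qed.

Section Partitions.
Context (t : R) (t0 : 0 <= t) (N : nat -> nat) (p : nat -> nat -> R).
Context (gp : forall k, grid t (p k)).
Context (mesh : forall e, 0 < e -> \forall k \near \oo, forall i, p k i.+1 - p k i <= e).

Local Notation opa := (opa P N).
Local Notation bpa := (bpa P N).
Local Notation pr := (arr_pt p).
Local Notation inc := (arr_inc p).

Lemma semimart_bpa X : semi X -> bpa (pr X).
Proof.
move=> /(semimartingale_csm F_usual)[X' [cX _] XX].
apply: (bpa_ae (bpa_pr F_usual t0 N gp cX)).
by apply: filterS XX => x h k i; rewrite /arr_pt h//; exact: (pt_ge0 gp).
Qed.

Lemma semimart_opa_inc X : semi X -> opa (inc X).
Proof.
move=> /(semimartingale_csm F_usual)[X' [cX _] XX].
apply: (opa_ae (opa_inc F_usual t0 N gp mesh cX)).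
by apply: filterS XX => x h k i; rewrite /arr_inc !h//; exact: (pt_ge0 gp).
Qed.

Lemma psum_ae A B : {ae P, forall x k i, A k i x = B k i x} ->
  {ae P, forall x k i, psum A k i x = psum B k i x}.
Proof. by apply: filterS => x h k i; apply: eq_bigr => j _; exact: h. Qed.

Lemma semimart_bpa_qv X : semi X -> bpa (psum (fun k i x => inc X k i x ^+ 2)).
Proof.
move=> /(semimartingale_csm F_usual)[X' sX XX]; have [cX _] := sX.
apply: (bpa_ae (bpa_qv F_usual t0 N gp cX (good_csm F_usual sX))).
by apply: psum_ae; apply: filterS XX => x h k i; rewrite /arr_inc !h//; exact: (pt_ge0 gp).
Qed.

Lemma semimart_opa_third A X Y : semi X -> semi Y -> opa A ->
  opa (psum (fun k i x => A k i x * (inc X k i x * inc Y k i x))).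
Proof.
move=> /(semimartingale_csm F_usual)[X' sX XX] /(semimartingale_csm F_usual)[Y' sY YY] hA.
have [cX _] := sX; have [cY _] := sY.
apply: (opa_ae (opa_third F_usual t0 gp cX (good_csm F_usual sX) cY (good_csm F_usual sY) hA)).
apply: psum_ae; apply: filterS2 XX YY => x hX hY k i.
by rewrite /arr_inc !hX ?hY//; exact: (pt_ge0 gp).
Qed.

Lemma bpa_psum_le A X : bpa A -> semi X ->
  bpa (psum (fun k i x => (A k i x * inc X k i x) ^+ 2)).
Proof.
move=> hA sX ep ep0; have ep2 : 0 < ep / 2 by rewrite divr_gt0.
have [C C0 h1] := hA _ ep2; have [D D0 h2] := semimart_bpa_qv sX ep2.
exists (C ^+ 2 * D); first by rewrite mulr_gt0// exprn_gt0.
move: h1 h2; apply: filterS2 => k [B1 [m1 P1 h1]] [B2 [m2 P2 h2]].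
have [mU PU] := exc_setU m1 m2 P1 P2; exists (B1 `|` B2); split => // x xU j jN.
have [x1 x2] := notU xU.
rewrite ger0_norm; last by apply: sumr_ge0 => i _; rewrite sqr_ge0.
apply: (@le_trans _ _ (\sum_(i < j) C ^+ 2 * inc X k i x ^+ 2)).
  apply: ler_sum => i _; rewrite exprMn ler_wpM2r ?sqr_ge0//.
  rewrite -[A k i x ^+ 2]real_normK ?num_real// lerXn2r ?nnegrE ?(ltW C0)//.
  by apply: h1 => //; rewrite ltnW// (leq_trans (ltn_ord i)).
rewrite -mulr_sumr ler_pM2l ?exprn_gt0//.
by apply: le_trans (h2 x x2 j jN); exact: ler_norm.
Qed.

End Partitions.

Section Integrals.
Context (I : finType) (c : I -> R) (X Y : I -> R -> Omega -> R) (Z : R -> Omega -> R).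
Context (S : seq R -> Omega -> R).
Context (sX : forall l, semi (X l)) (sY : forall l, semi (Y l)).
Context (SE : forall r x, S r x = \sum_(0 <= i < size r) \sum_l c l *
     (2^-1 * (X l (nth 0 (0 :: r) i) x + X l (nth 0 (0 :: r) i.+1) x) *
      (Y l (nth 0 (0 :: r) i.+1) x - Y l (nth 0 (0 :: r) i) x))).

Lemma meas_strat_sum q r : itv_partition 0 q r -> measurable_fun setT (S r).
Proof.
move=> hr; have [p0 _ _] := ppt_grid hr.
have mp W u : semi W -> 0 <= u -> measurable_fun setT (W u).
  by move=> sW u0; apply: (Fm_meas F_usual u0); exact: (semimart_Fm F_usual).
rewrite (_ : S r = fun x => \sum_(0 <= i < size r) \sum_l c l *
   (2^-1 * (X l (ppt q r i) x + X l (ppt q r i.+1) x) *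
    (Y l (ppt q r i.+1) x - Y l (ppt q r i) x))).
  apply: measurable_sum => i; apply: measurable_sum => l.
  apply: measurable_funM => //; apply: measurable_funM.
    by apply: measurable_funM => //; apply: measurable_funD; exact: mp.
  by apply: measurable_funB; exact: mp.
apply/funext => x; rewrite SE !big_nat; apply: eq_bigr => i /andP[_ ir].
by apply: eq_bigr => l _; rewrite !ppt_nth0// ltnW.
Qed.

(** At time 0 the empty partition has sum 0, so the hypothesis forces [Z 0] to be null in
    probability, and it may be subtracted. *)
Lemma strat_cvg_init : semi Z ->
  (forall q, 0 <= q -> forall r : nat -> seq R,
     (forall k, itv_partition 0 q (r k)) ->
     (forall e : R, 0 < e -> \forall k \near \oo, mesh_le (r k) e) ->
     cvg_in_probability P (fun k => S (r k)) (Z q)) ->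
  forall q, 0 <= q -> forall r : nat -> seq R,
     (forall k, itv_partition 0 q (r k)) ->
     (forall e : R, 0 < e -> \forall k \near \oo, mesh_le (r k) e) ->
     cvg_in_probability P (fun k => S (r k)) (fun x => Z q x - Z 0 x).
Proof.
move=> sZ hcv q q0 r hr hm.
have mZ u : 0 <= u -> measurable_fun setT (Z u).
  by move=> u0; apply: (Fm_meas F_usual u0); exact: (semimart_Fm F_usual).
have mS k := meas_strat_sum (hr k).
apply: cvg_of_op1 => //; first by apply: measurable_funB; exact: mZ.
have o1 := op1_of_cvg mS (mZ _ q0) (hcv q q0 r hr hm).
have h0 : itv_partition 0 0 ([::] : seq R) by [].
have m0 : measurable_fun setT (S [::]) by exact: meas_strat_sum h0.
have hm0 (e : R) : 0 < e -> \forall k \near \oo, mesh_le ([::] : seq R) e.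
  by move=> _; apply: nearW => k i.
have o2 := op1_of_cvg (fun=> m0) (mZ _ (lexx 0)) (hcv 0 (lexx 0) (fun=> [::]) (fun=> h0) hm0).
have : op1 P (fun k x => (S (r k) x - Z q x) - (S [::] x - Z 0 x)).
  exact: op1B o1 o2.
congr op1; apply/funext => k; apply/funext => x.
by rewrite [S [::] x]SE big_nil; ring.
Qed.

Context (sZ : semi Z).
Context (hcv : forall q, 0 <= q -> forall r : nat -> seq R,
     (forall k, itv_partition 0 q (r k)) ->
     (forall e : R, 0 < e -> \forall k \near \oo, mesh_le (r k) e) ->
     cvg_in_probability P (fun k => S (r k)) (fun x => Z q x - Z 0 x)).
Context (t : R) (t0 : 0 <= t) (s : nat -> seq R).
Context (hs : forall k, itv_partition 0 t (s k)).
Context (hm : forall e : R, 0 < e -> \forall k \near \oo, mesh_le (s k) e).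

Let p := fun k => ppt t (s k).
Let N := fun k => size (s k).

Lemma serr_regularized : exists (X' Y' : I -> R -> Omega -> R) (Z' : R -> Omega -> R),
  [/\ {ae P, forall x k i, serr_arr p c X Y Z k i x = serr_arr p c X' Y' Z' k i x},
   forall H, cproc F H -> good P F H ->
     opa P N (psum (fun k i x => arr_pt p H k i x * serr_arr p c X' Y' Z' k i x)) &
   forall w, bpa P N (psum (fun k i x => w k i x ^+ 2)) ->
     opa P N (psum (fun k i x => w k i x * serr_arr p c X' Y' Z' k i x))].
Proof.
have [X' hX] := choice (fun l => let: ex_intro2 X' h1 h2 := semimartingale_csm F_usual (sX l)
  in ex_intro (fun X' => csm P F X' /\ {ae P, forall x t, 0 <= t -> X' t x = X l t x})
     X' (conj h1 h2)).
have [Y' hY] := choice (fun l => let: ex_intro2 X' h1 h2 := semimartingale_csm F_usual (sY l)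
  in ex_intro (fun X' => csm P F X' /\ {ae P, forall x t, 0 <= t -> X' t x = Y l t x})
     X' (conj h1 h2)).
have [Z' cZ hZ] := semimartingale_csm F_usual sZ.
exists X', Y', Z'.
have hXY : {ae P, forall x l q, 0 <= q -> X' l q x = X l q x /\ Y' l q x = Y l q x}.
  apply: filter_forall => l; have [_ h1] := hX l; have [_ h2] := hY l.
  by apply: filterS2 h1 h2 => x h1 h2 q q0; rewrite h1// h2.
have gp k : grid t (p k) by exact: ppt_grid.
have mesh e : 0 < e -> \forall k \near \oo, forall i, p k i.+1 - p k i <= e.
  by move=> e0; apply: filterS (hm e0) => k h; apply: ppt_mesh => //; exact: ltW.
have fixed := strat_fixed F_usual (fun l => semimart_adapted (sX l))
  (fun l => semimart_adapted (sY l)) (semimart_adapted sZ) SE hcv hXY hZ hs hm.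
have cX l : cproc F (X' l) by have [[]] := hX l.
have cY l : cproc F (Y' l) by have [[]] := hY l.
have gX l : good P F (X' l) by have [h _] := hX l; exact: good_csm.
have gY l : good P F (Y' l) by have [h _] := hY l; exact: good_csm.
have gZ : good P F Z' by exact: good_csm.
split.
- apply: filterS2 hXY hZ => x h1 h2 k i; rewrite /serr_arr /serr !h2 ?(pt_ge0 gp)//.
  congr (_ - _); apply: eq_bigr => l _.
  have [-> ->] := h1 l _ (pt_ge0 gp k i).
  by have [-> ->] := h1 l _ (pt_ge0 gp k i.+1).
- exact: (opa_serr_pr F_usual t0 gp mesh cX gX cY gY cZ.1 gZ fixed).
- exact: (opa_serr_CS F_usual t0 gp mesh cX gX cY gY cZ.1 gZ fixed).
Qed.

Lemma semimart_serr_CS w : bpa P N (psum (fun k i x => w k i x ^+ 2)) ->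
  opa P N (psum (fun k i x => w k i x * serr_arr p c X Y Z k i x)).
Proof.
move=> hw; have [X' [Y' [Z' [E _ h2]]]] := serr_regularized.
apply: (opa_ae (h2 w hw)).
by apply: psum_ae; apply: filterS E => x E k i; rewrite E.
Qed.

Lemma semimart_serr_pr H : semi H ->
  opa P N (psum (fun k i x => arr_pt p H k i x * serr_arr p c X Y Z k i x)).
Proof.
move=> sH; have [X' [Y' [Z' [E h1 _]]]] := serr_regularized.
have [H' cH HH] := semimartingale_csm F_usual sH.
apply: (opa_ae (h1 H' cH.1 (good_csm F_usual cH))).
apply: psum_ae; apply: filterS2 E HH => x E HH k i; rewrite E /arr_pt HH//.
by have [h _ _] := ppt_grid (hs k); exact: h.
Qed.

End Integrals.

End SemimartingaleArrays.

(** * Algebra of one step of the connection form *)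

Section HorizontalIncrement.
Context {R : realType}.
Implicit Types (T p q h gam Da eta kap : quat R).

Lemma quatE : ((forall p q (j : 'I_4), (p + q)%R 0 j = (p 0 j + q 0 j)%R) *
  (forall p (j : 'I_4), (- p)%R 0 j = (- p 0 j)%R) *
  (forall (c : R) p (j : 'I_4), (c *: p)%R 0 j = (c * p 0 j)%R))%type.
Proof. by split; [split|]; move=> *; rewrite mxE. Qed.

Lemma quatB p q (j : 'I_4) : (p - q) 0 j = p 0 j - q 0 j.
Proof. by rewrite !mxE. Qed.

Lemma qmulDl p q h : qmul (p + q) h = qmul p h + qmul q h.
Proof.
apply/rowP => j; rewrite quatE !qmulE -big_split/=; apply: eq_bigr => a _.
by rewrite -big_split/=; apply: eq_bigr => b _; rewrite quatE; ring.
Qed.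

Lemma qmulDr p q h : qmul p (q + h) = qmul p q + qmul p h.
Proof.
apply/rowP => j; rewrite quatE !qmulE -big_split/=; apply: eq_bigr => a _.
by rewrite -big_split/=; apply: eq_bigr => b _; rewrite quatE; ring.
Qed.

Lemma qconjD p q : qconj (p + q) = qconj p + qconj q.
Proof. by apply/rowP => j; rewrite quatE !qconjE quatE; ring. Qed.

Lemma qmulNl p q : qmul (- p) q = - qmul p q.
Proof. by rewrite -scaleN1r qmulZl scaleN1r. Qed.

Lemma qmulNr p q : qmul p (- q) = - qmul p q.
Proof. by rewrite -scaleN1r qmulZr scaleN1r. Qed.

Lemma qconjN p : qconj (- p) = - qconj p.
Proof. by rewrite -scaleN1r qconjZ scaleN1r. Qed.

Lemma qmulq1 q : qmul q qone = q.
Proof. by apply/rowP; elim/quat_ind; rewrite !qmulE0 !mkquatE; ring. Qed.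

Lemma qconj1 : qconj qone = qone :> quat R.
Proof. by apply/rowP; elim/quat_ind; rewrite /qconj /qcoord !mkquatE ?oppr0. Qed.

(** Both sides are the imaginary part of [p conj(q)]: the factor [(j != inord 0)%:R] discards the
    real part, and [q conj(q)] is real. *)
Lemma im_qmul_conj p q (j : 'I_4) :
  (2^-1 *: (qmul p (qconj q) - qmul q (qconj p))) 0 j =
  (j != inord 0)%:R * qmul (p - q) (qconj q) 0 j.
Proof.
have nz (k l : nat) : (k < 4)%N -> (l < 4)%N -> ((inord k : 'I_4) == inord l) = (k == l).
  by move=> k4 l4; rewrite -(inj_eq val_inj) /= !inordK.
by elim/quat_ind: j; rewrite nz//= quatE quatB !qmulE0 !mkquatE /qconj /qcoord ?mkquatE
  !quatB; field.
Qed.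

(** The two products differ by half of [(p - q) conj(p - q)], which is real. *)
Lemma im_qmul_mid p q (j : 'I_4) :
  (j != inord 0)%:R * qmul (p - q) (qconj (2^-1 *: (q + p))) 0 j =
  (j != inord 0)%:R * qmul (p - q) (qconj q) 0 j.
Proof.
have nz (k l : nat) : (k < 4)%N -> (l < 4)%N -> ((inord k : 'I_4) == inord l) = (k == l).
  by move=> k4 l4; rewrite -(inj_eq val_inj) /= !inordK.
by elim/quat_ind: j; rewrite nz//= !(mul0r, mul1r)// !qmulE0 !mkquatE /qconj /qcoord ?mkquatE
  !quatE; field.
Qed.

(** Write [p] and [q] as their midpoint plus and minus half of their difference: the mixed terms
    cancel. *)
Lemma qmul_polar p q h :
  2^-1 *: (qmul (qmul p h) (qconj q) + qmul (qmul q h) (qconj p)) =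
  qmul (qmul (2^-1 *: (q + p)) h) (qconj (2^-1 *: (q + p)))
  - 4^-1 *: qmul (qmul (p - q) h) (qconj (p - q)).
Proof.
rewrite !(qmulZl, qconjZ, qmulZr, qmulDl, qconjD, qmulDr, qmulNl, qconjN, qmulNr).
by apply/rowP => j; rewrite !quatE; field.
Qed.

(* Splits the increment of the line integral of the connection form along
   [Theta Y], with [G = \sum_l Y'_l conj(Y_l)] of imaginary part [gam], into terms
   each of which is small when summed over a partition. *)
Lemma horizontal_increment T T' gam Da eta kap (g0 : R) (j : 'I_4) :
  gam 0 (inord 0) = 0 -> gam = Da - eta - kap ->
  (2^-1 *: (qmul (qmul T' (g0 *: qone + gam)) (qconj T) -
    qmul (qmul T (qconj (g0 *: qone + gam))) (qconj T'))) 0 j =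
  (j != inord 0)%:R *
  (qmul (T' - T + qmul (2^-1 *: (T + T')) Da) (qconj (2^-1 *: (T + T'))) 0 j
   - qmul ((1 - g0) *: (T' - T)) (qconj T) 0 j
   - qmul (qmul (2^-1 *: (T + T')) eta) (qconj (2^-1 *: (T + T'))) 0 j
   - qmul (qmul (2^-1 *: (T + T')) kap) (qconj (2^-1 *: (T + T'))) 0 j
   - 4^-1 * qmul (qmul (T' - T) gam) (qconj (T' - T)) 0 j).
Proof.
move=> gam0 gamE.
have cgam : qconj gam = - gam.
  apply/rowP => k; rewrite qconjE quatE /qsg.
  by case: eqP => [->|_]; rewrite ?gam0; ring.
have -> : 2^-1 *: (qmul (qmul T' (g0 *: qone + gam)) (qconj T) -
    qmul (qmul T (qconj (g0 *: qone + gam))) (qconj T')) =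
  g0 *: (2^-1 *: (qmul T' (qconj T) - qmul T (qconj T'))) +
  2^-1 *: (qmul (qmul T' gam) (qconj T) + qmul (qmul T gam) (qconj T')).
  rewrite qconjD qconjZ qconj1 cgam !(qmulDr, qmulZr, qmulq1, qmulNr, qmulDl, qmulZl, qmulNl).
  by apply/rowP => k; rewrite !quatE; ring.
(* The second product is minus the conjugate of the first, so their sum has no real part. *)
have im1 : (2^-1 *: (qmul (qmul T' gam) (qconj T) + qmul (qmul T gam) (qconj T'))) 0 j
  = (j != inord 0)%:R * (2^-1 *: (qmul (qmul T' gam) (qconj T) + qmul (qmul T gam) (qconj T'))) 0 j.
  have [->|_] := eqVneq j (inord 0); last by rewrite mul1r.
  have : qmul (qmul T gam) (qconj T') = - qconj (qmul (qmul T' gam) (qconj T)).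
    by rewrite !qconjM qconjK cgam qmulNl qmulNr opprK qmulA.
  by move=> ->; rewrite mul0r !quatE qconjE /qsg eqxx; ring.
rewrite quatE quatE im1 im_qmul_conj qmul_polar quatB quatE {im1 cgam}.
have E := im_qmul_mid T' T j.
set M := 2^-1 *: (T + T') in E *; set D := T' - T in E *.
clearbody M D; rewrite (qmulDl D) quatE qmulZl quatE.
have -> : qmul (qmul M gam) (qconj M) 0 j = qmul (qmul M Da) (qconj M) 0 j -
    qmul (qmul M eta) (qconj M) 0 j - qmul (qmul M kap) (qconj M) 0 j.
  by rewrite gamE !(qmulDr M, qmulNr M, qmulDl, qmulNl) !quatE.
(* What linearity leaves is the comparison of [D conj(T)] with [D conj(M)], which have the same
   imaginary part by [E]. *)
apply/eqP; rewrite -subr_eq0; apply/eqP.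
set c := _%:R in E *; set u := qmul D (qconj M) 0 j in E *.
set v := qmul D (qconj T) 0 j in E *.
transitivity (c * v - c * u); first by ring.
by rewrite E subrr.
Qed.

Definition alc (a b j : 'I_4) : R := 2^-1 * (qc a b j * qsg b - qc b a j * qsg a).

Lemma alpha_formE m (q h : hvec R m) j : alpha_form q h 0 j =
  \sum_(l : 'I_m * ('I_4 * 'I_4)) alc l.2.1 l.2.2 j * (q l.1 l.2.2 * h l.1 l.2.1).
Proof.
rewrite quatE summxE mulr_sumr -(pair_bigA _ (fun i l => alc l.1 l.2 j * (q i l.2 * h i l.1)))/=.
apply: eq_bigr => i _; rewrite !quatE !qmulE.
rewrite -(pair_bigA _ (fun a b => alc a b j * (q i b * h i a)))/=.
rewrite [X in _ - X]exchange_big/= -sumrB mulr_sumr; apply: eq_bigr => a _.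
rewrite -sumrB mulr_sumr; apply: eq_bigr => b _.
by rewrite !qconjE !mxE /alc; ring.
Qed.

Lemma alpha_form_anti m (q h : hvec R m) : alpha_form q h = - alpha_form h q.
Proof.
by rewrite /alpha_form -scalerN -sumrN; congr (_ *: _); apply: eq_bigr => i _; rewrite opprB.
Qed.

Lemma alpha_formB m (q h k : hvec R m) :
  alpha_form q (h - k) = alpha_form q h - alpha_form q k.
Proof.
apply/rowP => j; rewrite quatB !alpha_formE -sumrB; apply: eq_bigr => l _.
by rewrite !mxE; ring.
Qed.

Lemma alpha_form_diag m (q : hvec R m) : alpha_form q q = 0.
Proof.
by rewrite /alpha_form big1 ?scaler0// => i _; rewrite subrr.
Qed.

Lemma alpha_formZ m (q h : hvec R m) (a b : R) :
  alpha_form (a *: q) (b *: h) = (a * b) *: alpha_form q h.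
Proof.
apply/rowP => j; rewrite [RHS]quatE !alpha_formE mulr_sumr; apply: eq_bigr => l _.
by rewrite !mxE; ring.
Qed.

Lemma alpha_form_im0 m (q h : hvec R m) : alpha_form q h 0 (inord 0) = 0.
Proof.
rewrite quatE summxE big1 ?mulr0// => i _.
by rewrite !quatE !qmulE0 !mkquatE /qconj /qcoord ?mkquatE; ring.
Qed.

(** By bilinearity and antisymmetry both endpoint terms equal [alpha_form q h]. Hence a step of the
    Stratonovich sum of the connection form depends only on the form at the pair of endpoints. *)
Lemma alpha_form_mean m (q h : hvec R m) :
  2^-1 *: (alpha_form q (h - q) + alpha_form h (h - q)) = alpha_form q h.
Proof.
rewrite !alpha_formB !alpha_form_diag subr0 sub0r -alpha_form_anti.
by move: (alpha_form q h) => A; apply/rowP => j; rewrite !quatE; field.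
Qed.

(** The last coordinate is the constant 1 in both vectors, and its contribution cancels. *)
Lemma alpha_form_chart n (w v : hvec R n) :
  alpha_form (col_mx w qone) (col_mx v qone) = alpha_form w v.
Proof.
rewrite /alpha_form big_split_ord/= [X in _ + X]big1 ?addr0.
  by congr (_ *: _); apply: eq_bigr => i _; rewrite !rowKu.
by move=> i _; rewrite !rowKd subrr.
Qed.

(** Splits the quaternionic Hermitian product into its real part, the Euclidean product, and its
    imaginary part, the connection form. *)
Lemma gram_im m (y h : hvec R m) :
  \sum_i qmul (row i h) (qconj (row i y)) = hdot h y *: qone + alpha_form y h.
Proof.
apply/rowP => j; rewrite !quatE !summxE mulr_sumr /hdot mulr_suml.
rewrite -big_split/=; apply: eq_bigr => i _; rewrite sum_quat !quatE.
by elim/quat_ind: j; rewrite !qmulE0 !mkquatE /qconj /qcoord ?mkquatE !mxE; field.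
Qed.

Lemma alpha_form_hlmul m (T T' : quat R) (y y' : hvec R m) :
  alpha_form (hlmul T y) (hlmul T' y') =
  2^-1 *: (qmul (qmul T' (hdot y' y *: qone + alpha_form y y')) (qconj T) -
    qmul (qmul T (qconj (hdot y' y *: qone + alpha_form y y'))) (qconj T')).
Proof.
rewrite -gram_im qconj_sum !(qmul_sum, qmul_suml) -sumrB; congr (_ *: _).
apply: eq_bigr => i _; rewrite !row_hlmul !qconjM qconjK !qmulA.
by [].
Qed.

Lemma hdot_unit m (y h : hvec R m) : hnorm2 y = 1 -> hnorm2 h = 1 ->
  1 - hdot h y = 2^-1 * hnorm2 (h - y).
Proof.
move=> y1 h1.
have -> : hnorm2 (h - y) = hnorm2 h + hnorm2 y - 2 * hdot h y.
  rewrite /hnorm2 /hdot mulr_sumr -big_split -sumrB/=; apply: eq_bigr => i _.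
  rewrite mulr_sumr -big_split -sumrB/=; apply: eq_bigr => j _.
  by rewrite !mxE; ring.
by rewrite y1 h1; field.
Qed.

End HorizontalIncrement.

(** * The horizontal lift *)

Section NegligibleSums.
Context {R : realType} {d : measure_display} {Omega : measurableType d}.
Context (P : probability Omega R) (N : nat -> nat).
Implicit Types (A B C : nat -> nat -> Omega -> R).

Definition negl A := opa P N (psum A).

Lemma negl_ext A B : negl B -> (forall k i x, A k i x = B k i x) -> negl A.
Proof. by move=> hB AB; apply: (opa_ext hB) => k i x _; apply: eq_bigr => j _; exact: AB. Qed.

Lemma neglD A B : negl A -> negl B -> negl (fun k i x => A k i x + B k i x).
Proof. by move=> hA hB; apply: (opa_ext (opaD hA hB)) => k i x _; rewrite psumD. Qed.

Lemma neglZ c A : negl A -> negl (fun k i x => c * A k i x).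
Proof. by move=> hA; apply: (opa_ext (opaZ c hA)) => k i x _; rewrite psumZ. Qed.

Lemma neglB A B : negl A -> negl B -> negl (fun k i x => A k i x - B k i x).
Proof.
move=> hA hB; apply: (negl_ext (neglD hA (neglZ (-1) hB))) => k i x.
by rewrite mulN1r.
Qed.

Lemma negl_sum (I : Type) (r : seq I) (A : I -> nat -> nat -> Omega -> R) :
  (forall l, negl (A l)) -> negl (fun k i x => \sum_(l <- r) A l k i x).
Proof.
by move=> hA; apply: (opa_ext (opa_sum r hA)) => k i x _; rewrite psum_sum.
Qed.

Lemma negl_qmul (A B : nat -> nat -> Omega -> quat R) j :
  (forall a b, negl (fun k i x => A k i x 0 a * B k i x 0 b)) ->
  negl (fun k i x => qmul (A k i x) (qconj (B k i x)) 0 j).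
Proof.
move=> h; apply: (negl_ext (negl_sum (index_enum 'I_4) (fun a =>
  negl_sum (index_enum 'I_4) (fun b => neglZ (qc a b j * qsg b) (h a b))))) => k i x.
rewrite qmulE; apply: eq_bigr => a _; apply: eq_bigr => b _.
by rewrite qconjE; ring.
Qed.

Lemma negl_qmul3 (A B C : nat -> nat -> Omega -> quat R) j :
  (forall a b c, negl (fun k i x => A k i x 0 a * B k i x 0 b * C k i x 0 c)) ->
  negl (fun k i x => qmul (qmul (A k i x) (B k i x)) (qconj (C k i x)) 0 j).
Proof.
move=> h; apply: (negl_qmul (A := fun k i x => qmul (A k i x) (B k i x))) => e c.
apply: (negl_ext (negl_sum (index_enum 'I_4) (fun a =>
  negl_sum (index_enum 'I_4) (fun b => neglZ (qc a b e) (h a b c))))) => k i x.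
rewrite qmulE mulr_suml; apply: eq_bigr => a _; rewrite mulr_suml.
by apply: eq_bigr => b _; ring.
Qed.

End NegligibleSums.

Lemma stratonovich_sumE {R : realType} {d : measure_display} {Omega : measurableType d}
    m p (eta : hvec R m -> hvec R p -> quat R) (X : R -> Omega -> hvec R m)
    (Y : R -> Omega -> hvec R p) (I : finType) (c : I -> R) (f : I -> hvec R m -> R)
    (r : I -> 'I_p) (e : I -> 'I_4) (j : 'I_4) s x :
  (forall q h, eta q h 0 j = \sum_l c l * (f l q * h (r l) (e l))) ->
  stratonovich_sum eta X Y s x 0 j = \sum_(0 <= i < size s) \sum_l c l *
     (2^-1 * (f l (X (nth 0 (0 :: s) i) x) + f l (X (nth 0 (0 :: s) i.+1) x)) *
      (Y (nth 0 (0 :: s) i.+1) x (r l) (e l) - Y (nth 0 (0 :: s) i) x (r l) (e l))).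
Proof.
move=> etaE; rewrite /stratonovich_sum summxE; apply: eq_bigr => i _.
rewrite mxE [X in _ * X]mxE !etaE -big_split mulr_sumr/=; apply: eq_bigr => l _.
by rewrite !mxE; ring.
Qed.

Lemma area_formE {R : realType} n (w h : hvec R n) (j : 'I_4) :
  area_form w h 0 j = \sum_(l : 'I_n * ('I_4 * 'I_4)) alc l.2.1 l.2.2 j *
    ((1 + hnorm2 w)^-1 * w l.1 l.2.2 * h l.1 l.2.1).
Proof.
rewrite /area_form mxE alpha_formE mulr_sumr; apply: eq_bigr => l _.
by ring.
Qed.

Lemma sde_formE {R : realType} (q h : quat R) (j : 'I_4) :
  (- qmul q h) 0 j = \sum_(l : 'I_4 * 'I_4) - qc l.1 l.2 j * (q 0 l.1 * h 0 l.2).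
Proof.
rewrite mxE qmulE -sumrN -(pair_bigA _ (fun a b => - qc a b j * (q 0 a * h 0 b)))/=.
apply: eq_bigr => a _; rewrite -sumrN; apply: eq_bigr => b _.
by rewrite mulNr.
Qed.

(** * The lift [X = Theta Y]: semimartingale property, and vanishing of the sums of the connection
    form *)

Section HorizontalLift.
Context {R : realType} {d : measure_display} {Omega : measurableType d}.
Context (P : probability Omega R) (F : R -> set (set Omega)) (n : nat).
Context (F_usual : usual_filtration P F).
Context (w : R -> Omega -> hvec R n) (a Theta : R -> Omega -> quat R).
Context (a_area : stochastic_area P F w a).
Context (Theta_strat : stratonovich_integral P F (fun q h => - qmul q h) Theta a
        (fun t x => Theta t x - Theta 0 x)).

Local Notation semi := (cont_semimartingale P F).

Let rho t x := (Num.sqrt (1 + hnorm2 (w t x)))^-1.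
Let Y t x : hvec R (n + 1) := rho t x *: col_mx (w t x) qone.
Let X t x : hvec R (n + 1) := hlmul (Theta t x) (Y t x).

Lemma semimart_chart i j : semi (fun t x => w t x i j).
Proof. by have [h _ _ _] := a_area; exact: h. Qed.

Lemma semimart_frame j : semi (fun t x => Theta t x 0 j).
Proof. by have [h _ _ _] := Theta_strat; exact: h. Qed.

Lemma semimart_area j : semi (fun t x => a t x 0 j).
Proof. by have [_ h _ _] := Theta_strat; exact: h. Qed.

Lemma base_gt0 t x : 0 < 1 + hnorm2 (w t x).
Proof. by rewrite ltr_wpDr ?hnorm2_ge0. Qed.

Lemma rho_sqr t x : rho t x ^+ 2 = (1 + hnorm2 (w t x))^-1.
Proof. by rewrite exprVn sqr_sqrtr// ltW// base_gt0. Qed.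

Lemma semimart_rho : semi rho.
Proof.
apply: (semimart_rsqrt F_usual (X := fun t x => hnorm2 (w t x))).
  apply: (semimart_sum F_usual) => i; apply: (semimart_sum F_usual) => j.
  by apply: (semimartM F_usual); exact: semimart_chart.
by move=> t x; exact: hnorm2_ge0.
Qed.

Lemma semimart_unit i j : semi (fun t x => Y t x i j).
Proof.
have -> : (fun t x => Y t x i j) = fun t x => rho t x * col_mx (w t x) qone i j.
  by apply/funext => t; apply/funext => x; rewrite mxE.
apply: (semimartM F_usual); first exact: semimart_rho.
rewrite -(splitK i); case: (fintype.split i) => l /=.
  by under eq_fun do under eq_fun do rewrite col_mxEu; exact: semimart_chart.
by under eq_fun do under eq_fun do rewrite col_mxEd; exact: (semimart_cst F_usual).
Qed.

Lemma semimart_scaled i j : semi (fun t x => (1 + hnorm2 (w t x))^-1 * w t x i j).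
Proof.
rewrite (_ : (fun _ _ => _) = fun t x => rho t x ^+ 2 * w t x i j).
  apply: (semimartM F_usual); last exact: semimart_chart.
  by apply: (semimart_sqr F_usual); exact: semimart_rho.
by apply/funext => t; apply/funext => x; rewrite rho_sqr.
Qed.

Lemma semimart_lift i j : semi (fun t x => X t x i j).
Proof.
rewrite (_ : (fun _ _ => _) = fun t x =>
  \sum_b \sum_e qc b e j * (Theta t x 0 b * Y t x i e)).
  apply: (semimart_sum F_usual) => b; apply: (semimart_sum F_usual) => e.
  apply: (semimartZ F_usual); apply: (semimartM F_usual); first exact: semimart_frame.
  exact: semimart_unit.
apply/funext => t; apply/funext => x; rewrite mxE qmulE.
by apply: eq_bigr => b _; apply: eq_bigr => e _; rewrite [row _ _ _ _]mxE.
Qed.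

Lemma hnorm2_col (v : hvec R n) : hnorm2 (col_mx v qone) = 1 + hnorm2 v.
Proof.
rewrite hnorm2_rows big_split_ord/= big_ord1 addrC; congr (_ + _).
  by rewrite rowKd row_id hnorm2_quat sum_quat !mkquatE; ring.
by rewrite (hnorm2_rows v); apply: eq_bigr => i _; rewrite rowKu.
Qed.

Lemma hnorm2_unit t x : hnorm2 (Y t x) = 1.
Proof. by rewrite hnorm2Z hnorm2_col rho_sqr mulVf// gt_eqF// base_gt0. Qed.

Section FixedPartition.
Context (t : R) (t0 : 0 <= t) (s : nat -> seq R).
Context (hs : forall k, itv_partition 0 t (s k)).
Context (hm : forall e : R, 0 < e -> \forall k \near \oo, mesh_le (s k) e).

Let p := fun k => ppt t (s k).
Let N := fun k => size (s k).

Local Notation negl := (negl P N).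
Local Notation opa := (opa P N).
Local Notation bpa := (bpa P N).
Local Notation inc := (arr_inc p).
Local Notation th b := (fun t x => Theta t x 0 b).

Lemma lift_grid k : grid t (p k). Proof. exact: ppt_grid. Qed.

Lemma lift_mesh e : 0 < e -> \forall k \near \oo, forall i, p k i.+1 - p k i <= e.
Proof. by move=> e0; apply: filterS (hm e0) => k h; apply: ppt_mesh => //; exact: ltW. Qed.

Let bpt Z : semi Z -> bpa (arr_pt p Z) := @semimart_bpa _ _ _ _ _ F_usual _ t0 N _ lift_grid Z.
Let oinc Z : semi Z -> opa (inc Z) := @semimart_opa_inc _ _ _ _ _ F_usual _ t0 N _ lift_grid lift_mesh Z.
Let othird A Z Z' : semi Z -> semi Z' -> opa A ->
  negl (fun k i x => A k i x * (inc Z k i x * inc Z' k i x)) :=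
  @semimart_opa_third _ _ _ _ _ F_usual _ t0 N _ lift_grid A Z Z'.

(** Errors of the two Stratonovich equations, in components: [epsilon] for that of [Theta], [eta]
    for that of the area. *)
Let epsilon j := serr_arr p (fun l : 'I_4 * 'I_4 => - qc l.1 l.2 j)
  (fun l t x => Theta t x 0 l.1) (fun l t x => a t x 0 l.2) (fun t x => Theta t x 0 j).

Let eta j := serr_arr p (fun l : 'I_n * ('I_4 * 'I_4) => alc l.2.1 l.2.2 j)
  (fun l t x => (1 + hnorm2 (w t x))^-1 * w t x l.1 l.2.2)
  (fun l t x => w t x l.1 l.2.1) (fun t x => a t x 0 j).

Lemma negl_epsilon j :
  (forall A, bpa (psum (fun k i x => A k i x ^+ 2)) ->
    negl (fun k i x => A k i x * epsilon j k i x)) /\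
  (forall H, semi H -> negl (fun k i x => arr_pt p H k i x * epsilon j k i x)).
Proof.
have [_ _ _ hcv] := Theta_strat.
pose S r x := stratonovich_sum (fun q h => - qmul q h) Theta a r x 0 j.
have SE r x : S r x = _ := stratonovich_sumE _ _ _ _ (fun q h => sde_formE q h j).
have {}hcv q : 0 <= q -> forall r : nat -> seq R, (forall k, itv_partition 0 q (r k)) ->
     (forall e : R, 0 < e -> \forall k \near \oo, mesh_le (r k) e) ->
     cvg_in_probability P (fun k => S (r k)) (fun x => Theta q x 0 j - Theta 0 x 0 j).
  move=> q0 r hr hrm; have := hcv q q0 r hr hrm j.
  by congr (cvg_in_probability _ _ _); apply/funext => x; exact: quatB.
split=> [A|H].
  exact: (semimart_serr_CS F_usual (fun l => semimart_frame l.1)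
    (fun l => semimart_area l.2) SE (semimart_frame j) hcv t0 hs hm).
exact: (semimart_serr_pr F_usual (fun l => semimart_frame l.1)
    (fun l => semimart_area l.2) SE (semimart_frame j) hcv t0 hs hm).
Qed.

Lemma negl_eta j :
  (forall A, bpa (psum (fun k i x => A k i x ^+ 2)) ->
    negl (fun k i x => A k i x * eta j k i x)) /\
  (forall H, semi H -> negl (fun k i x => arr_pt p H k i x * eta j k i x)).
Proof.
have [_ _ _ hcv] := a_area.
pose S r x := stratonovich_sum (@area_form R n) w w r x 0 j.
have SE r x : S r x = _ := stratonovich_sumE _ _ _ _ (fun w h => area_formE w h j).
have {}hcv := strat_cvg_init F_usual (fun l => semimart_scaled l.1 l.2.2)
  (fun l => semimart_chart l.1 l.2.1) SE (semimart_area j)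
  (fun q q0 r hr hrm => hcv q q0 r hr hrm j).
split=> [A|H].
  exact: (semimart_serr_CS F_usual (fun l => semimart_scaled l.1 l.2.2)
    (fun l => semimart_chart l.1 l.2.1) SE (semimart_area j) hcv t0 hs hm).
exact: (semimart_serr_pr F_usual (fun l => semimart_scaled l.1 l.2.2)
    (fun l => semimart_chart l.1 l.2.1) SE (semimart_area j) hcv t0 hs hm).
Qed.

Let T k i x := Theta (p k i) x.
Let D k i x := Theta (p k i.+1) x - Theta (p k i) x.
Let M k i x := 2^-1 *: (Theta (p k i) x + Theta (p k i.+1) x).
Let B k i x := alpha_form (w (p k i) x) (w (p k i.+1) x).

Lemma frame_incE k i x b : D k i x 0 b = inc (th b) k i x.
Proof. by rewrite quatB. Qed.

Lemma frame_midE k i x b : M k i x 0 b = arr_pt p (th b) k i x + 2^-1 * inc (th b) k i x.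
Proof. by rewrite !quatE /arr_pt /arr_inc; field. Qed.

Lemma bpa_mid b : bpa (fun k i x => M k i x 0 b).
Proof.
apply: (bpa_ext (bpaD (bpt (semimart_frame b))
  (opa_bpa (opaZ 2^-1 (oinc (semimart_frame b)))))) => k i x _.
exact: frame_midE.
Qed.

Lemma opa_B b : opa (fun k i x => B k i x 0 b).
Proof.
apply: (opa_ext (opa_sum (index_enum ('I_n * ('I_4 * 'I_4))%type) (fun l => opaZ (alc l.2.1 l.2.2 b)
  (opaM (oinc (semimart_chart l.1 l.2.1)) (bpt (semimart_chart l.1 l.2.2)))))) => k i x _.
have -> : B k i x = alpha_form (w (p k i) x) (w (p k i.+1) x - w (p k i) x).
  by rewrite alpha_formB alpha_form_diag subr0.
rewrite alpha_formE; apply: eq_bigr => l _.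
by rewrite !mxE /arr_inc /arr_pt; ring.
Qed.

(** As [Y] is a unit vector, one minus the inner product is half of the squared increment of [Y];
    with [D] this makes three increments. *)
Lemma negl_defect j : negl (fun k i x =>
  qmul ((1 - hdot (Y (p k i.+1) x) (Y (p k i) x)) *: D k i x) (qconj (T k i x)) 0 j).
Proof.
apply: (negl_qmul (A := fun k i x => _ *: D k i x) (B := T)) => b c.
apply: (negl_ext (neglZ 2^-1 (negl_sum (index_enum 'I_(n + 1)) (fun l =>
   negl_sum (index_enum 'I_4) (fun e => othird (semimart_unit l e) (semimart_unit l e)
     (opaM (oinc (semimart_frame b)) (bpt (semimart_frame c)))))))) => k i x.
have mB (A A' : hvec R (n + 1)) l e : (A - A') l e = A l e - A' l e by rewrite !mxE.
rewrite quatE hdot_unit ?hnorm2_unit// frame_incE -!mulrA; congr (_ * _).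
rewrite /hnorm2 /hdot mulr_suml; apply: eq_bigr => l _; rewrite mulr_suml.
apply: eq_bigr => e _; rewrite mB /arr_inc /T /arr_pt.
by ring.
Qed.

(** [D + M Da] is the error [epsilon]. The weight [M] is a left-endpoint value plus half an
    increment, and each of the two estimates of [negl_epsilon] takes care of one part. *)
Lemma negl_sde j : negl (fun k i x =>
  qmul (D k i x + qmul (M k i x) (a (p k i.+1) x - a (p k i) x)) (qconj (M k i x)) 0 j).
Proof.
apply: negl_qmul => b c; have [h1 h2] := negl_epsilon b.
apply: (negl_ext (neglD (h2 _ (semimart_frame c))
  (neglZ 2^-1 (h1 _ (@semimart_bpa_qv _ _ _ _ _ F_usual _ t0 N _ lift_grid _ (semimart_frame c)))))).
move=> k i x; rewrite frame_midE quatE.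
have -> : D k i x 0 b + qmul (M k i x) (a (p k i.+1) x - a (p k i) x) 0 b = epsilon b k i x.
  rewrite /epsilon /serr_arr /serr quatB qmulE -sumrN; congr (_ + _).
  rewrite (pair_bigA _ (fun l e => qc l e b * (M k i x 0 l * (a (p k i.+1) x - a (p k i) x) 0 e))).
  by apply: eq_bigr => l _; rewrite quatB /M !quatE; ring.
by ring.
Qed.

(** The middle factor is the error [eta]: the trapezoidal rule for [area_form] averages [rho ^+ 2]
    over the endpoints. Expanding both factors [M] gives one term weighted by a semimartingale and
    three weighted by arrays whose sums of squares are bounded in probability. *)
Lemma negl_area j : negl (fun k i x => qmul (qmul (M k i x)
  (a (p k i.+1) x - a (p k i) x - (2^-1 * (rho (p k i) x ^+ 2 + rho (p k i.+1) x ^+ 2)) *: B k i x))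
  (qconj (M k i x)) 0 j).
Proof.
apply: negl_qmul3 => b e c; have [h1 h2] := negl_eta e.
have sb := semimart_frame b; have sc := semimart_frame c.
have le A Z : bpa A -> semi Z -> bpa (psum (fun k i x => (A k i x * inc Z k i x) ^+ 2)).
  exact: (@bpa_psum_le _ _ _ _ _ F_usual _ t0 N _ lift_grid).
have o1 := h2 _ (semimartM F_usual sb sc).
have o2 := h1 _ (le _ _ (bpt sb) sc).
have o3 := h1 _ (le _ _ (bpt sc) sb).
have o4 := h1 _ (le _ _ (opa_bpa (oinc sb)) sc).
apply: (negl_ext (neglD (neglD o1 (neglZ 2^-1 o2)) (neglD (neglZ 2^-1 o3) (neglZ 4^-1 o4)))).
move=> k i x; rewrite !frame_midE.
have -> : (a (p k i.+1) x - a (p k i) x -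
   (2^-1 * (rho (p k i) x ^+ 2 + rho (p k i.+1) x ^+ 2)) *: B k i x) 0 e = eta e k i x.
  rewrite !quatB quatE /eta /serr_arr /serr; congr (_ - _).
  have -> : B k i x = alpha_form (w (p k i) x) (w (p k i.+1) x - w (p k i) x).
    by rewrite alpha_formB alpha_form_diag subr0.
  have E : (2^-1 * (rho (p k i) x ^+ 2 + rho (p k i.+1) x ^+ 2)) *:
      alpha_form (w (p k i) x) (w (p k i.+1) x - w (p k i) x) =
    2^-1 *: (area_form (w (p k i) x) (w (p k i.+1) x - w (p k i) x) +
             area_form (w (p k i.+1) x) (w (p k i.+1) x - w (p k i) x)).
    rewrite /area_form -!rho_sqr -scalerA scalerDl; congr (_ *: (_ + _ *: _)).
    by rewrite !alpha_formB !alpha_form_diag subr0 sub0r -alpha_form_anti.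
  rewrite -quatE E quatE quatE !area_formE -big_split mulr_sumr/=.
  by apply: eq_bigr => l _; rewrite !mxE; ring.
by rewrite /arr_pt /arr_inc; field.
Qed.

(** The area carries the average of the squares of [rho] at the endpoints where [Y] carries their
    product. The discrepancy is half of the squared increment of [rho], and it multiplies [B],
    itself of the size of an increment of [w]. *)
Lemma negl_kap j : negl (fun k i x => qmul (qmul (M k i x)
  ((2^-1 * (rho (p k i.+1) x - rho (p k i) x) ^+ 2) *: B k i x)) (qconj (M k i x)) 0 j).
Proof.
apply: negl_qmul3 => b e c.
apply: (negl_ext (othird semimart_rho semimart_rho
  (opaM (opaZ 2^-1 (opa_B e)) (bpaM (bpa_mid b) (bpa_mid c))))) => k i x.
by rewrite (quatE.2 _ (B k i x)) /arr_inc; ring.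
Qed.

(** Two increments of [Theta] and the small factor [B]. *)
Lemma negl_quad j : negl (fun k i x => qmul (qmul (D k i x)
  ((rho (p k i) x * rho (p k i.+1) x) *: B k i x)) (qconj (D k i x)) 0 j).
Proof.
apply: negl_qmul3 => b e c.
have br : bpa (fun k i x => rho (p k i.+1) x).
  apply: (bpa_ext (bpaD (bpt semimart_rho) (opa_bpa (oinc semimart_rho)))) => k i x _.
  by rewrite /arr_pt /arr_inc; ring.
apply: (negl_ext (othird (semimart_frame b) (semimart_frame c)
  (opaM (opa_B e) (bpaM (bpt semimart_rho) br)))) => k i x.
by rewrite (quatE.2 _ (B k i x)) !frame_incE /arr_pt; ring.
Qed.

(** [horizontal_increment] is applied with [kap] equal to half of the squared increment of [rho]
    times [B]: then [Da - eta - kap] is the product of both values of [rho] with [B], which is the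
    connection form between the two values of [Y]. *)
Lemma negl_lift j : negl (fun k i x => alpha_form (X (p k i) x) (X (p k i.+1) x) 0 j).
Proof.
apply: (negl_ext (neglZ (j != inord 0)%:R (neglB (neglB (neglB (neglB (negl_sde j)
  (negl_defect j)) (negl_area j)) (negl_kap j)) (neglZ 4^-1 (negl_quad j))))) => k i x.
rewrite alpha_form_hlmul.
have YE : alpha_form (Y (p k i) x) (Y (p k i.+1) x) = (rho (p k i) x * rho (p k i.+1) x) *: B k i x.
  by rewrite alpha_formZ alpha_form_chart.
rewrite YE; apply: horizontal_increment; first by rewrite -YE alpha_form_im0.
by apply/rowP => b; rewrite !(quatE, quatB); field.
Qed.

End FixedPartition.

Lemma strat_lift : stratonovich_integral P F (@alpha_form R (n + 1)) X X (fun _ _ => 0).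
Proof.
split; try by move=> i j; exact: semimart_lift.
  move=> j; rewrite (_ : (fun _ _ => _) = fun _ _ : _ => 0 : R); last first.
    by apply/funext => t; apply/funext => x; rewrite mxE.
  split; first exact: (semimart_adapted (semimart_cst F_usual 0)).
  by apply: nearW => x; apply: continuous_subspaceT => y; exact: cvg_cst.
move=> t t0 s hs hm j.
have alE (q h : hvec R (n + 1)) : alpha_form q h 0 j = _ := alpha_formE q h j.
have SE r x := @stratonovich_sumE R _ _ _ _ (@alpha_form R (n + 1)) X X _ _
  (fun l q => q l.1 l.2.2) (fun l => l.1) (fun l => l.2.1) j r x alE.
have mS k := @meas_strat_sum _ _ _ _ _ F_usual _ _ _ _ _
  (fun l => semimart_lift l.1 l.2.2) (fun l => semimart_lift l.1 l.2.1) SE _ _ (hs k).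
apply: cvg_of_op1 => //.
move=> e ep e0 ep0; move: (negl_lift t0 hs hm j e0 ep0).
apply: filterS => k [B [mB PB hB]]; exists B; split => // x xB.
(* Of the uniform bound on partial sums only the one over the whole row is used here. *)
have := hB x xB _ (leqnn _); congr (`|_| < _).
have Z0 : (0 : quat R) ord0 j = 0 by rewrite mxE.
rewrite Z0 subr0 /stratonovich_sum summxE big_mkord /psum.
by apply: eq_bigr => i _; rewrite alpha_form_mean !ppt_nth0// ltnW.
Qed.

End HorizontalLift.

Theorem theorem4p2 (R : realType) (d : measure_display)
    (Omega : measurableType d) (P : probability Omega R)
    (F : R -> set (set Omega)) (n : nat)
    (w : R -> Omega -> 'M[R]_(n, 4)) (a Theta : R -> Omega -> 'rV[R]_4)
    (n_ge1 : (1 <= n)%N)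
    (F_usual : usual_filtration P F)
    (w_bm : brownian_motion_HP P F w)
    (a_area : stochastic_area P F w a)
    (Theta_sde : solves_area_sde P F a Theta) :
  horizontal_lift P F w
    (fun t x => (Num.sqrt (1 + hnorm2 (w t x)))^-1 *:
                hlmul (Theta t x) (col_mx (w t x) qone)).
Proof.
have [_ w0 _] := w_bm; have [T1 T0 Ts] := Theta_sde.
(* Real scalars commute with left multiplication; moved inside, the scalar makes the vector on which
   [Theta] acts a unit vector. *)
have XE : (fun t x => (Num.sqrt (1 + hnorm2 (w t x)))^-1 *:
    hlmul (Theta t x) (col_mx (w t x) qone)) =
  fun t x => hlmul (Theta t x) ((Num.sqrt (1 + hnorm2 (w t x)))^-1 *: col_mx (w t x) qone).
  apply/funext => t; apply/funext => x; apply/row_matrixP => i.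
  by rewrite row_hlmul !linearZ/= row_hlmul qmulZr.
rewrite {}XE; split.
- by move=> i j; exact: (semimart_lift F_usual a_area Ts).
- apply: filterS T1 => x T1 t t0.
  by rewrite /sphere /= hnorm2_hlmul hnorm2_unit mulr1; exact: T1.
- apply: filterS2 w0 T0 => x w0 T0; rewrite w0 T0.
  rewrite (_ : hnorm2 0 = 0) ?addr0 ?sqrtr1 ?invr1 ?scale1r; last first.
    by rewrite /hnorm2 /hdot big1// => i _; rewrite big1// => j _; rewrite mxE mul0r.
  by apply/row_matrixP => i; rewrite row_hlmul qmul1q.
- apply: filterS T1 => x T1 t t0.
  set r := (Num.sqrt _)^-1; set T := Theta t x.
  have r0 : r != 0 by rewrite invr_eq0 gt_eqF// sqrtr_gt0 base_gt0.
  (* The last quaternion of [X] is [r Theta], so multiplying by its inverse removes the scalar and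
     the rotation together and leaves [w]. *)
  have dE : dsubmx (hlmul T (r *: col_mx (w t x) qone)) = r *: T.
    apply/row_matrixP => i; rewrite row_dsubmx row_hlmul; apply/rowP => j.
    by rewrite linearZ/= rowKd qmulZr !ord1 row_id qmulq1 row_id.
  have N1 : hnorm2 (r *: T) != 0.
    by rewrite hnorm2Z (T1 t t0) mulr1 expf_neq0.
  rewrite /in_chart dE; split.
    by apply/eqP => h; move: N1; rewrite h -(scale0r T) hnorm2Z expr0n mul0r eqxx.
  apply/row_matrixP => i; rewrite row_hlmul row_usubmx row_hlmul.
  by rewrite linearZ/= rowKu qmulZr -qmulZl qmulA qinvM// qmul1q.
- exact: (strat_lift F_usual a_area Ts).
Qed.
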